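(* Let the RDD method (described in the context) be applied, with $N\ge1$ iterations and batch size $m\ge1$, to the problem $\min_{x\in\mathbb{R}^n} f(x)$, $f(x)=\mathbb{E}_\xi[F(x,\xi)]$, under the assumptions listed in the context. Then its output $\bar x_N$ satisfies $$\mathbb{E}[f(\bar x_N)]-f(x^* )\le\frac{384n\rho_nL_2\Theta_p}{N}+\frac{2}{L_2}\frac{\sigma^2}{m}+\frac{n}{12L_2}\Delta_\zeta+\frac{4n}{3L_2}\Delta_\eta^2+\frac{8\sqrt{2n\Theta_p}}{N}\left(\frac{\sqrt{\Delta_\zeta}}{2}+2\Delta_\eta\right)+\frac{N}{3L_2\rho_n}\left(\frac{\sqrt{\Delta_\zeta}}{2}+2\Delta_\eta\right)^2,$$ where $\Theta_p=V[x_0](x^* )$ and $\mathbb{E}$ is the expectation over all the randomness $e_1,\dots,e_N,\xi_{1,1},\dots,\xi_{N,m}$ of the method.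
   Context: Problem. $n\ge 8$; $\xi$ is a random vector with distribution $P$ on $\mathcal{X}$; for $P$-almost every $\xi$ the function $F(\cdot,\xi):\mathbb{R}^n\to\mathbb{R}$ is closed and convex and has gradient $g(x,\xi)$ that is $L(\xi)$-Lipschitz in the Euclidean norm, with $\sqrt{\mathbb{E}_\xi L(\xi)^2}\le L_2<+\infty$, $L_2>0$. Then $\mathbb{E}_\xi g(x,\xi)=\nabla f(x)$ and $\nabla f$ is $L_2$-Lipschitz in the Euclidean norm. Also $\mathbb{E}_\xi\|g(x,\xi)-\nabla f(x)\|_2^2\le\sigma^2$ for all $x$. A minimizer $x^*$ of $f$ exists (fixed). Oracle. Let $S_2(1)$ be the unit Euclidean sphere centered at $0$ in $\mathbb{R}^n$, and write $e\in RS_2(1)$ for $e$ uniformly distributed on $S_2(1)$. For $x\in\mathbb{R}^n$, $e\in S_2(1)$ and $\xi$ drawn independently from $P$, the oracle returns $\tilde f'(x,\xi,e)=\langle g(x,\xi),e\rangle+\zeta(x,\xi,e)+\eta(x,\xi,e)$, where $\mathbb{E}_\xi(\zeta(x,\xi,e))^2\le\Delta_\zeta$ for all $x,e$, and $|\eta(x,\xi,e)|\le\Delta_\eta$ for all $x,e$ and almost surely in $\xi$. Proximal setup. $p\in[1,2]$, $\frac1p+\frac1q=1$ (so $q\in[2,\infty]$), $\|\cdot\|_p$ is the usual $p$-norm. The prox-function $d$ is continuous, convex and 1-strongly convex on $\mathbb{R}^n$ w.r.t. $\|\cdot\|_p$, i.e. $d(y)-d(x)-\langle\nabla d(x),y-x\rangle\ge\frac12\|y-x\|_p^2$,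 with $\min d=0$. For $p=1$ the choice is $d(x)=\frac{\mathrm{e}\,n^{(\kappa-1)(2-\kappa)/\kappa}\ln n}{2}\|x\|_\kappa^2$ with $\kappa=1+\frac1{\ln n}$; for $p=2$ it is $d(x)=\frac12\|x\|_2^2$. Bregman divergence: $V[z](x)=d(x)-d(z)-\langle\nabla d(z),x-z\rangle$. Put $\rho_n=\min\{q-1,\,16\ln n-8\}\,n^{\frac2q-1}$ (for $q=\infty$: $q-1=\infty$, $2/q=0$). RDD method (input: starting point $x_0$, $N$, $m$). Put $\alpha=\frac1{48n\rho_nL_2}$. For $k=0,\dots,N-1$: draw $e_{k+1}\in RS_2(1)$ and independent realizations $\xi_{k+1,1},\dots,\xi_{k+1,m}$ of $\xi$, independently of the past; compute $\widetilde\nabla^mf(x_k)=\frac1m\sum_{i=1}^m\tilde f'(x_k,\xi_{k+1,i},e_{k+1})\,e_{k+1}$; set $x_{k+1}=\arg\min_{x\in\mathbb{R}^n}\{\alpha n\langle\widetilde\nabla^mf(x_k),x-x_k\rangle+V[x_k](x)\}$. Output $\bar x_N=\frac1N\sum_{k=0}^{N-1}x_k$. *)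

(* Defs.v *)
From mathcomp Require Export all_boot all_order all_algebra.
From mathcomp Require Export all_classical all_reals all_analysis.
Export Order.TTheory GRing.Theory Num.Theory.
Export numFieldNormedType.Exports.

Set Implicit Arguments.
Unset Strict Implicit.
Unset Printing Implicit Defensive.

Local Open Scope classical_set_scope.
Local Open Scope ring_scope.

Section vectors.
Context {R : realType} {n : nat}.
Implicit Types (x y z : 'rV[R]_n) (h : 'rV[R]_n -> R).

Definition dot x y : R := \sum_(i < n) x 0 i * y 0 i.

(* The norm that the library puts on ['rV[R]_n] is the sup norm; it is only used
   here through the (norm independent) notions of limit and derivative. *)
Definition enorm x : R := Num.sqrt (dot x x).

Definition pnorm (p : R) x : R := (\sum_(i < n) `|x 0 i| `^ p) `^ p^-1.

Definition gradient h x : 'rV[R]_n := \row_(i < n) 'D_(delta_mx 0 i) h x.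

Definition has_gradient h (v : 'rV[R]_n -> 'rV[R]_n) :=
  forall x, differentiable h x /\ gradient h x = v x.

(* Closed in the sense of convex analysis: the epigraph is closed. *)
Definition closed_function h :=
  closed [set u : 'rV[R]_n * R | h u.1 <= u.2].

Definition is_argmin h x := forall y, h x <= h y.

Definition bregman (d : 'rV[R]_n -> R) z x : R :=
  d x - d z - dot (gradient d z) (x - z).

End vectors.

Notation borel_rV R n := (g_sigma_algebraType (@open 'rV[R]_n)).

Definition kappa (R : realType) (n : nat) : R := 1 + (ln n%:R)^-1.

Section prox.
Context {R : realType} {n : nat}.

Local Notation k := (kappa R n).

Definition prox1 (x : 'rV[R]_n) : R :=
  expR 1 * n%:R `^ ((k - 1) * (2 - k) / k) * ln n%:R / 2
  * pnorm k x ^+ 2.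

Definition prox2 (x : 'rV[R]_n) : R := 2^-1 * enorm x ^+ 2.

Record prox_function (p : R) (d : 'rV[R]_n -> R) : Prop := {
  prox_continuous : continuous d ;
  prox_differentiable : forall x, differentiable d x ;
  prox_convex : convex_function setT d ;
  prox_strongly_convex : forall x y,
    2^-1 * pnorm p (y - x) ^+ 2 <= d y - d x - dot (gradient d x) (y - x) ;
  prox_min : (exists x, d x = 0) /\ (forall x, 0 <= d x) ;
  prox_p1 : p = 1 -> d = prox1 ;
  prox_p2 : p = 2 -> d = prox2
}.

End prox.

(* The minimum is taken in the extended reals, where [+oo - 1 = +oo] and
   [+oo^-1 = 0], so that [q = +oo] gives [(16 ln n - 8) * n `^ (-1)]. *)
Definition rho {R : realType} (n : nat) (q : \bar R) : R :=
  fine (mine (q - 1)%E (16 * ln n%:R - 8)%:E)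
  * n%:R `^ (2 * fine (q^-1)%E - 1).

Section probability.
Context {R : realType} {d : measure_display} {T : measurableType d}.

Definition mean {U : Type} (P : probability T R) (F : U -> T -> R) (x : U) : R :=
  fine ('E_P[F x])%E.

Definition mutually_independent (P : probability T R) (I : finType)
    (G : I -> set_system T) :=
  forall (J : {set I}) (A : I -> set T), (forall i, i \in J -> G i (A i)) ->
  P (\bigcap_(i in [set` J]) A i) = (\prod_(i in J) P (A i))%E.

(* The uniform distribution on the unit Euclidean sphere is the rotation
   invariant Borel probability measure on it. *)
Definition uniform_on_sphere (n : nat) (P : probability T R)
    (e : {RV P >-> borel_rV R n}) :=
  (forall w, enorm (e w : 'rV[R]_n) = 1) /\
  (forall Q : 'M[R]_n, Q *m Q^T = 1%:M ->
   forall A : set (borel_rV R n), measurable A ->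
     P [set w | A ((e w : 'rV[R]_n) *m Q)] = P (e @^-1` A)).

Definition has_law d' (S : measurableType d') (P : probability T R)
    (X : {RV P >-> S}) (Q : probability S R) :=
  forall A : set S, measurable A -> P (X @^-1` A) = Q A.

End probability.

Section rdd.
Context {R : realType} {n : nat} {T : Type}.
Implicit Types (x e : 'rV[R]_n).

Definition oracle (g : 'rV[R]_n -> T -> 'rV[R]_n)
    (zeta eta : 'rV[R]_n -> T -> 'rV[R]_n -> R) x (xi : T) e : R :=
  dot (g x xi) e + zeta x xi e + eta x xi e.

Definition batch_gradient (o : 'rV[R]_n -> T -> 'rV[R]_n -> R) (m : nat)
    x (xi : 'I_m -> T) e : 'rV[R]_n :=
  m%:R^-1 *: \sum_(i < m) o x (xi i) e *: e.

Definition rdd_objective (d : 'rV[R]_n -> R) (alpha : R) (G z x : 'rV[R]_n) : R :=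
  alpha * n%:R * dot G (x - z) + bregman d z x.

End rdd.

(* Main.v *)
Require Import Defs.
From mathcomp Require Import ring lra zify perm measurable_realfun.

(** Write V_k for the Bregman divergence V[x_k](x* ), and let c_k be the averaged
    oracle value along the direction e = e_{k+1}, so that the step of the method
    is the mirror step with the vector alpha n c_k e.  The optimality condition
    says that the gradient of d moves by exactly this vector; with the three
    point identity and the strong convexity of d it gives, on every path,

      alpha n c_k <x_k - x*, e> <= (alpha n c_k)^2 |e|_q^2 / 2 + V_k - V_{k+1}

    ([mirror_step]).  Everything else is the computation of the expectations of
    the two sides.

    Dual norm.  The product of <s, e>^2 with |e|_q^2 has no closed form
    expectation, so |e|_q^2 is replaced by a majorant W(e) = a + b sum_i e_i^(2k)
    whose mean is at most 2 rho_n ([dual_norm_majorant]): Hoelder and the power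
    mean inequality bound |e|_q^2 by a multiple of the k-th root of
    sum_i e_i^(2k), this concave root lies below its tangent, and
    E e_i^(2k) <= (k/n)^k ([sphere_moment_le]).  As W does not change when a
    coordinate changes sign or when two coordinates are exchanged,
    E[e_i e_j W(e)] is 0 for i <> j and E[W(e)] / n for i = j
    ([sphere_weighted_cov]).  Hence E[<s, e><t, e> W(e)] is exactly
    E<s, t> E[W(e)] / n as soon as (s, t) is independent of e
    ([sphere_bilinear]); moments of order four and correlations between <s, e>^2
    and |e|_q^2 never have to be estimated.

    Independence.  The iterate x_k is a measurable function of the draws of the
    first k steps: the gradient of d is a bijection with Lipschitz inverse
    ([gradient_inverse]), so the optimality condition determines x_{k+1} as a
    Borel function of x_k and of the draws ([iterate_past]).  The pi-lambda
    theorem turns mutual independence of the draws into independence of a fresh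
    draw from all of that past ([joint_sigma_indep]), and Fubini for the joint
    law, which is a product, allows the past to be held fixed while the fresh
    draw is averaged ([freezing]).  This gives the unbiasedness of the batch and
    the bound sigma^2 / m on its variance ([Rint_dot_batch_mean], [batch_mean_sqr]).

    Smoothness.  Integrating the pathwise gradient inequalities yields
    0 <= f(y) - f(x) - <a(x), y - x> <= L_2 |y - x|^2 with a(x) = E g(x, xi)
    ([mean_ge], [mean_le]).  Such a pair of bounds forces a to be the gradient of
    f, makes f continuous, and gives |a(x)|^2 <= 4 L_2 (f(x) - f(x* )).

    Errors.  With A the exact part of c_k and z, y the averaged errors,
    (A + z + y)^2 <= 3 A^2 + 2 z^2 + 6 y^2, and the cross term
    (z + y) <x_k - x*, e> is split by Young's inequality with weight 4 N alpha.
    Its quadratic part costs only V_k / (4 N), so that with the gap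
    S_k = E f(x_k) - f(x* )

      E V_{k+1} + (3/4) alpha S_k <= (1 + 1/(4N)) E V_k + alpha C

    ([one_step]).  Over N steps the factors 1 + 1/(4N) lose at most 4/3
    ([recursion_bound]); convexity passes from the mean of the gaps to the gap at
    the mean point, and each term of the resulting bound is dominated by a term
    of the claim ([final_constants]). *)

Set Implicit Arguments.
Unset Strict Implicit.
Unset Printing Implicit Defensive.

Local Open Scope classical_set_scope.
Local Open Scope ring_scope.

(** * Euclidean vectors *)

Section euclidean.
Context {R : realType} {n : nat}.
Implicit Types (x y z : 'rV[R]_n) (a t : R).

Lemma dotC x y : dot x y = dot y x.
Proof. by apply: eq_bigr => i _; rewrite mulrC. Qed.

Lemma dotDl x y z : dot (x + y) z = dot x z + dot y z.
Proof. by rewrite -big_split; apply: eq_bigr => i _; rewrite mxE mulrDl. Qed.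

Lemma dotZl a x y : dot (a *: x) y = a * dot x y.
Proof. by rewrite mulr_sumr; apply: eq_bigr => i _; rewrite mxE mulrA. Qed.

Lemma dotDr x y z : dot z (x + y) = dot z x + dot z y.
Proof. by rewrite dotC dotDl !(dotC z). Qed.

Lemma dotZr a x y : dot x (a *: y) = a * dot x y.
Proof. by rewrite dotC dotZl dotC. Qed.

Lemma dotNl x y : dot (- x) y = - dot x y.
Proof. by rewrite -scaleN1r dotZl mulN1r. Qed.

Lemma dotNr x y : dot x (- y) = - dot x y.
Proof. by rewrite dotC dotNl dotC. Qed.

Lemma dotBl x y z : dot (x - y) z = dot x z - dot y z.
Proof. by rewrite dotDl dotNl. Qed.

Lemma dotBr x y z : dot z (x - y) = dot z x - dot z y.
Proof. by rewrite dotDr dotNr. Qed.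

Lemma dot0l x : dot 0 x = 0.
Proof. by rewrite -(scale0r (0 : 'rV[R]_n)) dotZl mul0r. Qed.

Lemma dot0r x : dot x 0 = 0.
Proof. by rewrite dotC dot0l. Qed.

Lemma dot_suml (I : Type) (r : seq I) (f : I -> 'rV[R]_n) y :
  dot (\sum_(i <- r) f i) y = \sum_(i <- r) dot (f i) y.
Proof.
elim: r => [|i r IHr]; first by rewrite !big_nil dot0l.
by rewrite !big_cons dotDl IHr.
Qed.

Lemma dot_delta x i : dot x (delta_mx 0 i) = x 0 i.
Proof.
rewrite /dot (bigD1 i)//= mxE !eqxx mulr1 big1 ?addr0// => j ji.
by rewrite mxE (negbTE ji) mulr0.
Qed.

Lemma dot_ge0 x : 0 <= dot x x.
Proof. by apply: sumr_ge0 => i _; rewrite -expr2 sqr_ge0. Qed.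

Lemma enorm_ge0 x : 0 <= enorm x.
Proof. exact: sqrtr_ge0. Qed.

Lemma enorm_sqr x : enorm x ^+ 2 = dot x x.
Proof. by rewrite sqr_sqrtr ?dot_ge0. Qed.

Lemma dot_le_weighted t x y : 0 < t ->
  2 * dot x y <= t * dot x x + t^-1 * dot y y.
Proof.
move=> t0; have := dot_ge0 (t *: x - y).
rewrite dotBl !dotBr !dotZl !dotZr (dotC y x) => h.
rewrite -subr_ge0 -(pmulr_rge0 _ t0).
by move: h; congr (_ <= _); field; rewrite gt_eqF.
Qed.

Lemma dot_eq0 x : dot x x = 0 -> x = 0.
Proof.
move=> /eqP; rewrite psumr_eq0 => [/allP x0|i _]; last by rewrite -expr2 sqr_ge0.
apply/rowP => i; have /= := x0 i (mem_index_enum _).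
by rewrite mulf_eq0 orbb mxE => /eqP.
Qed.

Lemma dot_CS x y : dot x y ^+ 2 <= dot x x * dot y y.
Proof.
have [x0|x0] := eqVneq (dot x x) 0.
  by rewrite x0 mul0r (dot_eq0 x0) dot0l expr0n.
have xp : 0 < dot x x by rewrite lt0r x0 dot_ge0.
have := dot_ge0 (dot x x *: y - dot x y *: x).
rewrite dotBl !dotBr !dotZl !dotZr (dotC y x) => h.
rewrite -subr_ge0 -(pmulr_rge0 _ xp); move: h; congr (_ <= _); ring.
Qed.

Lemma coord_sqr_le x i : (x 0 i) ^+ 2 <= dot x x.
Proof.
rewrite /dot (bigD1 i)//= expr2 lerDl sumr_ge0// => j _.
by rewrite -expr2 sqr_ge0.
Qed.

Lemma coord_le1 x i : dot x x = 1 -> `|x 0 i| <= 1.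
Proof.
move=> x1; rewrite -(ler_pXn2r (ltn0Sn 1)) ?nnegrE// expr1n real_normK ?num_real//.
by rewrite -x1 coord_sqr_le.
Qed.

Lemma dot_le_enorm x y : dot x y <= enorm x * enorm y.
Proof.
rewrite (le_trans (ler_norm _))// -(ler_pXn2r (ltn0Sn 1)) ?nnegrE//.
  by rewrite real_normK ?num_real// exprMn !enorm_sqr dot_CS.
by rewrite mulr_ge0 ?enorm_ge0.
Qed.

End euclidean.

(** * Sums of real powers *)

Section hoelder.
Context {R : realType} {I : finType}.
Implicit Types (a b : I -> R) (s t : R).

Lemma sum_powR_ge0 a s : 0 <= \sum_i a i `^ s.
Proof. by apply: sumr_ge0 => i _; rewrite powR_ge0. Qed.

Lemma sum_powR_eq0 a s i : \sum_i a i `^ s = 0 -> a i = 0.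
Proof.
move=> /eqP; rewrite psumr_eq0 => [/allP a0|j _]; last exact: powR_ge0.
by have /= /eqP/powR_eq0_eq0 := a0 i (mem_index_enum _).
Qed.

Lemma powR_quot (x y s : R) : 0 <= x -> 0 <= y -> (x / y) `^ s = x `^ s / y `^ s.
Proof.
move=> x0 y0; rewrite powRM ?invr_ge0//; congr (_ * _).
by rewrite -(powR_inv1 y0) powRAC powR_inv1 ?powR_ge0.
Qed.

(** Normalizing both families reduces the inequality to Young's inequality for
    each index. *)
Lemma hoelder_sum a b s t : 0 < s -> 0 < t -> s^-1 + t^-1 = 1 ->
  (forall i, 0 <= a i) -> (forall i, 0 <= b i) ->
  \sum_i a i * b i <=
  (\sum_i a i `^ s) `^ s^-1 * (\sum_i b i `^ t) `^ t^-1.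
Proof.
move=> s0 t0 st a0 b0.
set A := \sum_i a i `^ s; set B := \sum_i b i `^ t.
have [A0|A0] := eqVneq A 0.
  by rewrite big1 ?mulr_ge0 ?powR_ge0// => i _; rewrite (sum_powR_eq0 i A0) mul0r.
have [B0|B0] := eqVneq B 0.
  by rewrite big1 ?mulr_ge0 ?powR_ge0// => i _; rewrite (sum_powR_eq0 i B0) mulr0.
have Ap : 0 < A by rewrite lt0r A0 sum_powR_ge0.
have Bp : 0 < B by rewrite lt0r B0 sum_powR_ge0.
set al := A `^ s^-1; set be := B `^ t^-1.
have alp : 0 < al by rewrite powR_gt0.
have bep : 0 < be by rewrite powR_gt0.
have als : al `^ s = A by rewrite -powRrM mulVf ?gt_eqF// powRr1// ltW.
have bet : be `^ t = B by rewrite -powRrM mulVf ?gt_eqF// powRr1// ltW.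
clearbody al be.
have abp : 0 < al * be by rewrite mulr_gt0.
rewrite -[leRHS]mulr1 -(ler_pdivrMl _ _ abp) mulr_sumr.
apply: (@le_trans _ _ (\sum_i (a i `^ s / A / s + b i `^ t / B / t))).
  apply: ler_sum => i _.
  have -> : (al * be)^-1 * (a i * b i) = (a i / al) * (b i / be).
    by field; rewrite !gt_eqF.
  have -> : a i `^ s / A = (a i / al) `^ s.
    by rewrite powR_quot ?als// ltW.
  have -> : b i `^ t / B = (b i / be) `^ t.
    by rewrite powR_quot ?bet// ltW.
  by apply: conjugate_powR => //; rewrite divr_ge0// ltW.
rewrite big_split/= -!mulr_suml -/A -/B !divff// !mul1r st//.
Qed.

(** Hoelder applied to the powers [a i `^ s] and the constant family, with
    exponents [t / s] and its conjugate. *)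
Lemma power_mean a s t : 0 < s -> s < t -> (forall i, 0 <= a i) ->
  (\sum_i a i `^ s) `^ s^-1 <=
  #|I|%:R `^ (s^-1 - t^-1) * (\sum_i a i `^ t) `^ t^-1.
Proof.
move=> s0 st a0; have t0 : 0 < t by exact: lt_trans st.
have ts : 0 < t / s by rewrite divr_gt0.
have d0 : 0 < 1 - s / t by rewrite subr_gt0 ltr_pdivrMr ?mul1r.
have := @hoelder_sum (fun i => a i `^ s) (fun=> 1) (t / s) (1 - s / t)^-1 ts.
rewrite invr_gt0 d0 invrK invf_div => /(_ isT).
have -> : s / t + (1 - s / t) = 1 by ring.
move=> /(_ erefl (fun=> powR_ge0 _ _) (fun=> ler01)).
under eq_bigr do rewrite mulr1.
under [in X in _ <= X -> _]eq_bigr do rewrite -powRrM (mulrC s) divfK ?gt_eqF//.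
under [in X in _ * X]eq_bigr do rewrite powR1.
rewrite sumr_const -[_ *+ _]/(#|I|%:R) => h.
have := ge0_ler_powR (_ : 0 <= s^-1) _ _ h; rewrite invr_ge0 (ltW s0) => /(_ isT).
rewrite !nnegrE sum_powR_ge0 mulr_ge0 ?powR_ge0// => /(_ isT isT).
rewrite powRM ?powR_ge0// -!powRrM mulrC => /le_trans; apply.
rewrite le_eqVlt; apply/orP; left; apply/eqP; congr (_ `^ _ * _ `^ _).
- by field; rewrite !gt_eqF.
- by field; rewrite !gt_eqF.
Qed.

End hoelder.

(** * Dual norms and even power sums *)

Section pnorms.
Context {R : realType} {n : nat}.
Implicit Types (x y e u : 'rV[R]_n) (p q : R).

Lemma pnorm_ge0 p x : 0 <= pnorm p x.
Proof. by rewrite powR_ge0. Qed.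

Lemma coord_le_pnorm p x i : 0 < p -> `|x 0 i| <= pnorm p x.
Proof.
move=> p0; have h : `|x 0 i| `^ p <= \sum_j `|x 0 j| `^ p.
  by rewrite (bigD1 i)//= lerDl sumr_ge0// => j _; rewrite powR_ge0.
have := ge0_ler_powR (_ : 0 <= p^-1) _ _ h; rewrite invr_ge0 (ltW p0) => /(_ isT).
rewrite !nnegrE powR_ge0 (le_trans _ h) ?powR_ge0// => /(_ isT isT).
by rewrite -powRrM divff ?gt_eqF// powRr1//.
Qed.

Lemma pnorm_powR p x : 0 < p -> pnorm p x `^ p = \sum_i `|x 0 i| `^ p.
Proof.
move=> p0; rewrite -powRrM mulVf ?gt_eqF// powRr1// sumr_ge0//.
Qed.

(** For exponents at most 2, [`|x_i| ^ 2 = `|x_i| ^ p * `|x_i| ^ (2 - p)], and the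
    second factor is at most the corresponding power of the p-norm. *)
Lemma dot_le_pnorm p x : 1 <= p <= 2 -> dot x x <= pnorm p x ^+ 2.
Proof.
move=> /andP[p1 p2]; have p0 : 0 < p by lra.
set M := pnorm p x; have M0 : 0 <= M := pnorm_ge0 p x.
have split2 a : 0 <= a -> a ^+ 2 = a `^ p * a `^ (2 - p).
  move=> a0; rewrite -powRD; last by rewrite addrC subrK pnatr_eq0.
  by rewrite addrC subrK powR_mulrn.
rewrite split2// pnorm_powR// mulr_suml; apply: ler_sum => i _.
rewrite -expr2 -real_normK ?num_real// split2//.
rewrite ler_wpM2l ?powR_ge0//; apply: ge0_ler_powR; rewrite ?nnegrE ?subr_ge0//.
exact: coord_le_pnorm.
Qed.

Lemma dot_le_sum_norm x y : `|dot x y| <= \sum_i `|x 0 i| * `|y 0 i|.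
Proof.
by apply: le_trans (ler_norm_sum _ _ _) _; apply: ler_sum => i _; rewrite normrM.
Qed.

(** The 2k-th power of the 2k-norm.  It is kept as a polynomial in the
    coordinates because moments of polynomials on the sphere are computable. *)
Definition evenpow (k : nat) e : R := \sum_i (e 0 i) ^+ (2 * k).

Lemma evenpow_ge0 k e : 0 <= evenpow k e.
Proof. by apply: sumr_ge0 => i _; rewrite exprM exprn_ge0// sqr_ge0. Qed.

Lemma evenpowE k e : evenpow k e = \sum_i `|e 0 i| `^ (2 * k%:R).
Proof.
apply: eq_bigr => i _; rewrite -natrM powR_mulrn// !exprM.
by rewrite real_normK ?num_real.
Qed.

Lemma coord_le_evenpow k e i : (0 < k)%N ->
  `|e 0 i| ^+ 2 <= evenpow k e `^ k%:R^-1.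
Proof.
move=> k0; have k0R : 0 < k%:R :> R by rewrite ltr0n.
have := @coord_le_pnorm (2 * k%:R) e i.
rewrite mulr_gt0// => /(_ isT); rewrite /pnorm -(evenpowE k e) invfM mulrC => h.
have /= := lerXn2r 2 _ _ h; rewrite !nnegrE powR_ge0 normr_ge0 => /(_ isT isT) /le_trans; apply.
by rewrite -powR_mulrn ?powR_ge0// -powRrM divfK// pnatr_eq0.
Qed.

(** Bounds the dual norm through the maximum norm: a coordinate is at most the
    2k-norm, and [q] (the reciprocal of the conjugate exponent) is the price of
    passing from the 1-norm to the p-norm.  It covers [p = 1], where [q = 0]. *)
Lemma dot_sqr_le_sup k p q e u : (0 < k)%N ->
  (p = 1 /\ q = 0 \/ 1 < p /\ p^-1 + q = 1) ->
  dot e u ^+ 2 <= n%:R `^ (2 * q) * evenpow k e `^ k%:R^-1 * pnorm p u ^+ 2.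
Proof.
move=> k0 pq; set Z := evenpow k e `^ k%:R^-1.
have Z0 : 0 <= Z by rewrite powR_ge0.
have h1 : `|dot e u| <= Num.sqrt Z * \sum_i `|u 0 i|.
  apply: le_trans (dot_le_sum_norm _ _) _; rewrite mulr_sumr.
  apply: ler_sum => i _; rewrite ler_wpM2r//.
  by rewrite -[leLHS]ger0_norm// -sqrtr_sqr ler_wsqrtr// coord_le_evenpow.
have h2 : \sum_i `|u 0 i| <= n%:R `^ q * pnorm p u.
  case: pq => [[-> ->]|[p1' pq]].
    rewrite powRr0 mul1r /pnorm invr1 powRr1; last first.
      by apply: sumr_ge0 => i _; rewrite powR_ge0.
    by apply: ler_sum => i _; rewrite powRr1.
  have := @power_mean R 'I_n (fun i => `|u 0 i|) 1 p ltr01 p1' (fun=> normr_ge0 _).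
  rewrite invr1 powRr1; last by apply: sumr_ge0 => i _; rewrite powR_ge0.
  under eq_bigr do rewrite powRr1//.
  by rewrite card_ord (_ : 1 - p^-1 = q)// -pq addrC addKr.
have h3 : `|dot e u| <= Num.sqrt Z * (n%:R `^ q * pnorm p u).
  by apply: le_trans h1 _; rewrite ler_wpM2l ?sqrtr_ge0.
have /= := lerXn2r 2 _ _ h3; rewrite !nnegrE normr_ge0 !mulr_ge0 ?powR_ge0 ?sqrtr_ge0//.
move=> /(_ isT isT); rewrite real_normK ?num_real// !exprMn sqr_sqrtr//.
move=> /le_trans; apply; rewrite mulrA (mulrC Z).
by rewrite -(powR_mulrn 2 (powR_ge0 _ q)) -powRrM (mulrC q).
Qed.

(** Bounds the dual norm through the 2k-norm by the power mean inequality, which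
    loses a smaller power of the dimension when [2 k] is close to [q]. *)
Lemma dot_sqr_le_dual k p q e u : 1 < p -> 0 < q -> p^-1 + q^-1 = 1 ->
  q < 2 * k%:R ->
  dot e u ^+ 2 <= n%:R `^ (2 * q^-1 - k%:R^-1) * evenpow k e `^ k%:R^-1
                  * pnorm p u ^+ 2.
Proof.
move=> p1 q0 pq qk.
have p0 : 0 < p by lra.
have k0 : 0 < k%:R :> R by lra.
have h1 : `|dot e u| <= (\sum_i `|e 0 i| `^ q) `^ q^-1 * pnorm p u.
  apply: le_trans (dot_le_sum_norm _ _) _.
  by apply: hoelder_sum => //; rewrite addrC.
have := @power_mean R 'I_n (fun i => `|e 0 i|) q (2 * k%:R) q0 qk (fun=> normr_ge0 _).
rewrite -(evenpowE k e) (card_ord n) => h2.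
have h3 : `|dot e u| <= n%:R `^ (q^-1 - (2 * k%:R)^-1) *
    evenpow k e `^ (2 * k%:R)^-1 * pnorm p u.
  by apply: le_trans h1 _; rewrite ler_wpM2r ?powR_ge0.
have /= := lerXn2r 2 _ _ h3; rewrite !nnegrE normr_ge0 !mulr_ge0 ?powR_ge0//.
move=> /(_ isT isT); rewrite real_normK ?num_real// !exprMn.
move=> /le_trans; apply; rewrite -!(powR_mulrn _ (powR_ge0 _ _)) -!powRrM.
rewrite le_eqVlt; apply/orP; left; apply/eqP; congr (_ `^ _ * _ `^ _ * _).
- by field; rewrite !gt_eqF.
- by field; rewrite !gt_eqF.
Qed.

(** The k-th root is concave, hence below its tangent at [t ^ k].  For
    [k > 1] it is Young's inequality for the exponents [k] and [k / (k - 1)]. *)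
Lemma root_le_tangent (k : nat) (y t : R) : (0 < k)%N -> 0 <= y -> 0 < t ->
  y `^ k%:R^-1 <= t * (k.-1%:R / k%:R) + y / (k%:R * t ^+ k.-1).
Proof.
move=> k0 y0 t0; have k0R : 0 < k%:R :> R by rewrite ltr0n.
have yt0 : 0 <= y / t ^+ k by rewrite divr_ge0// exprn_ge0// ltW.
have [->|k1] := eqVneq k 1%N.
  by rewrite invr1 powRr1// mul0r mulr0 add0r mul1r expr0 divr1.
have k2 : 1 < k%:R :> R by rewrite ltr1n ltn_neqAle eq_sym k1.
have := @conjugate_powR R (y `^ k%:R^-1 / t) 1 k%:R (k%:R / (k%:R - 1)).
rewrite ler01 divr_ge0 ?powR_ge0 ?(ltW t0)// => /(_ isT isT k0R).
rewrite divr_gt0 ?subr_gt0// => /(_ isT).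
have -> : k%:R^-1 + (k%:R / (k%:R - 1))^-1 = 1 :> R.
  by field; rewrite !gt_eqF// ?subr_gt0//.
move=> /(_ erefl); rewrite mulr1 powR1 ler_pdivrMr// => /le_trans; apply.
rewrite powR_mulrn ?divr_ge0 ?powR_ge0 ?(ltW t0)// expr_div_n -(powR_mulrn k (powR_ge0 y _)).
rewrite -powRrM mulVf ?gt_eqF// powRr1//.
have T0 : t ^+ k.-1 != 0 by rewrite expf_neq0 ?gt_eqF.
have -> : k.-1%:R = k%:R - 1 :> R by rewrite -[in RHS](prednK k0) -natr1 addrK.
have -> : t ^+ k = t * t ^+ k.-1 by rewrite -exprS prednK.
move: (t ^+ k.-1) T0 => T T0; move: (k%:R) k0R k2 => K K0 K1.
rewrite (_ : _ * t = t * ((K - 1) / K) + y / (K * T))//; field.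
by rewrite T0 !gt_eqF// subr_gt0.
Qed.

End pnorms.

(** * A polynomial majorant of the squared dual norm *)

Section majorant.
Context {R : realType}.
Implicit Types (p C r : R).

(** The tangent is taken at [n (k / n) ^ k], the bound on the mean of [evenpow k]
    on the sphere, so that at this value the tangent and the root agree. *)
Lemma majorant_of_root n p C r (k : nat) : (0 < n)%N -> (0 < k)%N -> 0 <= C ->
  (forall e u : 'rV[R]_n,
    dot e u ^+ 2 <= C * evenpow k e `^ k%:R^-1 * pnorm p u ^+ 2) ->
  C * (n%:R `^ k%:R^-1 * (k%:R / n%:R)) <= r ->
  exists a b : R, [/\ 0 <= a, 0 <= b, forall e u : 'rV[R]_n,
    dot e u ^+ 2 <= (a + b * evenpow k e) * pnorm p u ^+ 2 &
    a + b * (n%:R * (k%:R / n%:R) ^+ k) <= r].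
Proof.
move=> n0 k0 C0 H Hr.
have n0R : 0 < n%:R :> R by rewrite ltr0n.
have k0R : 0 < k%:R :> R by rewrite ltr0n.
pose t : R := n%:R `^ k%:R^-1 * (k%:R / n%:R).
have t0 : 0 < t by rewrite mulr_gt0 ?powR_gt0 ?divr_gt0.
have tk : t ^+ k = n%:R * (k%:R / n%:R) ^+ k.
  rewrite exprMn -(powR_mulrn k (powR_ge0 n%:R _)) -powRrM mulVf ?gt_eqF//.
  by rewrite powRr1// ltW.
have T0 : 0 < t ^+ k.-1 by rewrite exprn_gt0.
exists (C * t * (k.-1%:R / k%:R)), (C / (k%:R * t ^+ k.-1)); split.
- by rewrite mulr_ge0// ?divr_ge0// mulr_ge0// ltW.
- by rewrite divr_ge0// mulr_ge0// ltW.
- move=> e u; apply: le_trans (H e u) _; rewrite ler_wpM2r ?sqr_ge0//.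
  have := root_le_tangent k0 (evenpow_ge0 k e) t0.
  move=> /(ler_wpM2l C0) /le_trans; apply; rewrite le_eqVlt; apply/orP; left; apply/eqP.
  move: (t ^+ k.-1) T0 (k%:R) (k.-1%:R : R) k0R => T T0 K K1 K0.
  by field; rewrite !gt_eqF.
- apply: le_trans Hr; rewrite -/t -tk.
  have -> : t ^+ k = t * t ^+ k.-1 by rewrite -exprS prednK.
  have -> : k.-1%:R = k%:R - 1 :> R by rewrite -[in RHS](prednK k0) -natr1 addrK.
  move: (t ^+ k.-1) T0 (k%:R) k0R => T T0 K K0.
  rewrite le_eqVlt; apply/orP; left; apply/eqP.
  by field; rewrite !gt_eqF.
Qed.

Lemma ln_ge_7_8 n : (8 <= n)%N -> 7 / 8 <= ln n%:R :> R.
Proof.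
move=> n8; have n8R : 8 <= n%:R :> R by rewrite (ler_nat _ 8).
have n0 : 0 < n%:R :> R by lra.
have := @le_ln1Dx R (n%:R^-1 - 1); rewrite addrCA subrr addr0 lnV ?posrE//.
have : n%:R^-1 <= 8^-1 :> R by rewrite lef_pV2 ?posrE.
have : 0 < n%:R^-1 :> R by rewrite invr_gt0.
move: (n%:R^-1) (ln n%:R) => i l i0 i8 /(_ _)h.
have : - l <= i - 1 by apply: h; lra.
lra.
Qed.

Lemma root_dim_le2 n (k : nat) : (8 <= n)%N -> 2 * ln n%:R <= k%:R :> R ->
  n%:R `^ k%:R^-1 <= 2 :> R.
Proof.
move=> n8 nk; have l0 := ln_ge_7_8 n8.
have n0 : 0 < n%:R :> R by rewrite ltr0n (leq_trans _ n8).
have k0 : 0 < k%:R :> R by lra.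
have -> : n%:R `^ k%:R^-1 = expR (k%:R^-1 * ln n%:R) :> R.
  by rewrite mulrC expRM lnK// posrE.
apply: (@le_trans _ _ (expR 2^-1)).
  by rewrite ler_expR mulrC ler_pdivrMr// ler_pdivlMl//.
have := @expR_ge1Dx R (- 2^-1); rewrite expRN => h.
rewrite -[expR _]invrK -[leRHS]invrK lef_pV2 ?posrE ?invr_gt0 ?expR_gt0//.
by apply: le_trans h; lra.
Qed.

(** When the minimum in [rho] is [16 ln n - 8], the exponent [2 k] is of the order
    of [4 ln n]: then [n `^ (1 / k) <= 2], so that replacing the square of the
    maximum norm by that of the 2k-norm costs at most a factor 2 in the mean.
    When it is [q - 1], [2 k] is the first even number above [q]. *)
Lemma dual_norm_majorant n p (q : \bar R) : (8 <= n)%N -> 1 <= p <= 2 ->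
  (p%:E^-1 + q^-1 = 1)%E ->
  0 < rho n q /\
  exists (k : nat) (a b : R), [/\ 0 <= a, 0 <= b, forall e u : 'rV[R]_n,
    dot e u ^+ 2 <= (a + b * evenpow k e) * pnorm p u ^+ 2 &
    a + b * (n%:R * (k%:R / n%:R) ^+ k) <= 2 * rho n q].
Proof.
move=> n8 /andP[p1 p2] pq; have p0 : 0 < p by lra.
have n0 : (0 < n)%N by rewrite (leq_trans _ n8).
have n0R : 0 < n%:R :> R by rewrite ltr0n.
have l0 := ln_ge_7_8 n8.
set s := fine (q^-1)%E.
have [q1 ps] : (1 <= q - 1)%E /\ (p = 1 /\ s = 0 \/ 1 < p /\ p^-1 + s = 1).
  have pE : (p%:E^-1 = (p^-1)%:E)%E by rewrite /inve gt_eqF.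
  move: pq; rewrite /s; case: q {s} => [q| |].
  - rewrite pE /inve; have [->//|q0] := eqVneq q 0; rewrite -EFinD => -[/= pq].
    have qE : q^-1 = 1 - p^-1 by rewrite -pq addrC addKr.
    have p1' : 1 < p.
      rewrite lt_neqAle p1 andbT; apply: contra_neq q0 => p1'.
      by move: qE; rewrite -p1' invr1 subrr => /eqP; rewrite invr_eq0 => /eqP.
    split; last by right.
    have qi : 0 < q^-1 by rewrite qE subr_gt0 invf_lt1.
    have : 2^-1 <= p^-1 by rewrite lef_pV2 ?posrE.
    move=> pi; have : q^-1 <= 2^-1 by rewrite qE; lra.
    rewrite lef_pV2 ?posrE//; last by rewrite -invr_gt0.
    by move=> q2; rewrite -EFinB lee_fin; lra.
  - rewrite pE /inve /= adde0 => -[pi]; split; first by rewrite leey.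
    by left; split=> //; rewrite -[p]invrK pi invr1.
  - by rewrite pE.
have bigk : 16 * ln n%:R - 8 <= fine (mine (q - 1) (16 * ln n%:R - 8)%:E)%E ->
   exists (k : nat) (a b : R), [/\ 0 <= a, 0 <= b, forall e u : 'rV[R]_n,
    dot e u ^+ 2 <= (a + b * evenpow k e) * pnorm p u ^+ 2 &
    a + b * (n%:R * (k%:R / n%:R) ^+ k) <= 2 * rho n q].
  (* [k >= 2 ln n] gives [n `^ (1 / k) <= 2]; [k <= 2 ln n + 1] and [ln n >= 7 / 8]
     give [2 k <= 2 (16 ln n - 8)]. *)
  move=> hm; pose k := (Num.truncn (2 * ln n%:R : R)).+1.
  have lk : 2 * ln n%:R <= k%:R :> R by rewrite ltW// truncnS_gt.
  have ku : k%:R <= 2 * ln n%:R + 1 :> R.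
    by rewrite /k -[leLHS]natr1 lerD2r truncn_le//; lra.
  exists k; apply: (@majorant_of_root n p (n%:R `^ (2 * s))) => //.
    by move=> e u; exact: dot_sqr_le_sup.
  rewrite /rho -/s powRD ?(gt_eqF n0R) ?implybT// powR_inv1 ?ler0n//.
  set A := n%:R `^ (2 * s); have A0 : 0 <= A by rewrite powR_ge0.
  apply: (@le_trans _ _ (A * (2 * (k%:R / n%:R)))).
    by rewrite ler_wpM2l// ler_wpM2r ?divr_ge0// root_dim_le2.
  rewrite [leLHS](_ : _ = (2 * k%:R) * (A / n%:R)); last by ring.
  rewrite [leRHS]mulrA ler_wpM2r ?divr_ge0 ?ler0n//.
  move: (fine _) hm => m hm; rewrite ltW//; lra.
have rho0 : 0 < fine (mine (q - 1) (16 * ln n%:R - 8)%:E)%E ->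
    0 < rho n q.
  by move=> m0; rewrite /rho mulr_gt0// powR_gt0.
have sE : s = fine (q^-1)%E by []. clearbody s.
case: q pq sE q1 bigk rho0 => [q| |] pq sE q1 bigk rho0; last by [].
- have q1' : 1 <= q - 1 by rewrite -lee_fin.
  have q0 : 0 < q by lra.
  have mE : mine (q%:E - 1)%E (16 * ln n%:R - 8)%:E =
            (Order.min (q - 1) (16 * ln n%:R - 8))%:E.
    by rewrite -EFinB EFin_min.
  move: bigk rho0; rewrite mE/= => bigk rho0.
  split; first by rewrite rho0// lt_min; apply/andP; split; lra.
  have [lq|ql] := leP (16 * ln n%:R - 8) (q - 1).
    by apply: bigk; rewrite le_min lexx lq.
  have sq : s = q^-1 by rewrite sE inver gt_eqF.
  case: ps => [[_ s0]|[p1' ps]].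
    by move: sq; rewrite s0 => /esym/eqP; rewrite invr_eq0 gt_eqF.
  pose k := (Num.truncn (q / 2)).+1.
  have qk : q < 2 * k%:R by have := truncnS_gt (q / 2); rewrite -/k => ?; lra.
  have ku : k%:R <= q / 2 + 1.
    by rewrite /k -[leLHS]natr1 lerD2r truncn_le//; lra.
  have k0R : 0 < k%:R :> R by rewrite ltr0n.
  exists k; apply: (@majorant_of_root n p (n%:R `^ (2 * q^-1 - k%:R^-1))) => //.
    by move=> e u; apply: dot_sqr_le_dual => //; rewrite -sq.
  rewrite /rho mE -sE sq mulrA -powRD ?(gt_eqF n0R) ?implybT// subrK.
  rewrite powRD ?(gt_eqF n0R) ?implybT// powR_inv1 ?ler0n//.
  set A := n%:R `^ _; have A0 : 0 <= A by rewrite powR_ge0.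
  have -> : Order.min (q - 1) (16 * ln n%:R - 8) = q - 1 by rewrite min_l// ltW.
  rewrite [leLHS](_ : _ = k%:R * (A / n%:R)); last by ring.
  rewrite [leRHS]mulrA ler_wpM2r ?divr_ge0 ?ler0n//=; lra.
- have mE : mine (+oo - 1)%E (16 * ln n%:R - 8)%:E = (16 * ln n%:R - 8)%:E :> \bar R.
    by rewrite addye// /Order.min/=.
  by move: bigk rho0; rewrite mE/= => bigk rho0; split; [apply: rho0; lra|exact: bigk].
Qed.

End majorant.

(** * Borel vectors and expectations of real functions *)

Section borel_rV.
Context {R : realType} {n : nat}.

Lemma continuous_borel_measurable (h : 'rV[R]_n -> R) :
  continuous h -> measurable_fun setT (h : borel_rV R n -> R).
Proof.
move=> /continuousP ch.
apply: (measurability _ (RGenOpens.measurableE R)) => _ [_ [x [y ->]]] <-.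
by rewrite setTI; apply: sub_sigma_algebra; exact/ch/interval_open.
Qed.

Lemma measurable_coord i : measurable_fun setT (fun v : borel_rV R n => (v : 'rV[R]_n) 0 i).
Proof. by apply: continuous_borel_measurable; exact: coord_continuous. Qed.

Lemma measurable_coordX i k :
  measurable_fun setT (fun u : borel_rV R n => (u : 'rV[R]_n) 0 i ^+ k).
Proof. by apply: measurable_funX; exact: measurable_coord. Qed.

Definition rational_box (z : 'rV[rat]_n * nat) : set 'rV[R]_n :=
  [set v | forall i, `|v 0 i - ratr (z.1 0 i)| < z.2.+1%:R^-1].

(** Boxes with rational centre and radius [1 / (k + 1)] form a countable base. *)
Lemma open_rational_boxes (U : set 'rV[R]_n) : open U ->
  U = \bigcup_(z in [set z | rational_box z `<=` U]) rational_box z.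
Proof.
move=> oU; apply/seteqP; split=> [v Uv|v [z /= zU]]; last exact: zU.
have /nbhs_ballP[r /= r0 rU] : nbhs v U by exact: open_nbhs_nbhs.
have [k kr] : exists k, k.+1%:R^-1 < r / 2.
  have := @ltr_add_invr R 0 (r / 2); rewrite divr_gt0// => /(_ isT) [k].
  by rewrite add0r => ?; exists k.
have kp : 0 < k.+1%:R^-1 :> R by rewrite invr_gt0.
have /choice[c cP] : forall i, exists c : rat, `|v 0 i - ratr c| < k.+1%:R^-1.
  move=> i; have : v 0 i - k.+1%:R^-1 < v 0 i + k.+1%:R^-1.
    by rewrite ltrD2l gtrN.
  move=> /rat_in_itvoo[c]; rewrite in_itv/= => /andP[c1 c2]; exists c.
  by rewrite distrC ltr_distl c1 c2.
exists (\row_i c i, k) => /= [w wc|i]; last by rewrite mxE.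
apply: rU; rewrite -ball_normE/= /Num.norm/= mx_normrE.
apply/bigmax_ltP; split => // -[i j] _ /=; rewrite !mxE (ord1 i).
have := wc j; rewrite mxE => wj; have vj := cP j.
have -> : v 0 j - w 0 j = (v 0 j - ratr (c j)) - (w 0 j - ratr (c j)) by ring.
rewrite (le_lt_trans (ler_normB _ _))// (lt_trans (ltrD vj wj))//.
by rewrite [ltRHS]splitr ltrD.
Qed.

(** The Borel sets of the vector space are generated by countably many boxes, and
    the preimage of a box is a finite intersection of preimages of intervals. *)
Lemma measurable_to_borel_rV d (T : measurableType d) (f : T -> 'rV[R]_n) :
  (forall i, measurable_fun setT (fun w => f w 0 i)) ->
  measurable_fun setT (f : T -> borel_rV R n).
Proof.
move=> mf; apply: (@measurability _ _ T (borel_rV R n) setT f (@open 'rV[R]_n) erefl).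
move=> _ [U oU <-].
rewrite setTI (open_rational_boxes oU) preimage_bigcup.
rewrite bigcup_mkcond; apply: countable_bigcupT_measurable => // z.
case: ifPn => // _.
rewrite (_ : _ @^-1` _ = \bigcap_(i in [set: 'I_n])
    ((fun w => f w 0 i) @^-1` [set y | `|y - ratr (z.1 0 i)| < z.2.+1%:R^-1])).
  apply: fin_bigcap_measurable => // i _; rewrite -[X in measurable X]setTI.
  apply: mf => //; rewrite (_ : [set y | _] =
    `]ratr (z.1 0 i) - z.2.+1%:R^-1, ratr (z.1 0 i) + z.2.+1%:R^-1[%classic)//.
  by apply/seteqP; split => y /=; rewrite in_itv/= ltr_distl.
by apply/seteqP; split => w /= h i => [_|]; exact: h.
Qed.

End borel_rV.

Section real_expectation.
Context d {T : measurableType d} {R : realType} (P : probability T R).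
Implicit Types (f g : T -> R).

Lemma integrable_meas f : P.-integrable setT (EFin \o f) -> measurable_fun setT f.
Proof. by move=> /integrableP[/measurable_EFinP]. Qed.

Lemma integrable_dominated g f : measurable_fun setT f ->
  P.-integrable setT (EFin \o g) -> (forall w, `|f w| <= g w) ->
  P.-integrable setT (EFin \o f).
Proof.
move=> mf ig fg; apply: le_integrable ig => //; first exact/measurable_EFinP.
by move=> w _ /=; rewrite lee_fin (le_trans (fg w))// ler_norm.
Qed.

Lemma integrable_cst c : P.-integrable setT (EFin \o (fun=> c)).
Proof. exact: finite_measure_integrable_cst. Qed.

Lemma integrable_bounded f M : measurable_fun setT f -> (forall w, `|f w| <= M) ->
  P.-integrable setT (EFin \o f).
Proof. by move=> mf fM; apply: integrable_dominated fM => //; exact: integrable_cst. Qed.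

Lemma integrable_add f g : P.-integrable setT (EFin \o f) ->
  P.-integrable setT (EFin \o g) -> P.-integrable setT (EFin \o (fun w => f w + g w)).
Proof. by move=> fi gi; have := integrableD measurableT fi gi. Qed.

Lemma integrable_scale c f : P.-integrable setT (EFin \o f) ->
  P.-integrable setT (EFin \o (fun w => c * f w)).
Proof. by move=> fi; have := integrableZl measurableT c fi. Qed.

Lemma integrable_sub f g : P.-integrable setT (EFin \o f) ->
  P.-integrable setT (EFin \o g) -> P.-integrable setT (EFin \o (fun w => f w - g w)).
Proof. by move=> fi gi; have := integrableB measurableT fi gi. Qed.

Lemma integrable_sumr (I : Type) (s : seq I) (h : I -> T -> R) :
  (forall i, P.-integrable setT (EFin \o h i)) ->
  P.-integrable setT (EFin \o (fun w => \sum_(i <- s) h i w)).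
Proof.
move=> hi; elim: s => [|i s IHs].
  by under [X in EFin \o X]eq_fun do rewrite big_nil; exact: integrable_cst.
by under [X in EFin \o X]eq_fun do rewrite big_cons; exact: integrable_add.
Qed.

Lemma integrable_ge0_lty f : measurable_fun setT f -> (forall w, 0 <= f w) ->
  (\int[P]_w (f w)%:E < +oo)%E -> P.-integrable setT (EFin \o f).
Proof.
move=> mf f0 flty; apply/integrableP; split; first exact/measurable_EFinP.
by under eq_integral do rewrite /= ger0_norm//.
Qed.

Lemma integrable_mul_sqr f g : measurable_fun setT f -> measurable_fun setT g ->
  P.-integrable setT (EFin \o (fun w => f w ^+ 2)) ->
  P.-integrable setT (EFin \o (fun w => g w ^+ 2)) ->
  P.-integrable setT (EFin \o (fun w => f w * g w)).
Proof.
move=> mf mg fi gi; apply: integrable_dominated (integrable_add fi gi) _.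
  exact: measurable_funM.
move=> w; rewrite normrM -(real_normK (num_real (f w))) -(real_normK (num_real (g w))).
have := sqr_ge0 (`|f w| - `|g w|); have := sqr_ge0 `|f w|; have := sqr_ge0 `|g w|; nra.
Qed.

Lemma integrable_sqrt f : measurable_fun setT f ->
  P.-integrable setT (EFin \o (fun w => f w ^+ 2)) ->
  P.-integrable setT (EFin \o f).
Proof.
move=> mf fi; apply: integrable_dominated (integrable_add fi (integrable_cst 1)) _ => //.
move=> w; rewrite -(real_normK (num_real (f w))); have := sqr_ge0 (`|f w| - 1).
have := normr_ge0 (f w); nra.
Qed.

Lemma integrable_mul_bounded f g M : measurable_fun setT g -> (forall w, `|g w| <= M) ->
  P.-integrable setT (EFin \o f) -> P.-integrable setT (EFin \o (fun w => f w * g w)).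
Proof.
move=> mg gM fi.
apply: integrable_dominated (integrable_scale M (integrable_norm fi)) _.
  by apply: measurable_funM => //; exact: integrable_meas.
by move=> w; rewrite normrM mulrC ler_wpM2r.
Qed.

Lemma Rint_cst c : \int[P]_w c = c.
Proof.
rewrite Rintegral_cst // (_ : fine _ = 1) ?mulr1//.
by rewrite -[RHS]/(fine 1%E) -(@probability_setT _ _ _ P).
Qed.

Lemma Rint_add f g : P.-integrable setT (EFin \o f) ->
  P.-integrable setT (EFin \o g) ->
  \int[P]_w (f w + g w) = \int[P]_w f w + \int[P]_w g w.
Proof. by move=> fi gi; rewrite RintegralD. Qed.

Lemma Rint_sub f g : P.-integrable setT (EFin \o f) ->
  P.-integrable setT (EFin \o g) ->
  \int[P]_w (f w - g w) = \int[P]_w f w - \int[P]_w g w.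
Proof. by move=> fi gi; rewrite RintegralB. Qed.

Lemma Rint_scale c f : P.-integrable setT (EFin \o f) ->
  \int[P]_w (c * f w) = c * \int[P]_w f w.
Proof. by move=> fi; rewrite RintegralZl. Qed.

Lemma Rint_sum (I : Type) (s : seq I) (h : I -> T -> R) :
  (forall i, P.-integrable setT (EFin \o h i)) ->
  \int[P]_w (\sum_(i <- s) h i w) = \sum_(i <- s) \int[P]_w h i w.
Proof.
move=> hi; elim: s => [|i s IHs].
  by rewrite big_nil; under eq_Rintegral do rewrite big_nil; rewrite Rint_cst.
rewrite big_cons -IHs -Rint_add//; last exact: integrable_sumr.
by under eq_Rintegral do rewrite big_cons.
Qed.

Lemma Rint_le f g : P.-integrable setT (EFin \o f) ->
  P.-integrable setT (EFin \o g) -> (forall w, f w <= g w) ->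
  \int[P]_w f w <= \int[P]_w g w.
Proof. by move=> fi gi fg; apply: le_Rintegral. Qed.

Lemma Rint_EFin f : P.-integrable setT (EFin \o f) ->
  (\int[P]_w (f w)%:E = (\int[P]_w f w)%:E)%E.
Proof. by move=> fi; rewrite fineK// integrable_fin_num. Qed.

Lemma Rint_ge0_ae f : P.-integrable setT (EFin \o f) ->
  {ae P, forall w, 0 <= f w} -> 0 <= \int[P]_w f w.
Proof.
move=> fi f0; rewrite /Rintegral.
have -> : (\int[P]_w (f w)%:E = \int[P]_w `|f w|%:E)%E.
  have mf := integrable_meas fi.
  apply: ae_eq_integral => //; first exact/measurable_EFinP.
    by apply/measurable_EFinP; exact: measurableT_comp.
  by apply: filterS f0 => w fw _; rewrite ger0_norm.
by apply: fine_ge0; apply: integral_ge0 => w _; rewrite lee_fin.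
Qed.

Lemma integral_sqr_le_bound f (D : R) : measurable_fun setT f ->
  {ae P, forall w, `|f w| <= D} -> (\int[P]_w ((f w) ^+ 2)%:E <= (D ^+ 2)%:E)%E.
Proof.
move=> mf uD.
apply: (@le_trans _ _ (\int[P]_t (D ^+ 2)%:E)%E).
  apply: ae_ge0_le_integral => //.
  - by move=> t _; rewrite lee_fin sqr_ge0.
  - by apply/measurable_EFinP; exact: measurable_funX.
  - by move=> t _; rewrite lee_fin sqr_ge0.
  - apply: filterS uD => t uD _; rewrite lee_fin -[f t ^+ 2]real_normK ?num_real//.
    by rewrite ler_pXn2r ?nnegrE// (le_trans _ uD).
by rewrite integral_cst//= probability_setT mule1.
Qed.

Lemma ae_bound_ge0 f (D : R) : {ae P, forall w, `|f w| <= D} -> 0 <= D.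
Proof.
move=> uD; rewrite -[D]Rint_cst; apply: Rint_ge0_ae; first exact: integrable_cst.
by apply: filterS uD => t; exact: le_trans.
Qed.

End real_expectation.

(** * Reflections and the rotation invariant law on the sphere *)

Section reflection.
Context {R : realType} {n : nat}.
Implicit Types (u v s : 'rV[R]_n).

Definition reflect_along v u := u - (2 * dot u v / dot v v) *: v.

(** The Householder reflection as a matrix acting on the right.  For [v = 0] the
    inverse of [dot v v] is 0 and the reflection is the identity. *)
Definition reflection_mx v : 'M[R]_n := 1%:M - (2 / dot v v) *: (v^T *m v).

Lemma mul_trmx_dot u v : u *m v^T = (dot u v)%:M.
Proof.
apply/matrixP => i j; rewrite !ord1 !mxE eqxx mulr1n.
by apply: eq_bigr => l _; rewrite mxE.
Qed.

Lemma mul_reflection_mx v u : u *m reflection_mx v = reflect_along v u.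
Proof.
rewrite /reflection_mx mulmxBr mulmx1 -scalemxAr mulmxA mul_trmx_dot mul_scalar_mx.
by rewrite scalerA; congr (_ - _ *: _); ring.
Qed.

Lemma reflection_mx_orthogonal v : reflection_mx v *m (reflection_mx v)^T = 1%:M.
Proof.
have -> : (reflection_mx v)^T = reflection_mx v.
  by rewrite /reflection_mx linearB/= linearZ/= trmx_mul trmxK trmx1.
set A := v^T *m v; set c := 2 / dot v v.
have AA : A *m A = dot v v *: A.
  by rewrite /A mulmxA -(mulmxA v^T) mul_trmx_dot mul_mx_scalar -scalemxAl.
have cc : c * c * dot v v = c + c.
  rewrite /c; have [->|v0] := eqVneq (dot v v) 0; first by rewrite invr0; ring.
  by field.
rewrite /reflection_mx -/A -/c mulmxBl !mulmxBr mul1mx mulmx1 -scalemxAl mul1mx.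
by rewrite -scalemxAr AA !scalerA cc scalerDl opprB addrK subrK.
Qed.

Lemma reflect_delta i u j :
  reflect_along (delta_mx 0 i) u 0 j = if j == i then - u 0 j else u 0 j.
Proof.
rewrite /reflect_along !dot_delta !mxE !eqxx divr1/=.
by case: eqP => [->|_]; rewrite ?mulr1 ?mulr0; ring.
Qed.

Lemma reflect_swap i j u l : i != j ->
  reflect_along (delta_mx 0 i - delta_mx 0 j) u 0 l = u 0 (tperm i j l).
Proof.
move=> ij; have ji : j == i = false by rewrite eq_sym (negbTE ij).
rewrite /reflect_along !dotBr !dotBl !dot_delta !mxE !eqxx (negbTE ij) ji /=.
rewrite (_ : 1 - 0 - (0 - 1) = 2 :> R); last by ring.
rewrite (_ : 2 * (u 0 i - u 0 j) / 2 = u 0 i - u 0 j); last by field.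
case: tpermP => [->|->|/eqP/negbTE li /eqP/negbTE lj].
- by rewrite eqxx (negbTE ij)/=; ring.
- by rewrite eqxx ji/=; ring.
- by rewrite li lj/=; ring.
Qed.

(** The reflection along [delta_mx 0 i - s] exchanges the unit vector [s] with
    the i-th basis vector. *)
Lemma reflect_to i s u : dot s s = 1 ->
  reflect_along (delta_mx 0 i - s) u 0 i = dot u s.
Proof.
move=> s1; rewrite /reflect_along; set v := delta_mx 0 i - s.
have vv : dot v v = 2 * (1 - s 0 i).
  by rewrite /v dotBl !dotBr s1 (dotC _ s) !dot_delta mxE !eqxx/=; ring.
have uv : dot u v = u 0 i - dot u s by rewrite /v dotBr dot_delta.
have [v0|v0] := eqVneq (dot v v) 0.
  have -> : dot u s = u 0 i.
    by apply/eqP; rewrite eq_sym -subr_eq0 -uv (dot_eq0 v0) dot0r.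
  by rewrite v0 invr0 mulr0 scale0r subr0.
rewrite !mxE uv vv !eqxx/= mulr1n; field.
by move: v0; rewrite vv mulf_eq0 negb_or => /andP[].
Qed.

End reflection.

Section sphere.
Context {R : realType} {n : nat} {d : measure_display} {T : measurableType d}.
Context (P : probability T R) (e : {RV P >-> borel_rV R n}).
Hypothesis he : uniform_on_sphere e.
Let ew w : 'rV[R]_n := e w.

Lemma sphere_dot w : dot (ew w) (ew w) = 1.
Proof. by rewrite -enorm_sqr (he.1 w) expr1n. Qed.

Lemma sphere_meas : measurable_fun setT (ew : T -> borel_rV R n).
Proof. exact: (@measurable_funPT _ _ _ _ e). Qed.

Lemma sphere_meas_coord i : measurable_fun setT (fun w => ew w 0 i).
Proof. by apply: (measurableT_comp (@measurable_coord R n i) sphere_meas). Qed.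

(** Rotation invariance is used only through reflections: they already generate
    sign changes, transpositions and the transport of any direction to a
    coordinate axis. *)
Lemma sphere_reflect (v : 'rV[R]_n) (h : 'rV[R]_n -> R) (M : R) :
  measurable_fun setT (h : borel_rV R n -> R) ->
  (forall u : 'rV[R]_n, dot u u = 1 -> `|h u| <= M) ->
  \int[P]_w h (reflect_along v (ew w)) = \int[P]_w h (ew w).
Proof.
move=> mh hM.
pose f := fun w => ew w *m reflection_mx v.
have mf : measurable_fun setT (f : T -> borel_rV R n).
  apply: measurable_to_borel_rV => i.
  under eq_fun do rewrite mxE.
  apply: measurable_sum => j.
  by apply: measurable_funM => //; exact: sphere_meas_coord.
have fE w : f w = reflect_along v (ew w) by exact: mul_reflection_mx.
have f1 w : dot (f w) (f w) = 1.
  have : f w *m (f w)^T = ew w *m (ew w)^T.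
    rewrite /f trmx_mul mulmxA -(mulmxA (ew w)) reflection_mx_orthogonal mulmx1//.
  by rewrite !mul_trmx_dot sphere_dot => /matrixP/(_ 0 0); rewrite !mxE.
have ih1 : P.-integrable setT (EFin \o (h \o f)).
  apply: (@integrable_bounded _ _ _ _ _ M) => [|w]; last exact: hM.
  exact: measurableT_comp mh mf.
have ih2 : P.-integrable setT (EFin \o (h \o ew)).
  apply: (@integrable_bounded _ _ _ _ _ M) => [|w]; last exact/hM/sphere_dot.
  exact: measurableT_comp mh sphere_meas.
rewrite /Rintegral; congr fine.
under eq_integral do rewrite -fE.
rewrite -[LHS](@integral_pushforward _ _ T (borel_rV R n) R f mf P setT (EFin \o h))//;
  last by exact/measurable_EFinP.
rewrite -[RHS](@integral_pushforward _ _ T (borel_rV R n) R ew sphere_meas P setT (EFin \o h))//;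
  last by exact/measurable_EFinP.
apply: eq_measure_integral => A mA _.
exact: (he.2 _ (reflection_mx_orthogonal v) A mA).
Qed.
End sphere.

(** * Moments of the rotation invariant law *)

(** In characteristic 0 the difference vanishes at infinitely many points. *)
Lemma poly_eq_of_horner (R : numDomainType) (p q : {poly R}) :
  (forall t, p.[t] = q.[t]) -> p = q.
Proof.
move=> pq; apply/eqP; rewrite -subr_eq0; apply/eqP.
apply: (@roots_geq_poly_eq0 _ _ [seq i%:R | i <- iota 0 (size (p - q))]).
- by apply/allP => _ /mapP[i _ ->]; rewrite /root hornerD hornerN pq subrr.
- by rewrite map_inj_uniq ?iota_uniq// => i j /eqP; rewrite eqr_nat => /eqP.
- by rewrite size_map size_iota.
Qed.

Lemma coef2_expr_1DX2 (R : comNzRingType) k : ((1 + 'X^2 : {poly R}) ^+ k)`_2 = k%:R.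
Proof.
suff [] : ((1 + 'X^2 : {poly R}) ^+ k)`_0 = 1 /\ ((1 + 'X^2 : {poly R}) ^+ k)`_2 = k%:R.
  by [].
elim: k => [|k [IH0 IH2]]; first by rewrite expr0 !coef1.
by rewrite exprS mulrDl mul1r !coefD !coefXnM/= IH0 IH2 addr0 -natr1.
Qed.

Lemma leq_bernoulli k m : (k ^ m * (k + m) <= k * k.+1 ^ m)%N.
Proof.
elim: m => [|m IHm]; first by rewrite !expn0; lia.
have h : (k.+1 * (k ^ m * (k + m)) <= k.+1 * (k * k.+1 ^ m))%N by rewrite leq_mul2l IHm orbT.
rewrite !expnS mulnCA (leq_trans _ h)// -mulnA mulnCA [leqRHS]mulnCA leq_mul2l.
by apply/orP; right; lia.
Qed.

Lemma prod_odd_le k : (\prod_(i < k) (2 * i + 1) <= k ^ k)%N.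
Proof.
elim: k => [|k IHk]; first by rewrite big_ord0.
rewrite big_ord_recr/=.
have [->|k0] := posnP k; first by rewrite big_ord0.
have h : (2 * k ^ k <= k.+1 ^ k)%N.
  rewrite -(leq_pmul2l k0) (leq_trans _ (leq_bernoulli k k))//.
  by rewrite mulnA (mulnC (k ^ k)%N) addnn -mul2n (mulnC k).
apply: (@leq_trans (k ^ k * (2 * k + 1))); first by rewrite leq_mul2r IHk orbT.
rewrite expnS; apply: (@leq_trans (k.+1 * (2 * k ^ k))); last by rewrite leq_mul2l h orbT.
nia.
Qed.

Section sphere_moments.
Context {R : realType} {n : nat} {d : measure_display} {T : measurableType d}.
Context (P : probability T R) (e : {RV P >-> borel_rV R n}).
Hypothesis he : uniform_on_sphere e.
Let ew w : 'rV[R]_n := e w.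

Lemma sphere_integrable (h : 'rV[R]_n -> R) M :
  measurable_fun setT (h : borel_rV R n -> R) ->
  (forall u : 'rV[R]_n, dot u u = 1 -> `|h u| <= M) ->
  P.-integrable setT (EFin \o (fun w => h (ew w))).
Proof.
move=> mh hM; apply: (@integrable_bounded _ _ _ _ _ M) => [|w].
  exact: measurableT_comp mh (sphere_meas e).
by apply: hM; exact: sphere_dot.
Qed.

Lemma coordX_le1 (u : 'rV[R]_n) i k : dot u u = 1 -> `|u 0 i ^+ k| <= 1.
Proof. by move=> u1; rewrite normrX exprn_ile1// coord_le1. Qed.

Lemma integrable_monomial i j k l :
  P.-integrable setT (EFin \o (fun w => ew w 0 i ^+ k * ew w 0 j ^+ l)).
Proof.
apply: (@sphere_integrable (fun u => u 0 i ^+ k * u 0 j ^+ l) 1) => [|u u1].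
  by apply: measurable_funM; exact: measurable_coordX.
by rewrite normrM mulr_ile1// coordX_le1.
Qed.

Lemma integrable_power i k : P.-integrable setT (EFin \o (fun w => ew w 0 i ^+ k)).
Proof.
apply: (@sphere_integrable (fun u => u 0 i ^+ k) 1) => [|u u1].
  exact: measurable_coordX.
exact: coordX_le1.
Qed.

Lemma sphere_unit_power (s : 'rV[R]_n) i k : dot s s = 1 ->
  \int[P]_w (dot (ew w) s ^+ k) = \int[P]_w (ew w 0 i ^+ k).
Proof.
move=> s1; rewrite -(sphere_reflect he (delta_mx 0 i - s) (measurable_coordX i k)
  (fun u u1 => coordX_le1 i k u1)).
by under [RHS]eq_Rintegral do rewrite reflect_to//.
Qed.

(** A linear form of norm [r] has the moments of [r] times one coordinate; the
    form [e_i + t e_j] has squared norm [1 + t ^ 2]. *)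
Lemma sphere_pair_power i j k t : i != j ->
  \int[P]_w ((ew w 0 i + t * ew w 0 j) ^+ (2 * k)) =
  (1 + t ^+ 2) ^+ k * \int[P]_w (ew w 0 i ^+ (2 * k)).
Proof.
move=> ij; have ji : j == i = false by rewrite eq_sym (negbTE ij).
have r0 : 0 < 1 + t ^+ 2 by rewrite ltr_pwDl// sqr_ge0.
pose r := Num.sqrt (1 + t ^+ 2).
have rr : r ^+ 2 = 1 + t ^+ 2 by rewrite sqr_sqrtr// ltW.
have rp : 0 < r by rewrite sqrtr_gt0.
pose s : 'rV[R]_n := r^-1 *: (delta_mx 0 i + t *: delta_mx 0 j).
have s1 : dot s s = 1.
  rewrite dotZl dotZr dotDl !dotDr !dotZl !dotZr !dot_delta !mxE !eqxx (negbTE ij) ji/=.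
  rewrite (_ : 1 + _ + _ = r ^+ 2); last by rewrite rr; ring.
  by field; rewrite gt_eqF.
rewrite -(sphere_unit_power i (2 * k) s1) -rr -exprM -Rint_scale; last first.
  apply: (@sphere_integrable (fun u => dot u s ^+ (2 * k)) 1) => [|u u1].
    apply: measurable_funX; apply: measurable_sum => l.
    by apply: measurable_funM => //; exact: measurable_coord.
  rewrite normrX exprn_ile1// -(ler_pXn2r (ltn0Sn 1)) ?nnegrE// expr1n.
  rewrite real_normK ?num_real//.
  by have := dot_CS u s; rewrite u1 s1 mulr1.
apply: eq_Rintegral => w _; rewrite -exprMn; congr (_ ^+ _).
rewrite /s dotZr dotDr dotZr !dot_delta mulrA divff ?gt_eqF// mul1r//.
Qed.

(** Both sides of [sphere_pair_power] are polynomials in [t]; the identity is the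
    comparison of the coefficients of [t ^ 2]. *)
Lemma sphere_mixed_moment i j k : i != j -> (0 < k)%N ->
  \int[P]_w (ew w 0 i ^+ (2 * k)) =
  (2 * k - 1)%:R * \int[P]_w (ew w 0 i ^+ (2 * k - 2) * ew w 0 j ^+ 2).
Proof.
move=> ij k0; set c := \int[P]_w _.
pose m l := \int[P]_w (ew w 0 i ^+ (2 * k - l) * ew w 0 j ^+ l).
pose p := \poly_(l < (2 * k).+1) (m l *+ 'C(2 * k, l)).
(* [p.[t]] is the expectation of [(e_i + t e_j) ^ (2 k)], expanded. *)
have pE : p = c *: (1 + 'X^2) ^+ k.
  apply: poly_eq_of_horner => t.
  rewrite hornerZ horner_exp hornerD hornerXn hornerC mulrC -(sphere_pair_power k t ij).
  rewrite /p horner_poly.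
  under [RHS]eq_Rintegral do rewrite exprDn.
  rewrite Rint_sum => [|l].
    apply: eq_bigr => l _.
    rewrite (_ : _ * _ = ('C(2 * k, l)%:R * t ^+ l) * m l); last first.
      by rewrite -mulr_natr; ring.
    rewrite -Rint_scale.
      by apply: eq_Rintegral => w _; rewrite exprMn -mulr_natr; ring.
    exact: integrable_monomial.
  rewrite (_ : (fun w => _) = (fun w => ('C(2 * k, l)%:R * t ^+ l) *
    (ew w 0 i ^+ (2 * k - l) * ew w 0 j ^+ l))).
    by apply: integrable_scale; exact: integrable_monomial.
  by apply/funext => w; rewrite exprMn -mulr_natr; ring.
have := congr1 (fun q : {poly R} => q`_2) pE.
rewrite /= coefZ coef2_expr_1DX2 coef_poly ifT; last by lia.
rewrite -/(m 2) -[m 2 *+ _]mulr_natr => h.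
have k0R : k%:R != 0 :> R by rewrite pnatr_eq0 -lt0n.
apply: (mulIf k0R); rewrite -h [LHS]mulrC [RHS]mulrAC -natrM; congr (_%:R * _).
by rewrite bin2 -mulnA mul2n doubleK mulnC subn1.
Qed.

(** Multiply [e_i ^ (2k-2)] by [1 = sum_j e_j ^ 2] and use the mixed moments for
    the [n - 1] terms with [j != i]; the term [j = i] is at least as large. *)
Lemma sphere_moment_rec i k : (0 < k)%N ->
  n%:R * \int[P]_w (ew w 0 i ^+ (2 * k)) <=
  (2 * k - 1)%:R * \int[P]_w (ew w 0 i ^+ (2 * k - 2)).
Proof.
move=> k0; set c := \int[P]_w (ew w 0 i ^+ (2 * k)).
have c0 : 0 <= c by apply: Rintegral_ge0 => w _; rewrite exprM exprn_ge0// sqr_ge0.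
have K0 : 1 <= (2 * k - 1)%:R :> R by rewrite ler1n; lia.
have -> : \int[P]_w (ew w 0 i ^+ (2 * k - 2)) =
    \sum_j \int[P]_w (ew w 0 i ^+ (2 * k - 2) * ew w 0 j ^+ 2).
  rewrite -Rint_sum => [|j]; last exact: integrable_monomial.
  apply: eq_Rintegral => w _; rewrite -mulr_sumr.
  have := sphere_dot he w; rewrite /dot => h.
  by under eq_bigr do rewrite expr2; rewrite h mulr1.
rewrite mulr_sumr (bigD1 i)//=.
have -> : \int[P]_w (ew w 0 i ^+ (2 * k - 2) * ew w 0 i ^+ 2) = c.
  by apply: eq_Rintegral => w _; rewrite -exprD subnK//; lia.
rewrite (eq_bigr (fun=> c)) => [|j ji]; last by rewrite -sphere_mixed_moment// eq_sym.
rewrite sumr_const (eq_card (_ : _ =i predC1 i))// cardC1 card_ord -[c *+ _]mulr_natl.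
have n0 : (0 < n)%N := leq_ltn_trans (leq0n _) (ltn_ord i).
have -> : n%:R = n.-1%:R + 1 :> R by rewrite natr1 prednK.
by rewrite mulrDl mul1r [leLHS]addrC lerD2r ler_peMl.
Qed.

(** The recursion gives the product of the odd numbers below [2 k] over [n ^ k],
    and that product is at most [k ^ k]. *)
Lemma sphere_moment_le i k :
  \int[P]_w (ew w 0 i ^+ (2 * k)) <= (k%:R / n%:R) ^+ k.
Proof.
have n0 : (0 < n)%N := leq_ltn_trans (leq0n _) (ltn_ord i).
have n0R : 0 < n%:R :> R by rewrite ltr0n.
apply: (@le_trans _ _ ((\prod_(i < k) (2 * i + 1))%N%:R / n%:R ^+ k)); last first.
  rewrite expr_div_n ler_wpM2r ?invr_ge0 ?exprn_ge0//.
  by rewrite -natrX ler_nat prod_odd_le.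
elim: k => [|k IHk].
  by rewrite big_ord0 expr0 divr1; under eq_Rintegral do rewrite expr0; rewrite Rint_cst.
have := @sphere_moment_rec i k.+1 (ltn0Sn _).
rewrite (_ : (2 * k.+1 - 2)%N = (2 * k)%N); last by lia.
rewrite (_ : (2 * k.+1 - 1)%N = (2 * k + 1)%N); last by lia.
have /(ler_wpM2l (ler0n R (2 * k + 1))) := IHk => /[swap] /le_trans /[apply].
rewrite -ler_pdivlMl// => /le_trans; apply.
rewrite big_ord_recr/= natrM exprS; move: (n%:R ^+ k) (exprn_gt0 k n0R) => N N0.
rewrite le_eqVlt; apply/orP; left; apply/eqP; field.
by rewrite !gt_eqF.
Qed.

(** A sign change of the i-th coordinate kills the mixed terms, and exchanging
    coordinates makes the diagonal terms equal; these sum to the mean of [W]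
    because [e] is a unit vector. *)
Lemma sphere_weighted_cov (W : 'rV[R]_n -> R) (M : R) i j :
  measurable_fun setT (W : borel_rV R n -> R) ->
  (forall u : 'rV[R]_n, dot u u = 1 -> `|W u| <= M) ->
  (forall l u, W (reflect_along (delta_mx 0 l) u) = W u) ->
  (forall l l' u, W (reflect_along (delta_mx 0 l - delta_mx 0 l') u) = W u) ->
  \int[P]_w (ew w 0 i * ew w 0 j * W (ew w)) =
  (i == j)%:R * (n%:R^-1 * \int[P]_w W (ew w)).
Proof.
move=> mW WM Wflip Wswap.
have mij a b : measurable_fun setT (fun u : borel_rV R n =>
    (u : 'rV[R]_n) 0 a * (u : 'rV[R]_n) 0 b * W u).
  apply: measurable_funM => //; apply: measurable_funM; exact: measurable_coord.
have bij a b (u : 'rV[R]_n) : dot u u = 1 -> `|u 0 a * u 0 b * W u| <= M.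
  move=> u1; rewrite !normrM -[leRHS]mul1r ler_pM// ?WM//.
  by rewrite mulr_ile1// coord_le1.
have inv a b v := sphere_reflect he v (mij a b) (bij a b).
have [<-|ij] := eqVneq i j; last first.
  rewrite mul0r; have := inv i j (delta_mx 0 i).
  under eq_Rintegral do rewrite !reflect_delta Wflip eqxx eq_sym (negbTE ij) !mulNr -mulN1r.
  rewrite Rint_scale; last exact: (sphere_integrable (mij i j) (bij i j)).
  by move=> h; apply/eqP; rewrite -[_ == 0](mulrn_eq0 _ 2) mulr2n -{1}h mulN1r addNr.
rewrite mul1r.
have h l : \int[P]_w (ew w 0 l * ew w 0 l * W (ew w)) =
    \int[P]_w (ew w 0 i * ew w 0 i * W (ew w)).
  have [->//|li] := eqVneq l i; rewrite -(inv l l (delta_mx 0 l - delta_mx 0 i)).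
  by under eq_Rintegral do rewrite !reflect_swap// tpermL Wswap.
have n0 : (0 < n)%N := leq_ltn_trans (leq0n _) (ltn_ord i).
have n0R : n%:R != 0 :> R by rewrite pnatr_eq0 -lt0n.
apply: (mulfI n0R); rewrite mulrA divff// mul1r.
have -> : \int[P]_w W (ew w) = \sum_(l < n) \int[P]_w (ew w 0 l * ew w 0 l * W (ew w)).
  rewrite -Rint_sum => [|l]; last exact: (sphere_integrable (mij l l) (bij l l)).
  by apply: eq_Rintegral => w _; rewrite -mulr_suml -/(dot _ _) (sphere_dot he) mul1r.
by rewrite (eq_bigr _ (fun l _ => h l)) sumr_const card_ord mulr_natl.
Qed.

End sphere_moments.

(** * Independence of generated sigma-algebras *)

Section independence.
Context {R : realType} {d : measure_display} {T : measurableType d}.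
Context (P : probability T R) {I : finType} (G : I -> set_system T).
Hypothesis GT : forall i, G i setT.
Hypothesis GI : forall i, setI_closed (G i).
Hypothesis Gm : forall i, G i `<=` measurable.
Hypothesis hG : mutually_independent P G.

Definition joint_sigma (J : {set I}) : set_system T :=
  <<s \bigcup_(i in [set` J]) G i >>.

Lemma joint_sigma_sub (J J' : {set I}) : J \subset J' -> joint_sigma J `<=` joint_sigma J'.
Proof.
move=> /fintype.subsetP JJ'; apply: smallest_sub; first exact: smallest_sigma_algebra.
by move=> A [i /= iJ GiA]; apply: sub_gen_smallest; exists i => //=; exact: JJ'.
Qed.

Lemma sub_joint_sigma (J : {set I}) i : i \in J -> G i `<=` joint_sigma J.
Proof. by move=> iJ A GA; apply: sub_gen_smallest; exists i. Qed.

Lemma joint_sigma_measurable (J : {set I}) : joint_sigma J `<=` measurable.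
Proof.
apply: smallest_sub; first exact: sigma_algebra_measurable.
by move=> A [i _]; exact: Gm.
Qed.

(** The finite intersections of events of the sources in [J] form a pi-system
    that generates [joint_sigma J].  On it both sides, as measures of [A], agree
    by mutual independence, hence they agree on the generated sigma-algebra. *)
Lemma joint_sigma_indep (J : {set I}) j A B : j \notin J -> G j B -> joint_sigma J A ->
  P (A `&` B) = (P A * P B)%E.
Proof.
move=> jJ GB sA.
have mB : measurable B := Gm GB.
pose Pi : set_system T := [set A | exists2 F : I -> set T,
  (forall i, i \in J -> G i (F i)) & A = \bigcap_(i in [set` J]) F i].
have Pim : Pi `<=` measurable.
  move=> _ [F GF ->]; apply: fin_bigcap_measurable => //.
  by move=> i /= /GF; exact: Gm.
have PiI : setI_closed Pi.
  move=> _ _ [F GF ->] [F' GF' ->]; exists (fun i => F i `&` F' i).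
    by move=> i iJ; apply: GI; [exact: GF|exact: GF'].
  by rewrite bigcapI.
have PiE C : Pi C -> P (C `&` B) = (P C * P B)%E.
  move=> [F GF ->].
  (* One family carries the events of [J] together with [B] at [j]. *)
  pose F' i := if i == j then B else F i.
  have FF' i : i \in J -> F' i = F i.
    by rewrite /F'; case: eqP => // ->; rewrite (negbTE jJ).
  have := hG (J := j |: J) (A := F'); rewrite big_setU1//=.
  rewrite (eq_bigr (P \o F)) => [|i iJ]; last by rewrite /= FF'.
  rewrite -(hG (J := J) (A := F))// /F' eqxx muleC => <-; last first.
    move=> i; rewrite !inE; case: eqP => [->|_]//=; exact: GF.
  congr (P _); rewrite setIC; apply/seteqP; split=> [w [Bw Fw] i /=|w Fw].
    by rewrite !inE => /orP[->//|iJ]; case: eqP => // _; exact: Fw.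
  split; first by have := Fw j; rewrite /= !inE eqxx; exact.
  by move=> i /= iJ; have := Fw i; rewrite /= -/(F' i) FF'// !inE iJ orbT; exact.
have sPi : <<s Pi >> A.
  apply: (@smallest_sub _ _ (\bigcup_(i in [set` J]) G i) <<s Pi >>) sA.
    exact: smallest_sigma_algebra.
  move=> C [i /= iJ GC]; apply: sub_gen_smallest.
  exists (fun l => if l == i then C else setT).
    by move=> l lJ; case: eqP => // ->.
  apply/seteqP; split=> [w Cw l /= lJ|w Cw]; first by case: eqP.
  by have := Cw i iJ; rewrite eqxx.
have PB0 : 0 <= fine (P B) by exact: fine_ge0.
(* [A |-> P (A `&` B)] and [A |-> P A * P B] are finite measures. *)
pose m2 := mscale (NngNum PB0) P.
have := @g_sigma_algebra_measure_unique_trace _ _ T Pi setT measurableT _ _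
  (mrestr P mB) m2.
have -> : [set X | Pi X /\ X `<=` setT] = Pi.
  by apply/seteqP; split=> [C []//|C PC]; split.
have m2E C : m2 C = (P C * P B)%E.
  by rewrite /m2/= /mscale/= muleC fineK// fin_num_measure.
move=> /(_ Pim PiI) h; rewrite -m2E; apply: h => //.
- transitivity (P B); first by rewrite -[in RHS](setTI B).
  by rewrite -[LHS]mul1e -(probability_setT P) -m2E.
- by move=> C PC; transitivity (P C * P B)%E; [exact: PiE|rewrite -m2E].
- apply: (@le_lt_trans _ _ (P B)); first by rewrite -[in leRHS](setTI B).
  by rewrite (le_lt_trans (probability_le1 P mB))// ltry.
Qed.

End independence.

Section freezing.
Context {R : realType} {d dS dS' : measure_display}.
Context {T : measurableType d} {S : measurableType dS} {S' : measurableType dS'}.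
Context (P : probability T R) (Q : probability S' R).
Context (Y : T -> S) (Z : T -> S').
Hypothesis mY : measurable_fun setT Y.
Hypothesis mZ : measurable_fun setT Z.
Hypothesis lawZ : forall B, measurable B -> P (Z @^-1` B) = Q B.
Hypothesis YZ : forall A B, measurable A -> measurable B ->
  P (Y @^-1` A `&` Z @^-1` B) = (P (Y @^-1` A) * P (Z @^-1` B))%E.

Let mfY : {mfun T >-> S} :=
  MeasurableFun.Pack (MeasurableFun.Class (isMeasurableFun.Build _ _ _ _ Y mY)).
Let YZf w := (Y w, Z w).
Let mYZ : measurable_fun setT YZf := measurable_fun_pair mY mZ.
Let mfYZ : {mfun T >-> (S * S')%type} :=
  MeasurableFun.Pack (MeasurableFun.Class (isMeasurableFun.Build _ _ _ _ YZf mYZ)).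

Let lawYZ C : measurable C ->
  ((distribution P mfY) \x Q)%E C = distribution P mfYZ C.
Proof.
move=> mC; apply: product_measure_unique => // A B mA mB.
by rewrite /distribution/= /pushforward/= -lawZ// -YZ.
Qed.

Local Open Scope ereal_scope.

Lemma freezing_ge0 (phi : S * S' -> \bar R) : measurable_fun setT phi ->
  (forall z, 0 <= phi z) ->
  \int[P]_w phi (Y w, Z w) = \int[P]_w \int[Q]_z phi (Y w, z).
Proof.
move=> mphi phi0.
transitivity (\int[distribution P mfYZ]_z phi z).
  by rewrite ge0_integral_distribution.
transitivity (\int[distribution P mfY \x Q]_z phi z).
  by apply: eq_measure_integral => A mA _; apply/esym/lawYZ.
rewrite fubini_tonelli1//.
rewrite ge0_integral_distribution//.
  exact: measurable_fun_fubini_tonelli_F.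
by move=> y; exact: integral_ge0.
Qed.

(** Under independence the joint law of [(Y, Z)] is the product of the two laws;
    by Fubini the integral is computed with [Y] held fixed.  It plays the role of
    the conditional expectation given [Y]. *)
Lemma freezing (phi : S * S' -> R) : measurable_fun setT phi ->
  P.-integrable setT (EFin \o (fun w => phi (Y w, Z w))) ->
  (forall y, Q.-integrable setT (EFin \o (fun z => phi (y, z)))) ->
  (\int[P]_w phi (Y w, Z w) = \int[P]_w \int[Q]_z phi (Y w, z))%R.
Proof.
move=> mphi iphi iQ; have mephi : measurable_fun setT (EFin \o phi) by exact/measurable_EFinP.
rewrite /Rintegral; congr fine.
transitivity (\int[distribution P mfYZ]_z (phi z)%:E).
  by rewrite (integral_distribution (f := EFin \o phi)).
have E : forall f : S * S' -> \bar R, \int[distribution P mfY \x Q]_z f z =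
    \int[distribution P mfYZ]_z f z.
  by move=> f; apply: eq_measure_integral => A mA _; exact: lawYZ.
rewrite -E.
have ipr : (distribution P mfY \x Q).-integrable setT (EFin \o phi).
  apply/integrableP; split => //; rewrite E.
  have /integrableP[_] := integrable_pushforward mYZ mephi iphi measurableT.
  by [].
rewrite -(integral12_prod_meas1 ipr)/=.
have FE y : \int[Q]_z (phi (y, z))%:E = (fine (\int[Q]_z (phi (y, z))%:E))%:E.
  by rewrite fineK//; exact: (integrable_fin_num measurableT (iQ y)).
rewrite (integral_distribution (f := fun y => \int[Q]_z (phi (y, z))%:E)).
- by apply: eq_integral => w _; rewrite -FE.
- exact: measurable_fubini_F ipr.
- apply/integrableP; split.
    apply: (measurableT_comp _ mY); exact: measurable_fubini_F ipr.
  have /integrableP[_] := iphi; apply: le_lt_trans.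
  rewrite (freezing_ge0 (phi := abse \o (EFin \o phi))); first last.
  - by move=> z; exact: abse_ge0.
  - exact: measurableT_comp.
  apply: ge0_le_integral => //.
  - apply: measurableT_comp => //; apply: (measurableT_comp _ mY).
    exact: measurable_fubini_F ipr.
  - apply: (measurableT_comp (f := fun y => \int[Q]_z `|(phi (y, z))%:E|) _ mY).
    apply: (measurable_fun_fubini_tonelli_F (abse \o (EFin \o phi))) => //.
      exact: measurableT_comp.
    by move=> z; exact: abse_ge0.
  - move=> w _; apply: le_abse_integral => //.
    by have /integrableP[] := iQ (Y w).
Qed.

End freezing.

(** * Gradients, convexity and quadratic bounds *)

Section gradients.
Context {R : realType} {n : nat}.
Implicit Types (h : 'rV[R]_n -> R) (x y v s : 'rV[R]_n).

(** Derivatives as limits of a sequence, which is what measurability of the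
    partial derivatives calls for. *)
Lemma derivable_cvg_seq h x v : derivable h x v ->
  k.+1%:R * (h (x + k.+1%:R^-1 *: v) - h x) @[k --> \oo] --> 'D_v h x.
Proof.
move=> dh; pose u (k : nat) : R := k.+1%:R^-1.
have u0 : u k @[k --> \oo] --> 0^'.
  move=> A A0; have H : \forall k \near \oo, u k != 0 -> A (u k).
    by have H := @cvg_harmonic R _ A0; exact H.
  by apply: filterS H => k; apply; rewrite invr_neq0.
have := cvg_comp _ _ u0 dh; apply: cvg_trans; apply: near_eq_cvg.
by apply: nearW => k; rewrite /= /u invrK (addrC x).
Qed.

Lemma derive_gradient h x v : differentiable h x -> 'D_v h x = dot (gradient h x) v.
Proof.
move=> dh; rewrite deriveE// [in LHS](row_sum_delta v) linear_sum.
apply: eq_bigr => i _; rewrite linearZ/= mxE mulrC.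
by rewrite -deriveE.
Qed.

Lemma gradient_ge h x v c : differentiable h x ->
  (forall t, 0 < t <= 1 -> t * c <= h (x + t *: v) - h x) ->
  c <= dot (gradient h x) v.
Proof.
move=> dh H; rewrite -derive_gradient//.
apply: (cvgr_to_ge (derivable_cvg_seq (v := v) (diff_derivable dh))).
apply: nearW => k; rewrite -ler_pdivrMl//.
by apply: H; rewrite invr_gt0 ltr0n invf_le1// ler1n.
Qed.

Lemma gradient_le h x v c : differentiable h x ->
  (forall t, 0 < t <= 1 -> h (x + t *: v) - h x <= t * c) ->
  dot (gradient h x) v <= c.
Proof.
move=> dh H; rewrite -derive_gradient//.
apply: (cvgr_to_le (derivable_cvg_seq (v := v) (diff_derivable dh))).
apply: nearW => k; rewrite -ler_pdivlMl//.
by apply: H; rewrite invr_gt0 ltr0n invf_le1// ler1n.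
Qed.

Lemma convex_gradient_ineq h x y : differentiable h x ->
  convex_function setT h -> dot (gradient h x) (y - x) <= h y - h x.
Proof.
move=> dh ch; apply: gradient_le => // t /andP[t0 t1].
have H : h (t *: y + (1 - t) *: x) <= t * h y + (1 - t) * h x.
  by have := ch (Itv01 (ltW t0) t1) y x; rewrite !inE => /(_ I I); exact.
have -> : x + t *: (y - x) = t *: y + (1 - t) *: x.
  by rewrite scalerBr scalerBl scale1r addrCA.
rewrite lerBlDr (le_trans H)// le_eqVlt; apply/orP; left; apply/eqP; ring.
Qed.

(** Comparing the increments of [h] in the directions [v] and [- v] leaves the
    gradient as the only subgradient. *)
Lemma subgradient_unique h x s : differentiable h x ->
  (forall y, dot s (y - x) <= h y - h x) -> gradient h x = s.
Proof.
move=> dh H; have sv v : dot s v <= dot (gradient h x) v.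
  apply: gradient_ge => // t _.
  by have := H (x + t *: v); rewrite addrAC subrr add0r dotZr.
apply/rowP => i; have := sv (delta_mx 0 i); have := sv (- delta_mx 0 i).
rewrite !dotNr !dot_delta lerN2 => h1 h2; apply/eqP; rewrite eq_le h1 h2//.
Qed.

(** Jensen's inequality for the uniform average, from the subgradient inequality
    at the average, whose linear terms cancel. *)
Lemma mean_value_le h (a : 'rV[R]_n -> 'rV[R]_n) (N : nat)
    (x : nat -> 'rV[R]_n) :
  (forall x y, dot (a x) (y - x) <= h y - h x) -> (0 < N)%N ->
  h (N%:R^-1 *: \sum_(k < N) x k) <= N%:R^-1 * \sum_(k < N) h (x k).
Proof.
move=> h_ge N0; have N0R : 0 < N%:R :> R by rewrite ltr0n.
set xb := N%:R^-1 *: _.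
have s0 : \sum_(k < N) dot (a xb) (x k - xb) = 0.
  under eq_bigr do rewrite dotC.
  rewrite -dot_suml sumrB sumr_const card_ord -scaler_nat /xb scalerA.
  by rewrite divff ?gt_eqF// scale1r subrr dot0l.
have : 0 <= \sum_(k < N) (h (x k) - h xb).
  by rewrite -[leLHS]s0; apply: ler_sum => k _; exact: h_ge.
by rewrite sumrB sumr_const card_ord subr_ge0 ler_pdivlMl// mulr_natl.
Qed.

Lemma shift_cont (c : 'rV[R]_n) : continuous (fun x : 'rV[R]_n => x + c).
Proof.
move=> x; have FF : Filter (nbhs x) by exact: nbhs_filter.
have := @cvgD _ _ _ (nbhs x) FF (@id 'rV[R]_n) (cst c) x c (@cvg_id _ (nbhs x)) (cvg_cst c).
exact.
Qed.

Lemma dot_continuous s : continuous (dot s).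
Proof.
apply: continuous_big => [|i _]; first exact: add_continuous.
move=> x; apply: (@continuousM _ _ (cst (s 0 i)) (fun y => y 0 i)).
  exact: cst_continuous.
exact: coord_continuous.
Qed.

Lemma dot_sqr_continuous : continuous (fun y => dot y y).
Proof.
apply: continuous_big => [|i _]; first exact: add_continuous.
by move=> x; apply: continuousM; exact: coord_continuous.
Qed.

Lemma measurable_partial h i : continuous h ->
  (forall x, derivable h x (delta_mx 0 i)) ->
  measurable_fun setT (fun x : borel_rV R n => gradient h x 0 i).
Proof.
move=> ch dh.
apply: (@measurable_fun_cvg _ _ _ setT (fun k (x : borel_rV R n) =>
   k.+1%:R * (h ((x : 'rV[R]_n) + k.+1%:R^-1 *: delta_mx 0 i) - h x))).
- move=> k; apply: measurable_funM => //; apply: measurable_funB; last first.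
    exact: (continuous_borel_measurable ch).
  apply: (@continuous_borel_measurable R n
    (fun x : 'rV[R]_n => h (x + k.+1%:R^-1 *: delta_mx 0 i))) => x.
  apply: (@continuous_comp _ _ _ (fun x => x + k.+1%:R^-1 *: delta_mx 0 i) h).
    exact: shift_cont.
  exact: ch.
- move=> x _; rewrite mxE; exact: derivable_cvg_seq.
Qed.

End gradients.

Section quadratic_bounds.
Context {R : realType} {n : nat}.
Context (f : 'rV[R]_n -> R) (a : 'rV[R]_n -> 'rV[R]_n) (L : R).
Hypothesis L0 : 0 < L.
Hypothesis fa_ge : forall x y, dot (a x) (y - x) <= f y - f x.
Hypothesis fa_le : forall x y,
  f y - f x <= dot (a x) (y - x) + L * dot (y - x) (y - x).

(** The difference quotient deviates from [dot (a x) v] by at most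
    [`|t| * (L * dot v v)]. *)
Lemma quadratic_is_derive x v : is_derive x v f (dot (a x) v).
Proof.
have q : h^-1 *: ((f \o shift x) (h *: v) - f x) @[h --> 0^'] --> dot (a x) v.
  apply/cvgrPdist_le => eps eps0; near=> t.
  have t0 : t != 0 by near: t; exact: nbhs_dnbhs_neq.
  rewrite /= -[_ *: _]/(t^-1 * _) distrC.
  have -> : t^-1 * (f (t *: v + x) - f x) - dot (a x) v =
     t^-1 * (f (t *: v + x) - f x - dot (a x) (t *: v)).
    by rewrite dotZr; field.
  have h1 := fa_ge x (t *: v + x); have h2 := fa_le x (t *: v + x).
  rewrite addrK in h1 h2.
  have X0 : 0 <= f (t *: v + x) - f x - dot (a x) (t *: v) by rewrite subr_ge0.
  rewrite normrM normfV (ger0_norm X0) ler_pdivrMl ?normr_gt0//.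
  apply: (@le_trans _ _ (L * dot (t *: v) (t *: v))); first by rewrite lerBlDl.
  have -> : L * dot (t *: v) (t *: v) = `|t| * (`|t| * (L * dot v v)).
    have tt : `|t| * `|t| = t * t by rewrite -!expr2 real_normK ?num_real.
    rewrite dotZl dotZr [RHS](_ : _ = (`|t| * `|t|) * (L * dot v v)); last by ring.
    by rewrite tt; ring.
  rewrite ler_wpM2l//.
  have : `|t| <= eps / (L * dot v v + 1).
    near: t; apply: dnbhs0_le; rewrite divr_gt0// ltr_wpDl//.
    by rewrite mulr_ge0// ?dot_ge0// ltW.
  have D0 : 0 < L * dot v v + 1 by rewrite ltr_wpDl// mulr_ge0 ?dot_ge0// ltW.
  rewrite ler_pdivlMr// => h; apply: le_trans h.
  by rewrite ler_wpM2l// lerDl.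
apply: DeriveDef; first by apply/cvg_ex; exists (dot (a x) v).
by apply: cvg_lim => //.
Unshelve. all: by end_near. Qed.

Lemma quadratic_gradient x : gradient f x = a x.
Proof.
apply/rowP => i; rewrite mxE (derive_val (is_derive := quadratic_is_derive x _)).
exact: dot_delta.
Qed.

(** Compare the minimal value with the value after a gradient step of length
    [1 / (2 L)]. *)
Lemma quadratic_gradient_sqr x xs : is_argmin f xs ->
  dot (a x) (a x) <= 4 * L * (f x - f xs).
Proof.
move=> fmin; pose y := x - (2 * L)^-1 *: a x.
have := fa_le x y; rewrite /y addrAC subrr add0r !dotNr dotNl opprK !dotZr dotZl -/y.
have := fmin y; move: (dot (a x) (a x)) (f x) (f xs) (f y) => D fx fs fy h2 h1.
have L4 : 0 < 4 * L by rewrite mulr_gt0.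
rewrite -ler_pdivrMl//.
have E : (4 * L)^-1 * D = - (- ((2 * L)^-1 * D) + L * ((2 * L)^-1 * ((2 * L)^-1 * D))).
  by field; rewrite gt_eqF.
by rewrite E lerNl opprB (le_trans _ h1)// lerD2r.
Qed.

Lemma quadratic_argmin_gradient xs : is_argmin f xs -> a xs = 0.
Proof.
move=> fmin; apply: dot_eq0; apply/eqP; rewrite eq_le dot_ge0 andbT.
by have := quadratic_gradient_sqr xs fmin; rewrite subrr mulr0.
Qed.

Lemma quadratic_growth x xs : is_argmin f xs ->
  f x - f xs <= L * dot (x - xs) (x - xs).
Proof.
move=> fmin; have := fa_le xs x.
by rewrite (quadratic_argmin_gradient fmin) dot0l add0r.
Qed.

Lemma quadratic_continuous : continuous f.
Proof.
suff H (x : 'rV[R]_n) : f y @[y --> x] --> f x by move=> x; exact: H.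
have d1 : dot (a x) (y - x) @[y --> x] --> 0.
  rewrite -(dot0r (a x)) -(subrr x).
  exact: (continuous_comp (shift_cont (c := - x) (x := x)) (@dot_continuous _ _ (a x) _)).
have d2 : dot (y - x) (y - x) @[y --> x] --> 0.
  rewrite -[X in _ --> X](dot0r (0 : 'rV[R]_n)) -(subrr x).
  exact: (continuous_comp (shift_cont (c := - x) (x := x)) (@dot_sqr_continuous _ _ _)).
have FF : Filter (nbhs x) := nbhs_filter x.
have e1 : f x + dot (a x) (y - x) @[y --> x] --> f x + 0.
  exact: (cvgD (cvg_cst (f x)) d1).
have e2 : L * dot (y - x) (y - x) @[y --> x] --> L * 0.
  exact: (cvgM (cvg_cst L) d2).
have e3 := cvgD e1 e2; rewrite mulr0 !addr0 in e1 e3.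
have e4 : f x + dot (a x) (y - x) + L * dot (y - x) (y - x) @[y --> x] --> f x.
  exact: e3.
have fs : \forall y \near x, f x + dot (a x) (y - x) <= f y <=
    f x + dot (a x) (y - x) + L * dot (y - x) (y - x).
  near=> y; apply/andP; split; first by rewrite -lerBrDl.
  by rewrite -addrA -lerBlDl.
exact: (squeeze_cvgr fs e1 e4).
Unshelve. all: by end_near. Qed.

End quadratic_bounds.

(** * The averaged objective *)

Section mean.
Context {R : realType} {n : nat} {dX : measure_display} {X : measurableType dX}.
Context (P : probability X R) (F : 'rV[R]_n -> X -> R) (g : 'rV[R]_n -> X -> 'rV[R]_n).
Context (L : X -> R) (L2 : R) (hL2 : 0 < L2).
Hypothesis hF_int : forall x, P.-integrable setT (EFin \o F x).
Hypothesis hF : {ae P, forall xi, closed_function (F^~ xi) /\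
     convex_function setT (F^~ xi) /\ has_gradient (F^~ xi) (g^~ xi)}.
Hypothesis hg_meas : measurable_fun setT
     (fun t : borel_rV R n * X => g t.1 t.2 : borel_rV R n).
Hypothesis hg_lip : {ae P, forall xi, forall x y : 'rV[R]_n,
     enorm (g x xi - g y xi) <= L xi * enorm (x - y)}.
Hypothesis hL_meas : measurable_fun setT L.
Hypothesis hL : (sqrte 'E_P[fun xi => (L xi ^+ 2)%R] <= L2%:E)%E.
Context (sigma : R).
Hypothesis hsigma : forall x, ('E_P[fun xi =>
     (enorm (g x xi - gradient (mean P F) x) ^+ 2)%R] <= (sigma ^+ 2)%:E)%E.

Lemma gradient_coord_meas x i : measurable_fun setT (fun xi => g x xi 0 i).
Proof.
have := measurableT_comp (@measurable_coord R n i)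
  (measurableT_comp hg_meas (@pair1_measurable _ _ (borel_rV R n) X x)).
by [].
Qed.

Lemma noise_sqr_int x : P.-integrable setT (EFin \o (fun xi =>
    dot (g x xi - gradient (mean P F) x) (g x xi - gradient (mean P F) x))) /\
  \int[P]_xi dot (g x xi - gradient (mean P F) x) (g x xi - gradient (mean P F) x)
    <= sigma ^+ 2.
Proof.
have := hsigma x; rewrite unlock.
under eq_integral do rewrite enorm_sqr.
move=> H; split.
  apply: integrable_ge0_lty => [|xi|]; last by rewrite (le_lt_trans H)// ltry.
  - apply: measurable_sum => i; apply: measurable_funM => //;
      under eq_fun do rewrite !mxE; apply: measurable_funB => //;
      exact: gradient_coord_meas.
  - exact: dot_ge0.
rewrite -lee_fin; apply: le_trans H; rewrite /Rintegral.
have : (0 <= \int[P]_x0 (dot (g x x0 - gradient (mean P F) x)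
            (g x x0 - gradient (mean P F) x))%:E)%E.
  by apply: integral_ge0 => xi _; rewrite lee_fin dot_ge0.
by case: (\int[P]_x0 _)%E => //= r _; rewrite leey.
Qed.

(** Finite variance around the number [b] implies integrability, even before
    [b] is known to be the mean. *)
Lemma gradient_coord_int x i : P.-integrable setT (EFin \o (fun xi => g x xi 0 i)).
Proof.
set b := 'D_(delta_mx 0 i) (mean P F) x.
have mg := gradient_coord_meas x i.
have mgb : measurable_fun setT (fun xi => g x xi 0 i - b) by apply: measurable_funB.
have : P.-integrable setT (EFin \o (fun xi => g x xi 0 i - b)).
  apply: integrable_sqrt => //.
  apply: integrable_dominated (noise_sqr_int x).1 _ => [|xi].
    exact: measurable_funX.
  rewrite ger0_norm ?sqr_ge0//.
  by have := coord_sqr_le (g x xi - gradient (mean P F) x) i; rewrite !mxE.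
move=> /integrable_add /(_ (integrable_cst P b)).
by apply: eq_integrable => // xi _ /=; rewrite subrK.
Qed.

(** Defined without knowing that the objective is differentiable; identified
    with its gradient in [mean_gradientE]. *)
Definition mean_gradient x : 'rV[R]_n := \row_i \int[P]_xi g x xi 0 i.

Lemma dot_gradient_int x v : P.-integrable setT (EFin \o (fun xi => dot (g x xi) v)).
Proof.
apply: integrable_sumr => i.
have := integrable_scale (v 0 i) (gradient_coord_int x i).
by apply: eq_integrable => // xi _ /=; rewrite mulrC.
Qed.

Lemma Rint_dot_gradient x v : \int[P]_xi dot (g x xi) v = dot (mean_gradient x) v.
Proof.
rewrite Rint_sum => [|i].
  apply: eq_bigr => i _; rewrite mxE mulrC -Rint_scale; last exact: gradient_coord_int.
  by apply: eq_Rintegral => xi _; rewrite mulrC.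
have := integrable_scale (v 0 i) (gradient_coord_int x i).
by apply: eq_integrable => // xi _ /=; rewrite mulrC.
Qed.

Lemma mean_Rint x : mean P F x = \int[P]_xi F x xi.
Proof. by rewrite /mean unlock. Qed.

(** The bound on the extended real square root is a bound on the second moment,
    which in particular is finite. *)
Lemma Lip_sqr_int : P.-integrable setT (EFin \o (fun xi => L xi ^+ 2)) /\
  \int[P]_xi (L xi ^+ 2) <= L2 ^+ 2.
Proof.
move: hL; rewrite unlock; set E := (\int[P]_w _)%E => hE.
have E0 : (0 <= E)%E by apply: integral_ge0 => xi _; rewrite lee_fin sqr_ge0.
have E2 : (E <= (L2 ^+ 2)%:E)%E.
  have := sqrte_sqr L2%:E; rewrite -EFin_expe abse_EFin ger0_norm ?(ltW hL2)// => h.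
  by rewrite -lee_sqrt ?h// lee_fin sqr_ge0.
split.
  apply: integrable_ge0_lty => [|xi|]; [exact: measurable_funX|exact: sqr_ge0|].
  by rewrite (le_lt_trans E2)// ltry.
by rewrite -lee_fin /Rintegral -/E fineK// ge0_fin_numE// (le_lt_trans E2)// ltry.
Qed.

Lemma mean_ge x y : dot (mean_gradient x) (y - x) <= mean P F y - mean P F x.
Proof.
rewrite !mean_Rint -Rint_dot_gradient -Rint_sub// -subr_ge0 -Rint_sub; first last.
- exact: dot_gradient_int.
- exact: integrable_sub.
apply: Rint_ge0_ae.
  by apply: integrable_sub; [exact: integrable_sub|exact: dot_gradient_int].
apply: filterS hF => xi [_ [cF gF]]; rewrite subr_ge0.
have [dF <-] := gF x; exact: convex_gradient_ineq.
Qed.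

(** Convexity at [y] bounds the increment by [<g y, y - x>], and replacing [g y] by
    [g x] costs [L(xi) |y - x|^2].  As only the second moment of the Lipschitz
    constant is controlled, [L(xi)] is estimated by
    [(L(xi) ^ 2 + L2 ^ 2) / (2 L2)], which has mean at most [L2]. *)
Lemma mean_le x y : mean P F y - mean P F x <=
  dot (mean_gradient x) (y - x) + L2 * dot (y - x) (y - x).
Proof.
set q := dot (y - x) (y - x).
have [iL ELL] := Lip_sqr_int.
(* An integrable upper bound of the increments of [F], free of [g y]. *)
pose bd xi := dot (g x xi) (y - x) + (q * (2 * L2)^-1) * (L xi ^+ 2 + L2 ^+ 2).
have ibd : P.-integrable setT (EFin \o bd).
  apply: integrable_add; first exact: dot_gradient_int.
  by apply: integrable_scale; apply: integrable_add => //; exact: integrable_cst.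
have q0 : 0 <= q := dot_ge0 _.
apply: (@le_trans _ _ (\int[P]_xi bd xi)); last first.
  rewrite /bd Rint_add; first last.
  - by apply: integrable_scale; apply: integrable_add => //; exact: integrable_cst.
  - exact: dot_gradient_int.
  rewrite Rint_dot_gradient lerD2l Rint_scale; last first.
    by apply: integrable_add => //; exact: integrable_cst.
  rewrite Rint_add//; last exact: integrable_cst.
  rewrite Rint_cst (_ : L2 * q = q * (2 * L2)^-1 * (L2 ^+ 2 + L2 ^+ 2)); last first.
    by field; rewrite gt_eqF.
  rewrite ler_wpM2l ?lerD2r// mulr_ge0// invr_ge0 mulr_ge0// ltW//.
rewrite !mean_Rint -Rint_sub// -subr_ge0 -Rint_sub//; last exact: integrable_sub.
apply: Rint_ge0_ae; first by apply: integrable_sub => //; exact: integrable_sub.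
apply: filterS2 hF hg_lip => xi [_ [cF gF]] lip; rewrite subr_ge0.
have [dF gE] := gF y; have := convex_gradient_ineq x dF cF; rewrite gE => H1.
have H2 : dot (g y xi - g x xi) (y - x) <= L xi * q.
  apply: le_trans (dot_le_enorm _ _) _; rewrite /q -enorm_sqr expr2 mulrA.
  by rewrite ler_wpM2r ?enorm_ge0//.
have H3 : L xi * q <= q * (2 * L2)^-1 * (L xi ^+ 2 + L2 ^+ 2).
  rewrite -mulrA (mulrC (L xi)) ler_wpM2l// ler_pdivlMl ?mulr_gt0//.
  have := sqr_ge0 (L xi - L2); nra.
rewrite /bd; move: H1 H2; rewrite -(opprB y x) dotNr dotBl.
by move: H3; move: (q * _ * _) (L xi * q) => A B; lra.
Qed.

Lemma mean_gradientE x : gradient (mean P F) x = mean_gradient x.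
Proof. exact: quadratic_gradient mean_ge mean_le x. Qed.

End mean.

(** * The mirror step *)

Section mirror.
Context {R : realType} {n : nat} (p : R) (d : 'rV[R]_n -> R).
Hypothesis hp : 1 <= p <= 2.
Hypothesis hd : prox_function p d.
Implicit Types (x y z u G e : 'rV[R]_n).

Lemma pnormN x : pnorm p (- x) = pnorm p x.
Proof. by rewrite /pnorm; congr (_ `^ _); apply: eq_bigr => i _; rewrite mxE normrN. Qed.

Lemma bregman_ge_pnorm z x : 2^-1 * pnorm p (x - z) ^+ 2 <= bregman d z x.
Proof. exact: prox_strongly_convex hd z x. Qed.

Lemma bregman_ge0 z x : 0 <= bregman d z x.
Proof. by apply: le_trans (bregman_ge_pnorm z x); rewrite mulr_ge0// sqr_ge0. Qed.

Lemma dot_le_bregman z x : dot (x - z) (x - z) <= 2 * bregman d z x.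
Proof.
have := bregman_ge_pnorm z x; have := dot_le_pnorm (x - z) hp.
by move=> h1 h2; lra.
Qed.

(** Minimality in the mirror step says that the right-hand side is a subgradient
    of [d] at [x]. *)
Lemma argmin_gradient alpha G z x : is_argmin (rdd_objective d alpha G z) x ->
  gradient d x = gradient d z - (alpha * n%:R) *: G.
Proof.
move=> xmin; apply: subgradient_unique; first exact: prox_differentiable hd x.
move=> y; have := xmin y; rewrite /rdd_objective /bregman.
rewrite !dotBr !dotBl !dotZl; lra.
Qed.

Lemma scaled_dot_young c (W : R) e u : 0 <= W -> dot e u ^+ 2 <= W * pnorm p u ^+ 2 ->
  c * dot e u <= 2^-1 * (c ^+ 2 * W) + 2^-1 * pnorm p u ^+ 2.
Proof.
move=> W0; move: (dot e u) (pnorm p u) => D N.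
have [->|Wn0] := eqVneq W 0.
  rewrite mul0r mulr0 mulr0 add0r => D0.
  have -> : D = 0 by apply/eqP; rewrite -sqrf_eq0 eq_le D0 sqr_ge0.
  by rewrite mulr0 mulr_ge0// sqr_ge0.
have Wp : 0 < W by rewrite lt0r Wn0.
rewrite -ler_pdivrMl// => h.
have : 0 <= (c * W - D) ^+ 2 * W^-1 by rewrite mulr_ge0 ?sqr_ge0// invr_ge0.
rewrite (_ : _ * W^-1 = c ^+ 2 * W - 2 * (c * D) + W^-1 * D ^+ 2); last by field.
by move: (c ^+ 2 * W) (c * D) (W^-1 * D ^+ 2) (N ^+ 2) h => a b f g; lra.
Qed.

(** The three point identity turns the linear term at [x] into a difference of
    divergences; the linear term of the move [z - x] is absorbed by
    [bregman d z x], at the price of the squared dual norm. *)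
Lemma mirror_step alpha c e W z x xs : 0 <= W ->
  (forall u, dot e u ^+ 2 <= W * pnorm p u ^+ 2) ->
  is_argmin (rdd_objective d alpha (c *: e) z) x ->
  alpha * n%:R * (c * dot e (z - xs)) <=
  2^-1 * ((alpha * n%:R * c) ^+ 2 * W) + bregman d z xs - bregman d x xs.
Proof.
move=> W0 HW /argmin_gradient gx.
have three : bregman d z xs - bregman d x xs - bregman d z x =
    alpha * n%:R * (c * dot e (x - xs)).
  rewrite /bregman gx !dotBl !dotZl !dotBr; ring.
have := scaled_dot_young (alpha * n%:R * c) W0 (HW (z - x)).
have := bregman_ge_pnorm z x; rewrite -(opprB z x) pnormN.
have -> : alpha * n%:R * (c * dot e (z - xs)) =
    alpha * n%:R * c * dot e (z - x) + alpha * n%:R * (c * dot e (x - xs)).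
  by rewrite !dotBr; ring.
rewrite -three; move: (bregman d z x) (_ * (_ * W)) (_ * dot e _) (_ * pnorm _ _ ^+ 2).
by move=> a b f g; lra.
Qed.

Lemma gradient_strongly_monotone x y :
  dot (x - y) (x - y) <= dot (gradient d x - gradient d y) (x - y).
Proof.
have h1 := prox_strongly_convex hd y x; have := prox_strongly_convex hd x y.
rewrite -(opprB x y) pnormN dotNr => h2; have h3 := dot_le_pnorm (x - y) hp.
rewrite [leRHS]dotBl; lra.
Qed.

Lemma gradient_expansive x y : dot (x - y) (x - y) <=
  dot (gradient d x - gradient d y) (gradient d x - gradient d y).
Proof.
have := gradient_strongly_monotone x y.
have := @dot_le_weighted _ _ 1 (gradient d x - gradient d y) (x - y) ltr01.
by rewrite invr1 !mul1r; lra.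
Qed.

Lemma gradient_inj : injective (gradient d).
Proof.
move=> x y xy; apply/eqP; rewrite -subr_eq0; apply/eqP; apply: dot_eq0.
by apply/eqP; rewrite eq_le dot_ge0 (le_trans (gradient_expansive x y))// xy subrr dot0l.
Qed.

Lemma compact_dot_ball (r : R) : compact [set x : 'rV[R]_n | dot x x <= r].
Proof.
apply: bounded_closed_compact.
  exists (Num.sqrt r); split; first by rewrite num_real.
  move=> M rM x /= xr; rewrite /Num.norm/= mx_normrE.
  have M0 : 0 <= M by rewrite ltW// (le_lt_trans _ rM)// sqrtr_ge0.
  apply/bigmax_leP; split => // -[i j] _ /=; rewrite (ord1 i).
  apply: le_trans (ltW rM); rewrite -sqrtr_sqr ler_wsqrtr//.
  by rewrite (le_trans (coord_sqr_le x j)).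
have := @closed_comp _ _ (fun x : 'rV[R]_n => dot x x) [set y | y <= r].
by apply => [x _|]; [exact: dot_sqr_continuous|exact: closed_le].
Qed.

(** The gradient takes the value [y] at the minimizer of [d - <y, .>], which is
    found on a ball: outside of it strong convexity at 0 beats the value at 0. *)
Lemma gradient_surj y : exists x, gradient d x = y.
Proof.
pose phi x := d x - dot y x; pose w := y - gradient d 0.
have dcont : continuous d := prox_continuous hd.
have phic : continuous phi.
  by move=> x; apply: continuousB; [exact: dcont|exact: dot_continuous].
pose A := [set x : 'rV[R]_n | dot x x <= 4 * dot w w].
have A0 : A 0 by rewrite /A/= dot0l mulr_ge0// dot_ge0.
have [x xA xmin] : exists2 x, x \in A & forall t, t \in A -> phi x <= phi t.
  apply: compact_EVT_min; [by exists 0|exact: compact_dot_ball|].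
  exact: continuous_subspaceT.
exists x; apply: subgradient_unique; first exact: prox_differentiable hd x.
suff gmin z : phi x <= phi z.
  by move=> z; have := gmin z; rewrite /phi dotBr; lra.
have [zA|zA] := boolP (z \in A); first exact: xmin.
(* The radius [2 |w|] makes [|z| ^ 2 / 2 - <w, z>] nonnegative outside of [A]. *)
have := xmin 0; rewrite inE => /(_ A0) /le_trans; apply.
have := prox_strongly_convex hd 0 z; have := dot_le_pnorm (z - 0) hp; rewrite subr0.
have := @dot_le_weighted _ _ 2 w z (ltr0Sn _ _).
move: zA; rewrite /A notin_setE/= => /negP; rewrite -ltNge.
rewrite /phi dot0r /w [dot (y - _) z]dotBl.
move: (dot _ (y - _)) (dot z z) (pnorm _ _ ^+ 2) => D Z N; lra.
Qed.

(** Strong convexity makes the gradient expansive, so its inverse is 1-Lipschitz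
    and in particular Borel. *)
Lemma gradient_inverse : exists T : 'rV[R]_n -> 'rV[R]_n,
  (forall x, T (gradient d x) = x) /\
  (forall i, measurable_fun setT (fun y : borel_rV R n => T y 0 i)).
Proof.
have [T gT] := choice gradient_surj; exists T; split.
  by move=> x; apply: gradient_inj.
move=> i; apply: (@continuous_borel_measurable R n (fun y => T y 0 i)).
suff H (y : 'rV[R]_n) : T z 0 i @[z --> y] --> T y 0 i by move=> y; exact: H.
have FF : Filter (nbhs y) := nbhs_filter y.
have d2 : dot (z - y) (z - y) @[z --> y] --> 0.
  rewrite -[X in _ --> X](dot0r (0 : 'rV[R]_n)) -(subrr y).
  exact: (continuous_comp (shift_cont (c := - y) (x := y)) (@dot_sqr_continuous _ _ _)).
apply/cvgrPdist_le => eps eps0.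
have e2 : 0 < eps ^+ 2 by rewrite exprn_gt0.
have /cvgrPdist_le/(_ _ e2) := d2; apply: filterS => z; rewrite sub0r normrN.
rewrite ger0_norm ?dot_ge0// => h.
rewrite -(ler_pXn2r (ltn0Sn 1)) ?nnegrE ?(ltW eps0)// real_normK ?num_real//.
apply: le_trans h; have := gradient_expansive (T z) (T y); rewrite !gT.
by apply: le_trans; have := coord_sqr_le (T z - T y) i; rewrite !mxE -sqrrN opprB.
Qed.

End mirror.

(** * Forms in a direction independent of the past *)

Section past.
Context {R : realType} {dO : measure_display} {Omega : measurableType dO}.
Context (Pr : probability Omega R) {I : finType} (G : I -> set_system Omega).
Hypothesis GT : forall i, G i setT.
Hypothesis GI : forall i, setI_closed (G i).
Hypothesis Gm : forall i, G i `<=` measurable.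
Hypothesis hG : mutually_independent Pr G.

(** [Omega] with the events determined by the sources in [J]: a map measurable
    for it is a function of these sources only. *)
Local Notation past J := (g_sigma_algebraType (\bigcup_(i in [set` J]) G i)).

Lemma past_mono d' (S : measurableType d') (J J' : {set I}) (Y : Omega -> S) :
  J \subset J' -> measurable_fun setT (Y : past J -> S) ->
  measurable_fun setT (Y : past J' -> S).
Proof.
move=> JJ' mY _ A mA; rewrite setTI; have := mY measurableT A mA; rewrite setTI.
exact: joint_sigma_sub.
Qed.

Lemma past_measurable d' (S : measurableType d') (J : {set I}) (Y : Omega -> S) :
  measurable_fun setT (Y : past J -> S) -> measurable_fun setT Y.
Proof.
move=> mY _ A mA; rewrite setTI; have := mY measurableT A mA; rewrite setTI.
exact: joint_sigma_measurable.
Qed.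

Lemma past_source d' (S : measurableType d') (J : {set I}) i (Z : Omega -> S) :
  i \in J -> (forall A, measurable A -> G i (Z @^-1` A)) ->
  measurable_fun setT (Z : past J -> S).
Proof.
by move=> iJ GZ _ A mA; rewrite setTI; apply: sub_joint_sigma iJ _ _; exact: GZ.
Qed.

Lemma past_indep d1 d2 (S1 : measurableType d1) (S2 : measurableType d2)
    (J : {set I}) j (Y : Omega -> S1) (Z : Omega -> S2) :
  j \notin J -> (forall A, measurable A -> G j (Z @^-1` A)) ->
  measurable_fun setT (Y : past J -> S1) ->
  forall A B, measurable A -> measurable B ->
  Pr (Y @^-1` A `&` Z @^-1` B) = (Pr (Y @^-1` A) * Pr (Z @^-1` B))%E.
Proof.
move=> jJ GZ mY A B mA mB; apply: (joint_sigma_indep GT GI Gm hG jJ); first exact: GZ.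
by have := mY measurableT A mA; rewrite setTI.
Qed.

Section sphere_direction.
Context {n : nat} (e : {RV Pr >-> borel_rV R n}) (je : I).
Hypothesis he : uniform_on_sphere e.
Hypothesis Ge : forall A, measurable A -> G je (e @^-1` A).
Let ew w : 'rV[R]_n := e w.

(** Freezing the past factor [b] splits the expectation of the product. *)
Lemma Rint_mul_sphere (J : {set I}) (b : Omega -> R) (phi : 'rV[R]_n -> R) (M : R) :
  je \notin J -> measurable_fun setT (b : past J -> R) ->
  Pr.-integrable setT (EFin \o b) ->
  measurable_fun setT (phi : borel_rV R n -> R) ->
  (forall u : 'rV[R]_n, dot u u = 1 -> `|phi u| <= M) ->
  Pr.-integrable setT (EFin \o (fun w => b w * phi (ew w))) /\
  \int[Pr]_w (b w * phi (ew w)) = (\int[Pr]_w b w) * \int[Pr]_w phi (ew w).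
Proof.
move=> jJ mb ib mphi bphi.
have me : measurable_fun setT (ew : Omega -> borel_rV R n) := sphere_meas e.
have iphi : Pr.-integrable setT (EFin \o (fun w => phi (ew w))) :=
  sphere_integrable he mphi bphi.
have mphie : measurable_fun setT (fun w => phi (ew w)) := measurableT_comp mphi me.
have ibphi : Pr.-integrable setT (EFin \o (fun w => b w * phi (ew w))).
  by apply: (@integrable_mul_bounded _ _ _ _ _ _ M) => // w; apply/bphi/sphere_dot.
split => //.
have mF : measurable_fun setT (fun z : R * borel_rV R n => z.1 * phi z.2).
  apply: measurable_funM; first exact: measurable_fst.
  exact: (measurableT_comp mphi measurable_snd).
have iQ : (distribution Pr e).-integrable setT (EFin \o phi).
  have := @integrable_pushforward _ _ _ (borel_rV R n) R ew me Pr setT (EFin \o phi).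
  by apply => //; exact/measurable_EFinP.
have lawe (B : set (borel_rV R n)) : measurable B ->
    Pr (ew @^-1` B) = distribution Pr e B by [].
have := freezing (past_measurable mb) me lawe (past_indep jJ Ge mb) mF ibphi.
move=> -> /= ; last by move=> y; exact: (integrable_scale y iQ).
under eq_Rintegral do rewrite (Rint_scale _ iQ).
have E : \int[distribution Pr e]_z phi z = \int[Pr]_w phi (ew w).
  rewrite /Rintegral; congr fine.
  apply: (@integral_distribution _ _ _ _ _ _ e (EFin \o (phi : borel_rV R n -> R))) => //.
  exact/measurable_EFinP.
by rewrite E; under eq_Rintegral do rewrite mulrC; rewrite Rint_scale// mulrC.
Qed.

Context (W : 'rV[R]_n -> R) (M : R).
Hypothesis mW : measurable_fun setT (W : borel_rV R n -> R).
Hypothesis WM : forall u : 'rV[R]_n, dot u u = 1 -> `|W u| <= M.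
Hypothesis Wflip : forall l u, W (reflect_along (delta_mx 0 l) u) = W u.
Hypothesis Wswap : forall l l' u,
  W (reflect_along (delta_mx 0 l - delta_mx 0 l') u) = W u.

(** Expand the product over pairs of coordinates, separate the past from the
    direction, and insert the weighted covariances. *)
Lemma sphere_bilinear (J : {set I}) (s t : Omega -> 'rV[R]_n) :
  je \notin J ->
  (forall i, measurable_fun setT (fun w : past J => s w 0 i)) ->
  (forall i, measurable_fun setT (fun w : past J => t w 0 i)) ->
  (forall i, Pr.-integrable setT (EFin \o (fun w => s w 0 i ^+ 2))) ->
  (forall i, Pr.-integrable setT (EFin \o (fun w => t w 0 i ^+ 2))) ->
  Pr.-integrable setT
    (EFin \o (fun w => dot (s w) (ew w) * dot (t w) (ew w) * W (ew w))) /\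
  \int[Pr]_w (dot (s w) (ew w) * dot (t w) (ew w) * W (ew w)) =
    n%:R^-1 * (\int[Pr]_w dot (s w) (t w)) * \int[Pr]_w W (ew w).
Proof.
move=> jJ ms mt is_ it.
pose term i j w := (s w 0 i * t w 0 j) * (ew w 0 i * ew w 0 j * W (ew w)).
have mst i j : measurable_fun setT (fun w : past J => s w 0 i * t w 0 j).
  exact: measurable_funM.
have ist i j : Pr.-integrable setT (EFin \o (fun w => s w 0 i * t w 0 j)).
  by apply: integrable_mul_sqr => //; exact: past_measurable.
have mphi i j : measurable_fun setT (fun u : borel_rV R n =>
    (u : 'rV[R]_n) 0 i * (u : 'rV[R]_n) 0 j * W u).
  apply: measurable_funM => //; apply: measurable_funM; exact: measurable_coord.
have bphi i j (u : 'rV[R]_n) : dot u u = 1 -> `|u 0 i * u 0 j * W u| <= M.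
  move=> u1; rewrite !normrM -[leRHS]mul1r ler_pM// ?WM//.
  by rewrite mulr_ile1// coord_le1.
have H i j := Rint_mul_sphere jJ (mst i j) (ist i j) (mphi i j) (@bphi i j).
have iterm i j : Pr.-integrable setT (EFin \o term i j) := (H i j).1.
have E w : dot (s w) (ew w) * dot (t w) (ew w) * W (ew w) =
    \sum_i \sum_j term i j w.
  rewrite /dot big_distrlr/= mulr_suml; apply: eq_bigr => i _.
  by rewrite mulr_suml; apply: eq_bigr => j _; rewrite /term; ring.
have -> : (fun w => dot (s w) (ew w) * dot (t w) (ew w) * W (ew w)) =
    (fun w => \sum_i \sum_j term i j w) by apply/funext.
have irow i : Pr.-integrable setT (EFin \o (fun w => \sum_j term i j w)).
  exact: integrable_sumr.
split; first exact: integrable_sumr.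
rewrite Rint_sum// /dot Rint_sum// mulr_sumr mulr_suml; apply: eq_bigr => i _.
rewrite Rint_sum// (bigD1 i)//= big1 ?addr0 => [|j ji].
  by rewrite (H i i).2 (sphere_weighted_cov he i i mW WM Wflip Wswap) eqxx mul1r mulrCA mulrA.
rewrite (H i j).2 (sphere_weighted_cov he i j mW WM Wflip Wswap) eq_sym (negbTE ji).
by rewrite mul0r mulr0.
Qed.

End sphere_direction.
End past.

(** * Expectation of one step *)

Lemma sqr_mean_le (R : realFieldType) (m : nat) (z : 'I_m -> R) : (0 < m)%N ->
  (m%:R^-1 * \sum_i z i) ^+ 2 <= m%:R^-1 * \sum_i z i ^+ 2.
Proof.
move=> m0; have m0R : 0 < m%:R :> R by rewrite ltr0n.
set s := m%:R^-1 * \sum_i z i.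
have : 0 <= m%:R^-1 * \sum_i (z i - s) ^+ 2.
  by rewrite mulr_ge0 ?invr_ge0 ?ler0n// sumr_ge0// => i _; rewrite sqr_ge0.
under eq_bigr do rewrite sqrrB.
rewrite big_split sumrB/= sumr_const card_ord -[s ^+ 2 *+ m]mulr_natl.
have -> : \sum_(i < m) z i * s *+ 2 = 2 * m%:R * s ^+ 2.
  under eq_bigr do rewrite -mulrnAr; rewrite -mulr_suml /s.
  by rewrite -[_ *+ 2]mulr_natl; field; rewrite gt_eqF.
move: (\sum_(i < m) z i ^+ 2) (m%:R) m0R => A M M0.
rewrite (_ : M^-1 * _ = M^-1 * A - s ^+ 2) ?subr_ge0//.
by move: s => s; field; rewrite gt_eqF.
Qed.

(** The weights keep the coefficient 3 on the exact part [A], which the step size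
    has to compensate, and put the smaller loss on [z]. *)
Lemma sqr_sum3_le (R : realFieldType) (A z y : R) :
  (A + z + y) ^+ 2 <= 3 * A ^+ 2 + 2 * z ^+ 2 + 6 * y ^+ 2.
Proof.
rewrite -subr_ge0 (_ : _ - _ = (z - A - y) ^+ 2 + (A - 2 * y) ^+ 2); last by ring.
by rewrite addr_ge0 ?sqr_ge0.
Qed.

(** Young's inequality with weight [lam]; the weights [16 / 15] and [16] satisfy
    [(z + y) ^ 2 <= 16 / 15 * z ^ 2 + 16 * y ^ 2]. *)
Lemma noise_cross_le (R : realFieldType) (lam b z y : R) : 0 < lam ->
  - ((z + y) * b) <=
  2^-1 * (lam * (16 / 15 * z ^+ 2 + 16 * y ^+ 2) + lam^-1 * b ^+ 2).
Proof.
move=> l0; rewrite -subr_ge0.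
rewrite (_ : _ - _ = 2^-1 * (lam * (15^-1 * (z - 15 * y) ^+ 2) +
   lam^-1 * (lam * (z + y) + b) ^+ 2)); last by field; rewrite gt_eqF.
have l0' := ltW l0; apply: mulr_ge0; first by rewrite invr_ge0.
apply: addr_ge0; apply: mulr_ge0; rewrite ?invr_ge0 ?sqr_ge0//.
by apply: mulr_ge0; rewrite ?invr_ge0 ?sqr_ge0.
Qed.

Section batch.
Context {R : realType} {dO : measure_display} {Omega : measurableType dO}.
Context (Pr : probability Omega R) {I : finType} (G : I -> set_system Omega).
Hypothesis GT : forall i, G i setT.
Hypothesis GI : forall i, setI_closed (G i).
Hypothesis Gm : forall i, G i `<=` measurable.
Hypothesis hG : mutually_independent Pr G.
Local Notation past J := (g_sigma_algebraType (\bigcup_(i in [set` J]) G i)).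

Context {n : nat} {dX : measure_display} {X : measurableType dX}.
Context (P : probability X R) (g : 'rV[R]_n -> X -> 'rV[R]_n) (a : 'rV[R]_n -> 'rV[R]_n).
Context (sigma : R).
Hypothesis mg : measurable_fun setT
  (fun t : borel_rV R n * X => g t.1 t.2 : borel_rV R n).
Hypothesis ma : forall c, measurable_fun setT (fun x : borel_rV R n => a x 0 c).
Hypothesis ig : forall x c, P.-integrable setT (EFin \o (fun xi => g x xi 0 c)).
Hypothesis Eg : forall x c, \int[P]_xi g x xi 0 c = a x 0 c.
Hypothesis inoise : forall x, P.-integrable setT
  (EFin \o (fun xi => dot (g x xi - a x) (g x xi - a x))).
Hypothesis Enoise : forall x,
  \int[P]_xi dot (g x xi - a x) (g x xi - a x) <= sigma ^+ 2.

Context {m : nat} (J : {set I}) (jx : 'I_m -> I) (xi : 'I_m -> {RV Pr >-> X}).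
Hypothesis hm : (0 < m)%N.
Hypothesis jxJ : forall i, jx i \notin J.
Hypothesis jx_inj : injective jx.
Hypothesis Gxi : forall i A, measurable A -> G (jx i) (xi i @^-1` A).
Hypothesis hxi : forall i, has_law (xi i) P.
Context (x : Omega -> 'rV[R]_n).
Hypothesis mx : measurable_fun setT (x : past J -> borel_rV R n).

Definition sample_noise i w : 'rV[R]_n := g (x w) (xi i w) - a (x w).

Lemma sample_gradient_past (K : {set I}) i c : J \subset K -> jx i \in K ->
  measurable_fun setT (fun w : past K => g (x w) (xi i w) 0 c).
Proof.
move=> JK iK.
have mxK : measurable_fun setT (x : past K -> borel_rV R n) := past_mono JK mx.
have mxiK : measurable_fun setT (xi i : past K -> X).
  exact: (past_source iK (@Gxi i)).
have mp : measurable_fun setT (fun w : past K => (x w, xi i w) : borel_rV R n * X).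
  exact: measurable_fun_pair.
exact: (measurableT_comp (@measurable_coord R n c) (measurableT_comp mg mp)).
Qed.

Lemma gradient_past (K : {set I}) c : J \subset K ->
  measurable_fun setT (fun w : past K => a (x w) 0 c).
Proof.
by move=> JK; exact: (measurableT_comp (@ma c) (past_mono JK mx)).
Qed.

Lemma sample_noise_past (K : {set I}) i c : J \subset K -> jx i \in K ->
  measurable_fun setT (fun w : past K => sample_noise i w 0 c).
Proof.
move=> JK iK; have -> : (fun w : past K => sample_noise i w 0 c) =
    (fun w => g (x w) (xi i w) 0 c - a (x w) 0 c).
  by apply/funext => w; rewrite /sample_noise !mxE.
by apply: measurable_funB; [exact: sample_gradient_past|exact: gradient_past].
Qed.

Lemma noise_fun_meas c : measurable_fun setT
  (fun t : borel_rV R n * X => (g t.1 t.2 - a t.1) 0 c).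
Proof.
have -> : (fun t : borel_rV R n * X => (g t.1 t.2 - a t.1) 0 c) =
    (fun t => g t.1 t.2 0 c - a t.1 0 c) by apply/funext => t; rewrite !mxE.
apply: measurable_funB.
  exact: (measurableT_comp (@measurable_coord R n c) mg).
exact: (measurableT_comp (@ma c) measurable_fst).
Qed.

Lemma sample_noise_sqr i :
  Pr.-integrable setT (EFin \o (fun w => dot (sample_noise i w) (sample_noise i w))) /\
  \int[Pr]_w dot (sample_noise i w) (sample_noise i w) <= sigma ^+ 2.
Proof.
pose phi (t : borel_rV R n * X) := dot (g t.1 t.2 - a t.1) (g t.1 t.2 - a t.1).
have mphi : measurable_fun setT phi.
  by apply: measurable_sum => c; apply: measurable_funM; exact: noise_fun_meas.
have mxO := past_measurable Gm mx.
have mxi : measurable_fun setT (xi i : Omega -> X) by exact: measurable_funPT.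
have FR := freezing_ge0 mxO mxi (@hxi i) (past_indep GT GI Gm hG (jxJ i) (@Gxi i) mx)
  (phi := EFin \o phi).
have B : (\int[Pr]_w (phi (x w, xi i w))%:E <= (sigma ^+ 2)%:E)%E.
  rewrite FR => [||z]; [|exact/measurable_EFinP|by rewrite lee_fin dot_ge0].
  apply: (@le_trans _ _ (\int[Pr]_w (sigma ^+ 2)%:E)%E).
    apply: ge0_le_integral => //.
    - by move=> w _; apply: integral_ge0 => y _; rewrite lee_fin dot_ge0.
    - apply: (measurableT_comp (f := fun y : borel_rV R n => (\int[P]_z (phi (y, z))%:E)%E) _ mxO).
      apply: (measurable_fun_fubini_tonelli_F (EFin \o phi)).
        exact/measurable_EFinP.
      by move=> z; rewrite lee_fin dot_ge0.
    - by move=> w _; have := Enoise (x w); rewrite -lee_fin -(Rint_EFin (inoise (x w))).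
  by rewrite (Rint_EFin (integrable_cst Pr (sigma ^+ 2))) Rint_cst.
have iphi : Pr.-integrable setT (EFin \o (fun w => phi (x w, xi i w))).
  apply: integrable_ge0_lty; last by rewrite (le_lt_trans B)// ltry.
    exact: (measurableT_comp mphi (measurable_fun_pair mxO mxi)).
  by move=> w; exact: dot_ge0.
by split=> //; rewrite -lee_fin -(Rint_EFin iphi).
Qed.

Lemma sample_noise_coord_sqr_int i c :
  Pr.-integrable setT (EFin \o (fun w => sample_noise i w 0 c ^+ 2)).
Proof.
apply: integrable_dominated (sample_noise_sqr i).1 _.
  apply: measurable_funX; apply: (@past_measurable _ _ _ G Gm _ _ (jx i |: J)).
  by apply: sample_noise_past; [exact: finset.subsetUr|rewrite !inE eqxx].
by move=> w; rewrite ger0_norm ?sqr_ge0// coord_sqr_le.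
Qed.

(** With the point and the other factor frozen, the sampled gradient is
    unbiased.  The set [K] may contain the indices of other samples of the same
    batch, which makes their cross terms vanish as well. *)
Lemma Rint_mul_noise (K : {set I}) i c (b : Omega -> R) : J \subset K -> jx i \notin K ->
  measurable_fun setT (b : past K -> R) ->
  Pr.-integrable setT (EFin \o (fun w => b w ^+ 2)) ->
  Pr.-integrable setT (EFin \o (fun w => b w * sample_noise i w 0 c)) /\
  \int[Pr]_w (b w * sample_noise i w 0 c) = 0.
Proof.
move=> JK iK mb ib.
have mbO := past_measurable Gm mb.
have mxK : measurable_fun setT (x : past K -> borel_rV R n) := past_mono JK mx.
have mY : measurable_fun setT (fun w : past K => (b w, x w) : R * borel_rV R n).
  exact: measurable_fun_pair.
have mxi : measurable_fun setT (xi i : Omega -> X) by exact: measurable_funPT.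
have mn : measurable_fun setT (fun w => sample_noise i w 0 c).
  apply: (@past_measurable _ _ _ G Gm _ _ (jx i |: J)).
  by apply: sample_noise_past; [exact: finset.subsetUr|rewrite !inE eqxx].
have iprod : Pr.-integrable setT (EFin \o (fun w => b w * sample_noise i w 0 c)).
  by apply: integrable_mul_sqr => //; exact: sample_noise_coord_sqr_int.
split=> //.
pose phi (t : (R * borel_rV R n) * X) := t.1.1 * (g t.1.2 t.2 - a t.1.2) 0 c.
have mphi : measurable_fun setT phi.
  apply: measurable_funM; first exact: (measurableT_comp measurable_fst measurable_fst).
  have mp : measurable_fun setT (fun t : (R * borel_rV R n) * X => (t.1.2, t.2)).
    apply: measurable_fun_pair => //.
    exact: (measurableT_comp measurable_snd measurable_fst).
  exact: (measurableT_comp (noise_fun_meas c) mp).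
have inner y : P.-integrable setT (EFin \o (fun z => (g y z - a y) 0 c)).
  have := integrable_sub (ig y c) (integrable_cst P (a y 0 c)).
  by apply: eq_integrable => // z _ /=; rewrite !mxE.
have := freezing (past_measurable Gm mY) mxi (@hxi i)
  (past_indep GT GI Gm hG iK (@Gxi i) mY) mphi iprod.
rewrite /phi /= => ->; last by move=> y; exact: (integrable_scale y.1 (inner y.2)).
under eq_Rintegral do rewrite (Rint_scale _ (inner _)).
have E y : \int[P]_z (g y z - a y) 0 c = 0.
  under eq_Rintegral do rewrite !mxE.
  by rewrite Rint_sub// ?Eg ?Rint_cst ?subrr//; exact: integrable_cst.
by under eq_Rintegral do rewrite E mulr0; rewrite Rint_cst.
Qed.

Definition batch_mean w : 'rV[R]_n := m%:R^-1 *: \sum_i g (x w) (xi i w).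

Lemma batch_meanE w c :
  batch_mean w 0 c = a (x w) 0 c + m%:R^-1 * \sum_i sample_noise i w 0 c.
Proof.
have m0R : m%:R != 0 :> R by rewrite pnatr_eq0 -lt0n.
rewrite /batch_mean /sample_noise !mxE summxE.
under [in RHS]eq_bigr do rewrite !mxE.
rewrite sumrB sumr_const card_ord -[a _ _ _ *+ m]mulr_natl mulrBr mulrA mulVf// mul1r.
by rewrite addrC subrK.
Qed.

Hypothesis iax : forall c, Pr.-integrable setT (EFin \o (fun w => a (x w) 0 c ^+ 2)).

Lemma batch_mean_past (K : {set I}) c : J \subset K -> (forall i, jx i \in K) ->
  measurable_fun setT (fun w : past K => batch_mean w 0 c).
Proof.
move=> JK xK; have -> : (fun w : past K => batch_mean w 0 c) =
    (fun w => a (x w) 0 c + m%:R^-1 * \sum_i sample_noise i w 0 c).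
  by apply/funext => w; rewrite batch_meanE.
apply: measurable_funD; first exact: gradient_past.
apply: measurable_funM => //; apply: measurable_sum => i; exact: sample_noise_past.
Qed.

Lemma Rint_dot_batch_mean (u : Omega -> 'rV[R]_n) :
  (forall c, measurable_fun setT (fun w : past J => u w 0 c)) ->
  (forall c, Pr.-integrable setT (EFin \o (fun w => u w 0 c ^+ 2))) ->
  \int[Pr]_w dot (batch_mean w) (u w) = \int[Pr]_w dot (a (x w)) (u w).
Proof.
move=> mu iu.
have H i c := Rint_mul_noise c (subxx J) (jxJ i) (mu c) (iu c).
have mO c : measurable_fun setT (fun w => a (x w) 0 c).
  exact: (past_measurable Gm (gradient_past c (subxx J))).
have iau c : Pr.-integrable setT (EFin \o (fun w => a (x w) 0 c * u w 0 c)).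
  by apply: integrable_mul_sqr => //; exact: (past_measurable Gm (mu c)).
have E c w : batch_mean w 0 c * u w 0 c = a (x w) 0 c * u w 0 c +
    m%:R^-1 * \sum_i u w 0 c * sample_noise i w 0 c.
  by rewrite batch_meanE mulrDl -mulr_sumr; ring.
have is_ c : Pr.-integrable setT (EFin \o (fun w => \sum_i u w 0 c * sample_noise i w 0 c)).
  by apply: integrable_sumr => i; exact: (H i c).1.
have ibu c : Pr.-integrable setT (EFin \o (fun w => batch_mean w 0 c * u w 0 c)).
  have := integrable_add (iau c) (integrable_scale m%:R^-1 (is_ c)).
  by apply: eq_integrable => // w _ /=; rewrite E.
rewrite /dot !Rint_sum//; apply: eq_bigr => c _.
under eq_Rintegral do rewrite E.
rewrite Rint_add//; last exact: integrable_scale.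
rewrite Rint_scale// Rint_sum => [|i]; last exact: (H i c).1.
by rewrite big1 ?mulr0 ?addr0// => i _; rewrite (H i c).2.
Qed.

(** All cross terms have mean zero, and the [m] remaining noise terms are
    divided by [m ^ 2]. *)
Lemma batch_mean_sqr :
  (forall c, Pr.-integrable setT (EFin \o (fun w => batch_mean w 0 c ^+ 2))) /\
  \int[Pr]_w dot (batch_mean w) (batch_mean w) <=
    \int[Pr]_w dot (a (x w)) (a (x w)) + sigma ^+ 2 / m%:R.
Proof.
have m0R : 0 < m%:R :> R by rewrite ltr0n.
have Ha i c := Rint_mul_noise c (subxx J) (jxJ i) (gradient_past c (subxx J)) (iax c).
have Hn i j c : i != j ->
    Pr.-integrable setT (EFin \o (fun w => sample_noise i w 0 c * sample_noise j w 0 c)) /\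
    \int[Pr]_w (sample_noise i w 0 c * sample_noise j w 0 c) = 0.
  move=> ij; apply: (@Rint_mul_noise (jx i |: J)).
  - exact: finset.subsetUr.
  - by rewrite !inE (inj_eq jx_inj) eq_sym (negbTE ij) jxJ.
  - by apply: sample_noise_past; [exact: finset.subsetUr|rewrite !inE eqxx].
  - exact: sample_noise_coord_sqr_int.
pose N c w := \sum_i sample_noise i w 0 c.
have E c w : batch_mean w 0 c ^+ 2 = a (x w) 0 c ^+ 2 +
    (2 * m%:R^-1) * \sum_i a (x w) 0 c * sample_noise i w 0 c +
    m%:R^-2 * \sum_i \sum_j sample_noise i w 0 c * sample_noise j w 0 c.
  rewrite batch_meanE -mulr_sumr.
  under [X in _ = _ + _ * X]eq_bigr do rewrite -mulr_sumr.
  by rewrite -mulr_suml -exprVn; ring.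
have inn i j c : Pr.-integrable setT
    (EFin \o (fun w => sample_noise i w 0 c * sample_noise j w 0 c)).
  have [<-|ij] := eqVneq i j; last exact: (Hn i j c ij).1.
  have := sample_noise_coord_sqr_int i c.
  by apply: eq_integrable => // w _ /=; rewrite expr2.
have i1 c : Pr.-integrable setT (EFin \o (fun w => \sum_i a (x w) 0 c * sample_noise i w 0 c)).
  by apply: integrable_sumr => i; exact: (Ha i c).1.
have i2 c : Pr.-integrable setT (EFin \o (fun w =>
    \sum_i \sum_j sample_noise i w 0 c * sample_noise j w 0 c)).
  by apply: integrable_sumr => i; exact: integrable_sumr.
have isq c : Pr.-integrable setT (EFin \o (fun w => batch_mean w 0 c ^+ 2)).
  have := integrable_add (integrable_add (iax c) (integrable_scale (2 * m%:R^-1) (i1 c)))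
    (integrable_scale (m%:R^-2) (i2 c)).
  by apply: eq_integrable => // w _ /=; rewrite E.
split=> //.
have EE c : \int[Pr]_w (batch_mean w 0 c ^+ 2) = \int[Pr]_w (a (x w) 0 c ^+ 2) +
    m%:R^-2 * \sum_i \int[Pr]_w (sample_noise i w 0 c ^+ 2).
  under eq_Rintegral do rewrite E.
  rewrite Rint_add; last exact: integrable_scale.
    rewrite Rint_add//; last exact: integrable_scale.
    rewrite Rint_scale// Rint_sum => [|i]; last exact: (Ha i c).1.
    rewrite big1 => [|i _]; last by rewrite (Ha i c).2.
    rewrite mulr0 addr0 Rint_scale// Rint_sum => [|i]; last exact: integrable_sumr.
    congr (_ + _ * _); apply: eq_bigr => i _; rewrite Rint_sum//.
    rewrite (bigD1 i)//= big1 ?addr0 => [|j ji]; last by rewrite (Hn i j c _).2// eq_sym.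
    by apply: eq_Rintegral => w _; rewrite expr2.
  by apply: integrable_add => //; exact: integrable_scale.
have dsq (s : Omega -> 'rV[R]_n) :
    (forall c, Pr.-integrable setT (EFin \o (fun w => s w 0 c ^+ 2))) ->
    \int[Pr]_w dot (s w) (s w) = \sum_c \int[Pr]_w (s w 0 c ^+ 2).
  by move=> is_; rewrite -Rint_sum//; apply: eq_Rintegral.
rewrite dsq// (eq_bigr _ (fun c _ => EE c)) big_split/= -dsq// lerD2l.
rewrite -mulr_sumr exchange_big/=.
rewrite (eq_bigr (fun i => \int[Pr]_w dot (sample_noise i w) (sample_noise i w)))
  => [|i _]; last by rewrite dsq// => c; exact: sample_noise_coord_sqr_int.
apply: (@le_trans _ _ (m%:R^-2 * \sum_(i < m) sigma ^+ 2)).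
  rewrite ler_wpM2l ?invr_ge0 ?exprn_ge0 ?ler0n//; apply: ler_sum => i _.
  exact: (sample_noise_sqr i).2.
rewrite sumr_const card_ord -[_ *+ m]mulr_natl.
rewrite le_eqVlt; apply/orP; left; apply/eqP; field; rewrite gt_eqF//.
Qed.

Context (e : {RV Pr >-> borel_rV R n}) (je : I).
Hypothesis he : uniform_on_sphere e.
Hypothesis Ge : forall A, measurable A -> G je (e @^-1` A).
Hypothesis jeJ : je \notin J.
Hypothesis jejx : forall i, jx i != je.
Let ew w : 'rV[R]_n := e w.

Definition mean_noise (z : 'rV[R]_n -> X -> 'rV[R]_n -> R) w :=
  m%:R^-1 * \sum_i z (x w) (xi i w) (ew w).

(** The error bound holds for a fixed point and direction, so both are frozen
    before the sample is averaged; the mean over the batch is then handled by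
    the convexity of the square. *)
Lemma mean_noise_sqr (z : 'rV[R]_n -> X -> 'rV[R]_n -> R) (D : R)
    (W : 'rV[R]_n -> R) (M : R) :
  measurable_fun setT (fun t : borel_rV R n * X * borel_rV R n => z t.1.1 t.1.2 t.2) ->
  (forall y v, (\int[P]_w ((z y w v) ^+ 2)%:E <= D%:E)%E) ->
  measurable_fun setT (W : borel_rV R n -> R) ->
  (forall u, 0 <= W u) ->
  (forall u : 'rV[R]_n, dot u u = 1 -> `|W u| <= M) ->
  Pr.-integrable setT (EFin \o (fun w => mean_noise z w ^+ 2 * W (ew w))) /\
  \int[Pr]_w (mean_noise z w ^+ 2 * W (ew w)) <= D * \int[Pr]_w W (ew w).
Proof.
move=> mz zD mW W0 WM.
have mxO := past_measurable Gm mx.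
have me : measurable_fun setT (ew : Omega -> borel_rV R n) := sphere_meas e.
have iW : Pr.-integrable setT (EFin \o (fun w => W (ew w))) := sphere_integrable he mW WM.
pose phi (t : (borel_rV R n * borel_rV R n) * X) := z t.1.1 t.2 t.1.2 ^+ 2 * W t.1.2.
have phi0 t : 0 <= phi t by rewrite mulr_ge0 ?sqr_ge0.
have mz' : measurable_fun setT (fun t : (borel_rV R n * borel_rV R n) * X =>
    z t.1.1 t.2 t.1.2).
  have mp : measurable_fun setT (fun t : (borel_rV R n * borel_rV R n) * X =>
      ((t.1.1, t.2), t.1.2)).
    apply: measurable_fun_pair; last exact: (measurableT_comp measurable_snd measurable_fst).
    apply: measurable_fun_pair => //.
    exact: (measurableT_comp measurable_fst measurable_fst).
  exact: (measurableT_comp mz mp).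
have mphi : measurable_fun setT phi.
  apply: measurable_funM; first exact: measurable_funX.
  exact: (measurableT_comp mW (measurableT_comp measurable_snd measurable_fst)).
pose K := je |: J.
have mY : measurable_fun setT (fun w : past K => (x w, ew w) : borel_rV R n * borel_rV R n).
  apply: measurable_fun_pair; first exact: (past_mono (finset.subsetUr _ _) mx).
  by apply: past_source Ge; rewrite !inE eqxx.
have mYO := past_measurable Gm mY.
have mzi i : measurable_fun setT (fun w => z (x w) (xi i w) (ew w)).
  have mxi : measurable_fun setT (xi i : Omega -> X) by exact: measurable_funPT.
  exact: (measurableT_comp mz (measurable_fun_pair (measurable_fun_pair mxO mxi) me)).
have Hi i : Pr.-integrable setT (EFin \o (fun w => z (x w) (xi i w) (ew w) ^+ 2 * W (ew w))) /\
    \int[Pr]_w (z (x w) (xi i w) (ew w) ^+ 2 * W (ew w)) <= D * \int[Pr]_w W (ew w).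
  have iK : jx i \notin K by rewrite !inE negb_or jejx jxJ.
  have mxi : measurable_fun setT (xi i : Omega -> X) by exact: measurable_funPT.
  have B : (\int[Pr]_w (phi ((x w, ew w), xi i w))%:E <= (D * \int[Pr]_w W (ew w))%:E)%E.
    rewrite (freezing_ge0 mYO mxi (@hxi i) (past_indep GT GI Gm hG iK (@Gxi i) mY)
      (phi := EFin \o phi)) => [||t]; [|exact/measurable_EFinP|by rewrite lee_fin].
    rewrite -Rint_scale// -Rint_EFin; last exact: integrable_scale.
    apply: ge0_le_integral => //.
    - by move=> w _; apply: integral_ge0 => y _; rewrite lee_fin.
    - apply: (measurableT_comp (f := fun y : borel_rV R n * borel_rV R n =>
        (\int[P]_z (phi (y, z))%:E)%E) _ mYO).
      apply: (measurable_fun_fubini_tonelli_F (EFin \o phi)).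
        exact/measurable_EFinP.
      by move=> t; rewrite lee_fin.
    - apply/measurable_EFinP; apply: measurable_funM => //.
      exact: (measurableT_comp mW me).
    - move=> w _; rewrite /phi/=.
      under eq_integral do rewrite mulrC EFinM.
      rewrite ge0_integralZl//; last 3 first.
      + apply/measurable_EFinP; apply: measurable_funX.
        have mp : measurable_fun setT
            (fun y : X => ((x w, ew w), y) : (borel_rV R n * borel_rV R n) * X).
          by apply: measurable_fun_pair => //; exact: measurable_cst.
        exact: (measurableT_comp mz' mp).
      + by move=> y _; rewrite lee_fin sqr_ge0.
      + by rewrite lee_fin.
      by rewrite mulrC EFinM lee_wpmul2l// lee_fin.
  have iphi : Pr.-integrable setT (EFin \o (fun w => phi ((x w, ew w), xi i w))).
    apply: integrable_ge0_lty; last by rewrite (le_lt_trans B)// ltry.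
      exact: (measurableT_comp mphi (measurable_fun_pair mYO mxi)).
    by move=> w.
  by split=> //; rewrite -lee_fin -(Rint_EFin iphi).
have m0R : 0 < m%:R :> R by rewrite ltr0n.
pose bd w := m%:R^-1 * \sum_i (z (x w) (xi i w) (ew w) ^+ 2 * W (ew w)).
have ibd : Pr.-integrable setT (EFin \o bd).
  by apply: integrable_scale; apply: integrable_sumr => i; exact: (Hi i).1.
have le_bd w : mean_noise z w ^+ 2 * W (ew w) <= bd w.
  by rewrite /bd -mulr_suml mulrA ler_wpM2r// sqr_mean_le.
have ge0w w : 0 <= mean_noise z w ^+ 2 * W (ew w) by rewrite mulr_ge0 ?sqr_ge0.
have izm : Pr.-integrable setT (EFin \o (fun w => mean_noise z w ^+ 2 * W (ew w))).
  apply: integrable_dominated ibd _ => [|w]; last by rewrite ger0_norm.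
  apply: measurable_funM; last exact: (measurableT_comp mW me).
  by apply: measurable_funX; apply: measurable_funM => //; apply: measurable_sum.
split=> //; apply: (le_trans (Rint_le izm ibd le_bd)).
rewrite /bd Rint_scale; last by apply: integrable_sumr => i; exact: (Hi i).1.
rewrite Rint_sum => [|i]; last exact: (Hi i).1.
rewrite ler_pdivrMl//.
apply: (@le_trans _ _ (\sum_(i < m) D * \int[Pr]_w W (ew w))).
  by apply: ler_sum => i _; exact: (Hi i).2.
by rewrite sumr_const card_ord mulr_natl.
Qed.

Context (W : 'rV[R]_n -> R) (M : R).
Hypothesis mW : measurable_fun setT (W : borel_rV R n -> R).
Hypothesis W0 : forall u, 0 <= W u.
Hypothesis WM : forall u : 'rV[R]_n, dot u u = 1 -> `|W u| <= M.
Hypothesis Wflip : forall l u, W (reflect_along (delta_mx 0 l) u) = W u.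
Hypothesis Wswap : forall l l' u,
  W (reflect_along (delta_mx 0 l - delta_mx 0 l') u) = W u.

Context (z y : 'rV[R]_n -> X -> 'rV[R]_n -> R) (Dz Dy : R).
Hypothesis mz : measurable_fun setT
  (fun t : borel_rV R n * X * borel_rV R n => z t.1.1 t.1.2 t.2).
Hypothesis my : measurable_fun setT
  (fun t : borel_rV R n * X * borel_rV R n => y t.1.1 t.1.2 t.2).
Hypothesis zD : forall v u, (\int[P]_w ((z v w u) ^+ 2)%:E <= Dz%:E)%E.
Hypothesis yD : forall v u, (\int[P]_w ((y v w u) ^+ 2)%:E <= Dy%:E)%E.

Context (u : Omega -> 'rV[R]_n) (V V' : Omega -> R) (beta : R).
Hypothesis mu : forall c, measurable_fun setT (fun w : past J => u w 0 c).
Hypothesis iV : Pr.-integrable setT (EFin \o V).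
Hypothesis mV' : measurable_fun setT V'.
Hypothesis V'0 : forall w, 0 <= V' w.
Hypothesis uV : forall w, dot (u w) (u w) <= 2 * V w.
Hypothesis beta0 : 0 <= beta.
Hypothesis step : forall w,
  let c := dot (batch_mean w) (ew w) + mean_noise z w + mean_noise y w in
  beta * (c * dot (u w) (ew w)) <= 2^-1 * ((beta * c) ^+ 2 * W (ew w)) + V w - V' w.

(** Integrates the pathwise step inequality.  The weighted square is taken with
    weight [W]; the linear term and the square of [<u, e>] in the cross term use
    the constant weight 1 in [sphere_bilinear], which produces the factor
    [1 / n]. *)
Lemma step_expectation (lam : R) : 0 < lam ->
  let EW := \int[Pr]_w W (ew w) in
  Pr.-integrable setT (EFin \o V') /\
  \int[Pr]_w V' w + beta / n%:R * \int[Pr]_w dot (a (x w)) (u w) <=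
  \int[Pr]_w V w
  + 2^-1 * beta ^+ 2 *
    (3 * (n%:R^-1 * (\int[Pr]_w dot (a (x w)) (a (x w)) + sigma ^+ 2 / m%:R) * EW)
     + 2 * (Dz * EW) + 6 * (Dy * EW))
  + beta / 2 * (lam * (16 / 15 * Dz + 16 * Dy)
                + lam^-1 * (n%:R^-1 * (2 * \int[Pr]_w V w))).
Proof.
move=> l0 EW; have b2 : 0 <= 2^-1 * beta ^+ 2 by rewrite mulr_ge0 ?sqr_ge0.
pose K := J :|: [set jx i | i in 'I_m].
have JK : J \subset K := finset.subsetUl _ _.
have xK i : jx i \in K by rewrite !inE imset_f ?orbT.
have eK : je \notin K.
  rewrite !inE negb_or jeJ; apply/imsetP => -[i _ jei].
  by have := jejx i; rewrite jei eqxx.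
have [ibm Ebm] := batch_mean_sqr.
have mbK c := batch_mean_past c JK xK.
have muK c : measurable_fun setT (fun w : past K => u w 0 c) := past_mono JK (mu c).
have iu c : Pr.-integrable setT (EFin \o (fun w => u w 0 c ^+ 2)).
  apply: integrable_dominated (integrable_scale 2 iV) _.
    by apply: measurable_funX; exact: (past_measurable Gm (mu c)).
  by move=> w; rewrite ger0_norm ?sqr_ge0// (le_trans _ (uV w))// coord_sqr_le.
have one (v : 'rV[R]_n) : dot v v = 1 -> `|1 : R| <= 1 by rewrite normr1.
have m1 : measurable_fun setT ((fun=> 1 : R) : borel_rV R n -> R) by exact: measurable_cst.
have [iA EA] := sphere_bilinear GT GI Gm hG he Ge mW WM Wflip Wswap eK mbK mbK ibm ibm.
have [iB EB] := sphere_bilinear GT GI Gm hG he Ge m1 one (fun _ _ => erefl)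
  (fun _ _ _ => erefl) eK mbK muK ibm iu.
have [iC EC] := sphere_bilinear GT GI Gm hG he Ge m1 one (fun _ _ => erefl)
  (fun _ _ _ => erefl) eK muK muK iu iu.
have [izW EzW] := mean_noise_sqr mz zD mW W0 WM.
have [iyW EyW] := mean_noise_sqr my yD mW W0 WM.
have [iz Ez] := mean_noise_sqr mz zD m1 (fun=> ler01) one.
have [iy Ey] := mean_noise_sqr my yD m1 (fun=> ler01) one.
rewrite !Rint_cst !mulr1 in EB EC Ez Ey.
have Eu : \int[Pr]_w dot (u w) (u w) <= 2 * \int[Pr]_w V w.
  rewrite -Rint_scale//; apply: Rint_le => //; last exact: integrable_scale.
  apply: integrable_sumr => c; have := iu c.
  by apply: eq_integrable => // w _ /=; rewrite expr2.
have EbU := Rint_dot_batch_mean mu iu.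
pose A w := dot (batch_mean w) (ew w) * dot (batch_mean w) (ew w) * W (ew w).
pose B w := dot (batch_mean w) (ew w) * dot (u w) (ew w) * 1.
pose C w := dot (u w) (ew w) * dot (u w) (ew w) * 1.
pose Z w := mean_noise z w ^+ 2 * W (ew w).
pose Y w := mean_noise y w ^+ 2 * W (ew w).
pose Z1 w := mean_noise z w ^+ 2 * 1.
pose Y1 w := mean_noise y w ^+ 2 * 1.
pose T1 w := 3 * A w + 2 * Z w + 6 * Y w.
pose T2 w := lam * (16 / 15 * Z1 w + 16 * Y1 w) + lam^-1 * C w.
pose S w := V w + 2^-1 * beta ^+ 2 * T1 w + beta / 2 * T2 w - beta * B w.
have i1 : Pr.-integrable setT (EFin \o T1).
  by do 2!(apply: integrable_add; last exact: integrable_scale); exact: integrable_scale.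
have i2' : Pr.-integrable setT (EFin \o (fun w => 16 / 15 * Z1 w + 16 * Y1 w)).
  by apply: integrable_add; exact: integrable_scale.
have i2 : Pr.-integrable setT (EFin \o T2).
  by apply: integrable_add; exact: integrable_scale.
have i3 : Pr.-integrable setT (EFin \o (fun w => V w + 2^-1 * beta ^+ 2 * T1 w)).
  by apply: integrable_add => //; exact: integrable_scale.
have i4 : Pr.-integrable setT (EFin \o
    (fun w => V w + 2^-1 * beta ^+ 2 * T1 w + beta / 2 * T2 w)).
  by apply: integrable_add => //; exact: integrable_scale.
have iS : Pr.-integrable setT (EFin \o S).
  by apply: integrable_sub => //; exact: integrable_scale.
have V'S w : V' w <= S w.
  have := step w; rewrite /S /T1 /T2 /A /B /C /Z /Y /Z1 /Y1 /=.
  have := sqr_sum3_le (dot (batch_mean w) (ew w)) (mean_noise z w) (mean_noise y w).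
  have := noise_cross_le (dot (u w) (ew w)) (mean_noise z w) (mean_noise y w) l0.
  have := W0 (ew w).
  move: (dot (batch_mean w) _) (dot (u w) _) (mean_noise z w) (mean_noise y w) (W _).
  move=> a0 b0 c0 d0 w0 w00 h1 h2.
  have h3 := ler_wpM2l b2 (ler_wpM2r w00 h2); have {h1}h1 := ler_wpM2l beta0 h1.
  rewrite !mulr1 -!expr2; move: (lam^-1) h1 => il h1 h4.
  have E : 2^-1 * ((beta * (a0 + c0 + d0)) ^+ 2 * w0) =
     2^-1 * beta ^+ 2 * ((a0 + c0 + d0) ^+ 2 * w0) by ring.
  rewrite E in h4; move: h3 h4; set Q := (a0 + c0 + d0) ^+ 2 * w0.
  have E2 : beta * ((a0 + c0 + d0) * b0) = beta * (a0 * b0) - beta * - ((c0 + d0) * b0) by ring.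
  rewrite E2; move: h1; set P1 := beta * - _; move: Q P1 => Q P1.
  have E3 : 2^-1 * beta ^+ 2 * ((3 * a0 ^+ 2 + 2 * c0 ^+ 2 + 6 * d0 ^+ 2) * w0) =
     2^-1 * beta ^+ 2 * (3 * (a0 ^+ 2 * w0) + 2 * (c0 ^+ 2 * w0) + 6 * (d0 ^+ 2 * w0)) by ring.
  rewrite E3; set P2 := 2^-1 * beta ^+ 2 * (_ + _ + _).
  have E4 : beta * (2^-1 * (lam * (16 / 15 * c0 ^+ 2 + 16 * d0 ^+ 2) + il * b0 ^+ 2)) =
    beta / 2 * (lam * (16 / 15 * c0 ^+ 2 + 16 * d0 ^+ 2) + il * b0 ^+ 2) by ring.
  rewrite E4; set P3 := beta / 2 * _; set P4 := beta * (a0 * b0).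
  set P5 := 2^-1 * beta ^+ 2 * Q; clearbody P2 P3 P4 P5 => ? ? ?; lra.
have iV' : Pr.-integrable setT (EFin \o V').
  by apply: integrable_dominated iS _ => // w; rewrite ger0_norm.
split=> //; rewrite -lerBrDr; apply: (le_trans (Rint_le iV' iS V'S)).
rewrite /S Rint_sub//; last exact: integrable_scale.
rewrite Rint_add//; last exact: integrable_scale.
rewrite Rint_add//; last exact: integrable_scale.
rewrite !Rint_scale//.
have -> : \int[Pr]_w B w = n%:R^-1 * \int[Pr]_w dot (a (x w)) (u w).
  by rewrite EB EbU.
rewrite (mulrA beta n%:R^-1) lerD2r -!addrA lerD2l; apply: lerD.
  rewrite ler_wpM2l// /T1 Rint_add//; last 2 first.
  - by apply: integrable_add; exact: integrable_scale.
  - exact: integrable_scale.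
  rewrite Rint_add; [|exact: integrable_scale|exact: integrable_scale].
  rewrite !Rint_scale// -!addrA.
  have EW0 : 0 <= EW by apply: Rintegral_ge0 => w _.
  apply: lerD; last by apply: lerD; rewrite ler_wpM2l.
  rewrite ler_wpM2l// /A EA ler_wpM2r// ler_wpM2l// invr_ge0//.
rewrite ler_wpM2l ?mulr_ge0// /T2 Rint_add; [|exact: integrable_scale|exact: integrable_scale].
rewrite !Rint_scale// Rint_add; [|exact: integrable_scale|exact: integrable_scale].
rewrite !Rint_scale//; apply: lerD.
  by rewrite ler_wpM2l ?(ltW l0)//; apply: lerD; rewrite ler_wpM2l// divr_ge0.
rewrite ler_wpM2l ?invr_ge0 ?(ltW l0)// /C EC ler_wpM2l// invr_ge0//.
Qed.

End batch.

(** * Constants of the recursion *)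

Section sphere_majorant.
Context {R : realType} {n : nat}.
Implicit Types u v : 'rV[R]_n.

Lemma evenpow_meas k : measurable_fun setT (evenpow k : borel_rV R n -> R).
Proof. by apply: measurable_sum => i; exact: measurable_coordX. Qed.

Lemma evenpow_le_dim k u : dot u u = 1 -> evenpow k u <= n%:R.
Proof.
move=> u1; rewrite -[n%:R]mulr1 -[in leRHS](card_ord n) mulr_natl -sumr_const.
by apply: ler_sum => i _; rewrite (le_trans (ler_norm _))// coordX_le1.
Qed.

Lemma evenpow_flip k i u : evenpow k (reflect_along (delta_mx 0 i) u) = evenpow k u.
Proof.
apply: eq_bigr => j _; rewrite reflect_delta; case: eqP => // _.
by rewrite !exprM sqrrN.
Qed.

Lemma evenpow_swap k i j u :
  evenpow k (reflect_along (delta_mx 0 i - delta_mx 0 j) u) = evenpow k u.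
Proof.
have [<-|ij] := eqVneq i j.
  by rewrite subrr /reflect_along scaler0 subr0.
rewrite /evenpow; under eq_bigr do rewrite reflect_swap//.
by rewrite (reindex_inj (@perm.perm_inj _ (perm.tperm i j)))/=;
  apply: eq_bigr => l _; rewrite perm.tpermK.
Qed.

Lemma Rint_evenpow_le d (T : measurableType d) (P : probability T R)
    (e : {RV P >-> borel_rV R n}) k : uniform_on_sphere e ->
  \int[P]_w evenpow k (e w : 'rV[R]_n) <= n%:R * (k%:R / n%:R) ^+ k.
Proof.
move=> he; rewrite Rint_sum => [|i]; last exact: (integrable_power he).
apply: (@le_trans _ _ (\sum_(i < n) (k%:R / n%:R) ^+ k)).
  by apply: ler_sum => i _; exact: (sphere_moment_le he).
by rewrite sumr_const card_ord [leRHS]mulr_natl.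
Qed.

End sphere_majorant.

Section arithmetic.
Context {R : realType}.

(** The right-hand side is the square in which the claim is expressed. *)
Lemma noise_budget (Dz De : R) : 0 <= Dz -> 0 <= De ->
  Dz + 15 * De ^+ 2 <= 4 * (Num.sqrt Dz / 2 + 2 * De) ^+ 2.
Proof.
move=> Dz0 De0; have sD := sqr_sqrtr Dz0.
have -> : 4 * (Num.sqrt Dz / 2 + 2 * De) ^+ 2 =
    Num.sqrt Dz ^+ 2 + 8 * (Num.sqrt Dz * De) + 16 * De ^+ 2 by field.
have : 0 <= Num.sqrt Dz * De by rewrite mulr_ge0 ?sqrtr_ge0.
by rewrite sD; have := sqr_ge0 De; lra.
Qed.

(** With this step size the coefficient [3 (alpha n) ^ 2 / 2] of the squared
    exact part, multiplied by [4 L2 S * 2 r / n], is a quarter of [al * S]: one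
    quarter of the descent pays for the variance of the direction. *)
Lemma step_constants (n N m r L2 al EW Eaa Edu S Dz Dy Q s2 v v' : R) :
  0 < n -> 0 < N -> 0 < m -> 0 < r -> 0 < L2 ->
  0 <= EW -> EW <= 2 * r -> 0 <= Eaa -> Eaa <= 4 * L2 * S -> S <= Edu ->
  0 <= Dz -> 0 <= Dy -> 0 <= s2 -> Dz + 15 * Dy <= Q ->
  al = (48 * n * r * L2)^-1 ->
  v' + al * n / n * Edu <=
    v + 2^-1 * (al * n) ^+ 2 *
      (3 * (n^-1 * (Eaa + s2 / m) * EW) + 2 * (Dz * EW) + 6 * (Dy * EW))
    + al * n / 2 * (4 * N * al * (16 / 15 * Dz + 16 * Dy)
                    + (4 * N * al)^-1 * (n^-1 * (2 * v))) ->
  v' + 3 / 4 * al * S <= (1 + (4 * N)^-1) * v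
    + al * (s2 / (16 * L2 * m) + n * Dz / (24 * L2) + n * Dy / (8 * L2)
            + 2 * N * Q / (45 * r * L2)).
Proof.
move=> n0 N0 m0 r0 L0 EW0 EWr Eaa0 EaaS SE Dz0 Dy0 s20 DQ alE.
have al0 : 0 < al by rewrite alE invr_gt0 !mulr_gt0.
pose beta := al * n; pose lam := 4 * N * al; rewrite -/beta -/lam => H.
have be0 : 0 <= beta by rewrite mulr_ge0 ?ltW.
have la0 : 0 < lam by rewrite !mulr_gt0.
have s2m : 0 <= s2 / m by rewrite divr_ge0 ?(ltW m0).
have h1 : n^-1 * (Eaa + s2 / m) * EW <= n^-1 * (4 * L2 * S + s2 / m) * (2 * r).
  apply: ler_pM => //; first by rewrite mulr_ge0 ?invr_ge0 ?addr_ge0 ?(ltW n0).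
  by rewrite ler_wpM2l ?invr_ge0 ?(ltW n0)// lerD2r.
have h2 : Dz * EW <= Dz * (2 * r) by rewrite ler_wpM2l.
have h3 : Dy * EW <= Dy * (2 * r) by rewrite ler_wpM2l.
have h4 : 16 / 15 * Dz + 16 * Dy <= 16 / 15 * Q by lra.
have b2 : 0 <= 2^-1 * beta ^+ 2 by rewrite mulr_ge0 ?sqr_ge0.
have g1 : 2^-1 * beta ^+ 2 *
      (3 * (n^-1 * (Eaa + s2 / m) * EW) + 2 * (Dz * EW) + 6 * (Dy * EW)) <=
    2^-1 * beta ^+ 2 * (3 * (n^-1 * (4 * L2 * S + s2 / m) * (2 * r))
      + 2 * (Dz * (2 * r)) + 6 * (Dy * (2 * r))).
  rewrite ler_wpM2l//; apply: lerD; last by rewrite ler_wpM2l.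
  by apply: lerD; rewrite ler_wpM2l.
have g2 : beta / 2 * (lam * (16 / 15 * Dz + 16 * Dy) + lam^-1 * (n^-1 * (2 * v))) <=
    beta / 2 * (lam * (16 / 15 * Q) + lam^-1 * (n^-1 * (2 * v))).
  have b20 : 0 <= beta / 2 by rewrite divr_ge0.
  by apply: ler_wpM2l => //; rewrite lerD2r ler_wpM2l ?(ltW la0).
have g3 : al * S <= beta / n * Edu.
  by rewrite /beta mulfK ?gt_eqF// ler_wpM2l// ltW.
have E1 : 2^-1 * beta ^+ 2 * (3 * (n^-1 * (4 * L2 * S + s2 / m) * (2 * r))
      + 2 * (Dz * (2 * r)) + 6 * (Dy * (2 * r))) =
    al * S / 4 + al * (s2 / (16 * L2 * m) + n * Dz / (24 * L2) + n * Dy / (8 * L2)).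
  by rewrite /beta alE; field; rewrite !gt_eqF.
have E2 : beta / 2 * (lam * (16 / 15 * Q) + lam^-1 * (n^-1 * (2 * v))) =
    al * (2 * N * Q / (45 * r * L2)) + (4 * N)^-1 * v.
  by rewrite /beta /lam alE; field; rewrite !gt_eqF.
rewrite E1 in g1; rewrite E2 in g2.
have -> : 3 / 4 * al * S = 3 / 4 * (al * S) by ring.
move: H g1 g2 g3.
set X1 := 2^-1 * _ * _; set X2 := beta / 2 * _; set X3 := beta / n * _.
move: X1 X2 X3 => X1 X2 X3 H g1 g2 g3.
rewrite mulrDr (_ : (1 + _) * v = v + (4 * N)^-1 * v); last by ring.
move: g1 g2; set Y1 := al * (_ + _ / (8 * L2)); set Y2 := al * (2 * _ * _ / _).
set Y3 := _^-1 * v; clearbody Y1 Y2 Y3 => g1 g2.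
by move: (al * S) g1 g3 => s g1 g3; lra.
Qed.

(** By induction all [v l] stay below [B], the right-hand side, so the excess of the
    factor over 1 adds at most [B / (4 N)] per step and [B / 4] in total; [B] solves
    [v 0 + N A + B / 4 = B]. *)
Lemma recursion_bound (N : nat) (v S : nat -> R) (c A : R) :
  (0 < N)%N -> 0 <= c -> 0 <= A ->
  (forall k, 0 <= v k) -> (forall k, 0 <= S k) ->
  (forall k, (k < N)%N -> v k.+1 + c * S k <= (1 + (4 * N%:R)^-1) * v k + A) ->
  c * \sum_(k < N) S k <= 4 / 3 * (v 0%N + N%:R * A).
Proof.
move=> N0 c0 A0 v0 S0 H; have N0R : 0 < N%:R :> R by rewrite ltr0n.
set B := 4 / 3 * (v 0%N + N%:R * A).
have B0 : 0 <= B by rewrite mulr_ge0 ?addr_ge0 ?mulr_ge0 ?ler0n.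
have cS l : 0 <= c * \sum_(k < l) S k by rewrite mulr_ge0// sumr_ge0.
have bnd l : (l <= N)%N ->
    v 0%N + l%:R * A + l%:R * ((4 * N%:R)^-1 * B) <= B.
  move=> lN; have lNR : l%:R <= N%:R :> R by rewrite ler_nat.
  apply: (@le_trans _ _ (v 0%N + N%:R * A + N%:R * ((4 * N%:R)^-1 * B))).
    have iB : 0 <= (4 * N%:R)^-1 * B by rewrite mulr_ge0// invr_ge0 mulr_ge0 ?ler0n.
    by apply: lerD; [rewrite lerD2l|]; rewrite ler_wpM2r.
  have -> : N%:R * ((4 * N%:R)^-1 * B) = 4^-1 * B by field; rewrite gt_eqF.
  have : v 0%N + N%:R * A = 3 / 4 * B by rewrite /B; field.
  by move=> ->; lra.
have main l : (l <= N)%N -> v l + c * \sum_(k < l) S k <=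
    v 0%N + l%:R * A + l%:R * ((4 * N%:R)^-1 * B).
  elim: l => [_|l IHl lN]; first by rewrite big_ord0 mulr0 !mul0r !addr0.
  have {}IHl := IHl (ltnW lN); have vB : v l <= B.
    apply: le_trans (bnd l (ltnW lN)); apply: le_trans IHl.
    by rewrite lerDl.
  have iN : 0 <= (4 * N%:R)^-1 :> R by rewrite invr_ge0 mulr_ge0 ?ler0n.
  have h1 := H l lN; have h2 := ler_wpM2l iN vB.
  have E : (1 + (4 * N%:R)^-1) * v l = v l + (4 * N%:R)^-1 * v l by ring.
  have S1 (X : R) : l.+1%:R * X = l%:R * X + X by rewrite -natr1; ring.
  rewrite E in h1; rewrite big_ord_recr/= (mulrDr c) !S1.
  move: IHl h1 h2; move: (c * \sum_(_ < _) _) (c * S l) (_^-1 * v l) (_^-1 * B) (l%:R * _).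
  by move=> a b d f Y; move: (l%:R * f) => Z; lra.
apply: le_trans (bnd N (leqnn N)); apply: le_trans (main N (leqnn N)).
by rewrite lerDr.
Qed.

Lemma final_constants (n N m r L2 al Th Dz Dy s2 Q : R) :
  0 < n -> 0 < N -> 0 < m -> 0 < r -> 0 < L2 -> 0 <= Th -> 0 <= Dz -> 0 <= Dy ->
  0 <= s2 -> 0 <= Q ->
  al = (48 * n * r * L2)^-1 ->
  (3 / 4 * al)^-1 * (4 / 3 * (Th + N * (al *
     (s2 / (16 * L2 * m) + n * Dz / (24 * L2) + n * Dy / (8 * L2)
            + 2 * N * (4 * Q ^+ 2) / (45 * r * L2))))) / N <=
  384 * n * r * L2 * Th / N + 2 / L2 * (s2 / m) + n / (12 * L2) * Dz
    + 4 * n / (3 * L2) * Dy + 8 * Num.sqrt (2 * n * Th) / N * Q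
    + N / (3 * L2 * r) * Q ^+ 2.
Proof.
move=> n0 N0 m0 r0 L0 Th0 Dz0 Dy0 s20 Q0 alE.
have E : (3 / 4 * al)^-1 * (4 / 3 * (Th + N * (al *
     (s2 / (16 * L2 * m) + n * Dz / (24 * L2) + n * Dy / (8 * L2)
            + 2 * N * (4 * Q ^+ 2) / (45 * r * L2))))) / N =
   16 / 9 * (48 * (n * r * L2 * Th / N)) + 1 / 9 * (s2 / m / L2)
   + 2 / 27 * (n / L2 * Dz) + 2 / 9 * (n / L2 * Dy)
   + 128 / 405 * (N / (L2 * r) * Q ^+ 2).
  by rewrite alE; field; rewrite !gt_eqF.
rewrite E.
have t1 : 0 <= n * r * L2 * Th / N.
  by rewrite divr_ge0 ?mulr_ge0 ?(ltW n0) ?(ltW r0) ?(ltW L0) ?(ltW N0).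
have t2 : 0 <= s2 / m / L2 by rewrite !divr_ge0 ?(ltW m0) ?(ltW L0).
have t3 : 0 <= n / L2 * Dz by rewrite mulr_ge0 ?divr_ge0 ?(ltW n0) ?(ltW L0).
have t4 : 0 <= n / L2 * Dy by rewrite mulr_ge0 ?divr_ge0 ?(ltW n0) ?(ltW L0).
have t5 : 0 <= N / (L2 * r) * Q ^+ 2.
  by rewrite mulr_ge0 ?sqr_ge0// divr_ge0 ?mulr_ge0 ?(ltW N0) ?(ltW L0) ?(ltW r0).
have t6 : 0 <= 8 * Num.sqrt (2 * n * Th) / N * Q.
  by rewrite mulr_ge0// divr_ge0 ?mulr_ge0 ?sqrtr_ge0 ?(ltW N0).
have -> : 384 * n * r * L2 * Th / N = 384 * (n * r * L2 * Th / N) by ring.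
have -> : 2 / L2 * (s2 / m) = 2 * (s2 / m / L2) by ring.
have -> : n / (12 * L2) * Dz = 1 / 12 * (n / L2 * Dz) by field; rewrite gt_eqF.
have -> : 4 * n / (3 * L2) * Dy = 4 / 3 * (n / L2 * Dy) by field; rewrite gt_eqF.
have -> : N / (3 * L2 * r) * Q ^+ 2 = 1 / 3 * (N / (L2 * r) * Q ^+ 2).
  by field; rewrite !gt_eqF.
move: (_ * Th / N) (s2 / m / L2) (_ * Dz) (_ * Dy) (_ * Q ^+ 2) (_ * Q) t1 t2 t3 t4 t5 t6.
by move=> *; lra.
Qed.

End arithmetic.

(** * The run of the method *)

Section run.
Context {R : realType} {n : nat} {dX : measure_display} {X : measurableType dX}.
Context (P : probability X R) (f : 'rV[R]_n -> R).
Context (g : 'rV[R]_n -> X -> 'rV[R]_n) (a : 'rV[R]_n -> 'rV[R]_n) (L2 sigma : R).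
Hypothesis n0 : (0 < n)%N.
Hypothesis hL2 : 0 < L2.
Hypothesis f_ge : forall x y, dot (a x) (y - x) <= f y - f x.
Hypothesis f_le : forall x y,
  f y - f x <= dot (a x) (y - x) + L2 * dot (y - x) (y - x).
Context (xstar : 'rV[R]_n).
Hypothesis hxstar : is_argmin f xstar.
Hypothesis mg : measurable_fun setT
  (fun t : borel_rV R n * X => g t.1 t.2 : borel_rV R n).
Hypothesis ig : forall x c, P.-integrable setT (EFin \o (fun xi => g x xi 0 c)).
Hypothesis Eg : forall x c, \int[P]_xi g x xi 0 c = a x 0 c.
Hypothesis inoise : forall x, P.-integrable setT
  (EFin \o (fun xi => dot (g x xi - a x) (g x xi - a x))).
Hypothesis Enoise : forall x,
  \int[P]_xi dot (g x xi - a x) (g x xi - a x) <= sigma ^+ 2.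

Context (z y : 'rV[R]_n -> X -> 'rV[R]_n -> R) (Dz De : R).
Hypothesis mz : measurable_fun setT
  (fun t : borel_rV R n * X * borel_rV R n => z t.1.1 t.1.2 t.2).
Hypothesis my : measurable_fun setT
  (fun t : borel_rV R n * X * borel_rV R n => y t.1.1 t.1.2 t.2).
Hypothesis zD : forall v u, (\int[P]_w ((z v w u) ^+ 2)%:E <= Dz%:E)%E.
Hypothesis yD : forall v u, (\int[P]_w ((y v w u) ^+ 2)%:E <= (De ^+ 2)%:E)%E.
Hypothesis Dz0 : 0 <= Dz.
Hypothesis De0 : 0 <= De.

Context (p : R) (d : 'rV[R]_n -> R).
Hypothesis hp : 1 <= p <= 2.
Hypothesis hd : prox_function p d.
Context (r ca cb : R) (k0 : nat).
Hypothesis r0 : 0 < r.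
Hypothesis ca0 : 0 <= ca.
Hypothesis cb0 : 0 <= cb.
Hypothesis maj : forall e u : 'rV[R]_n,
  dot e u ^+ 2 <= (ca + cb * evenpow k0 e) * pnorm p u ^+ 2.
Hypothesis maj_le : ca + cb * (n%:R * (k0%:R / n%:R) ^+ k0) <= 2 * r.

Context (N m : nat).
Hypothesis hN : (0 < N)%N.
Hypothesis hm : (0 < m)%N.
Context {dO : measure_display} {Omega : measurableType dO} (Pr : probability Omega R).
Context (e : 'I_N -> {RV Pr >-> borel_rV R n}) (xi : 'I_N -> 'I_m -> {RV Pr >-> X}).
Hypothesis he : forall k, uniform_on_sphere (e k).
Hypothesis hxi : forall k i, has_law (xi k i) P.

(** Left indices stand for directions, right indices for samples of a batch. *)
Definition sources (j : 'I_N + 'I_N * 'I_m) : set_system Omega :=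
  match j with
  | inl k => preimage_set_system setT (e k) measurable
  | inr ki => preimage_set_system setT (xi ki.1 ki.2) measurable
  end.
Hypothesis hindep : mutually_independent Pr sources.
Context (x : nat -> Omega -> 'rV[R]_n) (x0 : 'rV[R]_n).
Hypothesis hx0 : forall w, x 0%N w = x0.

(** The step vector is this number times the direction. *)
Definition stochastic_coef (k : 'I_N) w : R :=
  dot (batch_mean g (xi k) (x k) w) (e k w)
  + mean_noise (xi k) (x k) (e k) z w + mean_noise (xi k) (x k) (e k) y w.

Let al : R := (48 * n%:R * r * L2)^-1.

Hypothesis hx : forall (k : 'I_N) w, is_argmin
  (rdd_objective d al (stochastic_coef k w *: (e k w : 'rV[R]_n)) (x k w)) (x k.+1 w).

Let n0R : 0 < n%:R :> R. Proof. by rewrite ltr0n. Qed.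
Let al0 : 0 < al. Proof. by rewrite invr_gt0 !mulr_gt0. Qed.

Let ST j : sources j setT.
Proof. by case: j => [k|ki]; exists setT => //; rewrite setTI preimage_setT. Qed.

Let SI j : setI_closed (sources j).
Proof.
case: j => [k|ki] _ _ [A mA <-] [B mB <-];
  (exists (A `&` B); first exact: measurableI);
  by rewrite preimage_setI setIIr.
Qed.

Let Sm j : sources j `<=` measurable.
Proof.
case: j => [k|ki] _ [A mA <-]; rewrite setTI.
  by rewrite -[X in measurable X]setTI; apply: (@measurable_funPT _ _ _ _ (e k)).
by rewrite -[X in measurable X]setTI; apply: (@measurable_funPT _ _ _ _ (xi ki.1 ki.2)).
Qed.

Let Se k A : measurable A -> sources (inl k) (e k @^-1` A).
Proof. by move=> mA; exists A => //; rewrite setTI. Qed.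

Let Sxi k i A : measurable A -> sources (inr (k, i)) (xi k i @^-1` A).
Proof. by move=> mA; exists A => //; rewrite setTI. Qed.

Definition before (k : nat) : {set 'I_N + 'I_N * 'I_m} :=
  [set j : 'I_N + 'I_N * 'I_m |
    match j with inl l => (l < k)%N | inr li => (li.1 < k)%N end].

Local Notation past J := (g_sigma_algebraType (\bigcup_(i in [set` J]) sources i)).

Lemma before_mono k : before k \subset before k.+1.
Proof.
by apply/fintype.subsetP => -[l|[l i]]; rewrite !inE => /ltnW.
Qed.

Let fcont : continuous f := quadratic_continuous f_ge f_le.

Lemma mean_gradient_meas c : measurable_fun setT (fun v : borel_rV R n => a v 0 c).
Proof.
have := @measurable_partial R n f c fcont.
have -> : (fun v : borel_rV R n => gradient f v 0 c) = (fun v => a v 0 c).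
  by apply/funext => v; rewrite (quadratic_gradient hL2 f_ge f_le).
by apply => v; have [] := quadratic_is_derive hL2 f_ge f_le v (delta_mx 0 c).
Qed.

Lemma prox_gradient_meas c : measurable_fun setT (fun v : borel_rV R n => gradient d v 0 c).
Proof.
apply: measurable_partial; first exact: prox_continuous hd.
by move=> v; apply: diff_derivable; exact: prox_differentiable hd v.
Qed.

Lemma coordinate_past (J : {set 'I_N + 'I_N * 'I_m}) (u : Omega -> 'rV[R]_n) c :
  measurable_fun setT (u : past J -> borel_rV R n) ->
  measurable_fun setT (fun w : past J => u w 0 c).
Proof. by move=> mu; exact: (measurableT_comp (@measurable_coord R n c) mu). Qed.

Lemma stochastic_coef_past (k : 'I_N) :
  measurable_fun setT (x k : past (before k) -> borel_rV R n) ->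
  measurable_fun setT (stochastic_coef k : past (before k.+1) -> R).
Proof.
move=> mx; have mxS := past_mono (before_mono k) mx.
have me : measurable_fun setT (e k : past (before k.+1) -> borel_rV R n).
  by apply: past_source (@Se k); rewrite inE.
have mxi i : measurable_fun setT (xi k i : past (before k.+1) -> X).
  by apply: past_source (@Sxi k i); rewrite inE.
have mb c : measurable_fun setT
    (fun w : past (before k.+1) => batch_mean g (xi k) (x k) w 0 c).
  apply: (batch_mean_past mg mean_gradient_meas (jx := fun i => inr (k, i)) (J := before k) hm
    (@Sxi k) mx); first exact: before_mono.
  by move=> i; rewrite inE.
have mn (t : 'rV[R]_n -> X -> 'rV[R]_n -> R) : measurable_fun setT
      (fun t' : borel_rV R n * X * borel_rV R n => t t'.1.1 t'.1.2 t'.2) ->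
    measurable_fun setT (mean_noise (xi k) (x k) (e k) t : past (before k.+1) -> R).
  move=> mt; apply: measurable_funM; first exact: measurable_cst.
  apply: measurable_sum => i.
  exact: (measurableT_comp mt (measurable_fun_pair (measurable_fun_pair mxS (mxi i)) me)).
apply: measurable_funD; last exact: mn.
apply: measurable_funD; last exact: mn.
apply: measurable_sum => c; apply: measurable_funM; first exact: mb.
exact: (coordinate_past c me).
Qed.

(** Every iterate is the inverse gradient of [d] at a vector that is determined
    by the previous iterate and the new draws. *)
Lemma iterate_past k : (k <= N)%N ->
  measurable_fun setT (x k : past (before k) -> borel_rV R n).
Proof.
elim: k => [_|k IHk kN].
  have -> : x 0%N = fun=> x0 by apply/funext => w; exact: hx0.
  exact: measurable_cst.
have {}IHk := IHk (ltnW kN); pose k' := Ordinal kN.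
have mc := @stochastic_coef_past k' IHk.
have [T [TK mT]] := gradient_inverse hp hd.
have me : measurable_fun setT (e k' : past (before k.+1) -> borel_rV R n).
  by apply: past_source (@Se k'); rewrite inE /=.
have mxS : measurable_fun setT (x k : past (before k.+1) -> borel_rV R n) :=
  past_mono (before_mono k) IHk.
pose v w : 'rV[R]_n := gradient d (x k w) -
  (al * n%:R) *: (stochastic_coef k' w *: (e k' w : 'rV[R]_n)).
have mv : measurable_fun setT (v : past (before k.+1) -> borel_rV R n).
  apply: measurable_to_borel_rV => c.
  have -> : (fun w : past (before k.+1) => v w 0 c) = (fun w => gradient d (x k w) 0 c -
      (al * n%:R) * (stochastic_coef k' w * (e k' w : 'rV[R]_n) 0 c)).
    by apply/funext => w; rewrite /v !mxE.
  apply: measurable_funB; first exact: (measurableT_comp (prox_gradient_meas c) mxS).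
  apply: measurable_funM; first exact: measurable_cst.
  by apply: measurable_funM => //; exact: (coordinate_past c me).
have -> : x k.+1 = (fun w => T (v w)).
  apply/funext => w; rewrite -[LHS]TK (argmin_gradient hd (hx k' w)) /v.
  by [].
apply: measurable_to_borel_rV => c.
exact: (measurableT_comp (mT c) mv).
Qed.

Lemma iterate_meas k : (k <= N)%N -> measurable_fun setT (x k : Omega -> borel_rV R n).
Proof. by move=> kN; exact: (past_measurable Sm (iterate_past kN)). Qed.

Let V k w := bregman d (x k w) xstar.

Lemma bregman_meas k : (k <= N)%N -> measurable_fun setT (V k).
Proof.
move=> kN; have mx := iterate_meas kN; rewrite /V /bregman.
apply: measurable_funB.
  apply: measurable_funB => //.
  exact: (measurableT_comp (continuous_borel_measurable (prox_continuous hd)) mx).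
apply: measurable_sum => c; apply: measurable_funM.
  exact: (measurableT_comp (prox_gradient_meas c) mx).
have -> : (fun w => (xstar - x k w) 0 c) = (fun w => xstar 0 c - x k w 0 c).
  by apply/funext => w; rewrite !mxE.
by apply: measurable_funB => //; exact: (measurableT_comp (@measurable_coord R n c) mx).
Qed.

Let gap k w := f (x k w) - f xstar.

Lemma gap_ge0 k w : 0 <= gap k w.
Proof. by rewrite subr_ge0. Qed.

Lemma dist_le_V k w : dot (x k w - xstar) (x k w - xstar) <= 2 * V k w.
Proof.
have := dot_le_bregman hp hd (x k w) xstar.
by rewrite -(opprB (x k w)) dotNl dotNr opprK.
Qed.

(** Integrability of the gaps follows from that of the divergences. *)
Lemma gap_le k w : gap k w <= 2 * L2 * V k w.
Proof.
apply: le_trans (quadratic_growth hL2 f_le (x k w) hxstar) _.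
by rewrite [2 * L2]mulrC -mulrA ler_wpM2l ?(ltW hL2)//; exact: dist_le_V.
Qed.

Lemma gap_int k : (k <= N)%N -> Pr.-integrable setT (EFin \o V k) ->
  Pr.-integrable setT (EFin \o gap k).
Proof.
move=> kN iV; apply: integrable_dominated (integrable_scale (2 * L2) iV) _.
  apply: measurable_funB => //.
  exact: (measurableT_comp (continuous_borel_measurable fcont) (iterate_meas kN)).
by move=> w; rewrite ger0_norm ?gap_ge0// gap_le.
Qed.

Let Q : R := Num.sqrt Dz / 2 + 2 * De.
Let C : R := sigma ^+ 2 / (16 * L2 * m%:R) + n%:R * Dz / (24 * L2)
  + n%:R * De ^+ 2 / (8 * L2) + 2 * N%:R * (4 * Q ^+ 2) / (45 * r * L2).

(** The majorant [W] of the squared dual norm and the Young weight [4 N al] are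
    inserted in [step_expectation]; the integrability of the next divergence
    comes out of the same inequality. *)
Lemma one_step (k : 'I_N) : Pr.-integrable setT (EFin \o V k) ->
  Pr.-integrable setT (EFin \o V k.+1) /\
  \int[Pr]_w V k.+1 w + 3 / 4 * al * \int[Pr]_w gap k w <=
  (1 + (4 * N%:R)^-1) * \int[Pr]_w V k w + al * C.
Proof.
move=> iV; have kN : (k <= N)%N := ltnW (ltn_ord k).
have mxp := iterate_past kN; have mxO := iterate_meas kN.
have igap := gap_int kN iV.
have Vge0 l w : 0 <= V l w := bregman_ge0 hd _ _.
pose W (u : 'rV[R]_n) := ca + cb * evenpow k0 u.
have W0 u : 0 <= W u by rewrite addr_ge0// mulr_ge0// evenpow_ge0.
have mW : measurable_fun setT (W : borel_rV R n -> R).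
  by apply: measurable_funD => //; apply: measurable_funM => //; exact: evenpow_meas.
have WM (u : 'rV[R]_n) : dot u u = 1 -> `|W u| <= ca + cb * n%:R.
  by move=> u1; rewrite ger0_norm// lerD2l ler_wpM2l// evenpow_le_dim.
have Wflip l u : W (reflect_along (delta_mx 0 l) u) = W u by rewrite /W evenpow_flip.
have Wswap l l' u : W (reflect_along (delta_mx 0 l - delta_mx 0 l') u) = W u.
  by rewrite /W evenpow_swap.
have aa_le w : dot (a (x k w)) (a (x k w)) <= 4 * L2 * gap k w.
  exact: (quadratic_gradient_sqr hL2 f_le (x k w) hxstar).
have maO c : measurable_fun setT (fun w => a (x k w) 0 c).
  exact: (measurableT_comp (mean_gradient_meas c) mxO).
have iax c : Pr.-integrable setT (EFin \o (fun w => a (x k w) 0 c ^+ 2)).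
  apply: integrable_dominated (integrable_scale (4 * L2) igap) _.
    exact: measurable_funX.
  by move=> w; rewrite ger0_norm ?sqr_ge0// (le_trans (coord_sqr_le _ _)).
have mu c : measurable_fun setT (fun w : past (before k) => (x k w - xstar) 0 c).
  have -> : (fun w : past (before k) => (x k w - xstar) 0 c) =
      (fun w => x k w 0 c - xstar 0 c) by apply/funext => w; rewrite !mxE.
  by apply: measurable_funB; [exact: (coordinate_past c mxp)|exact: measurable_cst].
have jeJ : inl k \notin before k by rewrite inE ltnn.
have jxJ i : inr (k, i) \notin before k by rewrite inE /= ltnn.
have jx_inj : injective (fun i : 'I_m => inr (k, i) : 'I_N + 'I_N * 'I_m).
  by move=> i j [].
have step w : let c := dot (batch_mean g (xi k) (x k) w) (e k w)
      + mean_noise (xi k) (x k) (e k) z w + mean_noise (xi k) (x k) (e k) y w in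
    al * n%:R * (c * dot (x k w - xstar) (e k w)) <=
    2^-1 * ((al * n%:R * c) ^+ 2 * W (e k w)) + V k w - V k.+1 w.
  have := mirror_step hd xstar (W0 (e k w)) (maj (e k w)) (hx k w).
  by rewrite (dotC (x k w - xstar)).
have be0 : 0 <= al * n%:R by rewrite mulr_ge0 ?ler0n// ltW.
have lam0 : 0 < 4 * N%:R * al by rewrite mulr_gt0// mulr_gt0 ?ltr0n.
have [iV' EV'] := step_expectation ST SI Sm hindep mg mean_gradient_meas ig Eg
  inoise Enoise hm jxJ jx_inj (@Sxi k) (@hxi k) mxp iax (he k) (@Se k) jeJ
  (fun=> isT) mW W0 WM Wflip Wswap mz my zD yD mu iV (bregman_meas (ltn_ord k))
  (Vge0 k.+1) (dist_le_V k) be0 step lam0.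
split=> //.
have EW0 : 0 <= \int[Pr]_w W (e k w) by apply: Rintegral_ge0 => w _; exact: W0.
have EWr : \int[Pr]_w W (e k w) <= 2 * r.
  have ie : Pr.-integrable setT (EFin \o (fun w => evenpow k0 (e k w : 'rV[R]_n))).
    apply: (sphere_integrable (he k) (@evenpow_meas R n k0)) => u u1.
    by rewrite ger0_norm ?evenpow_ge0//; exact: evenpow_le_dim.
  rewrite /W Rint_add; [|exact: integrable_cst|exact: integrable_scale].
  rewrite Rint_cst Rint_scale//; apply: le_trans maj_le.
  by rewrite lerD2l ler_wpM2l// Rint_evenpow_le.
have isum (s t : Omega -> 'rV[R]_n) :
    (forall c, measurable_fun setT (fun w => s w 0 c)) ->
    (forall c, measurable_fun setT (fun w => t w 0 c)) ->
    (forall c, Pr.-integrable setT (EFin \o (fun w => s w 0 c ^+ 2))) ->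
    (forall c, Pr.-integrable setT (EFin \o (fun w => t w 0 c ^+ 2))) ->
    Pr.-integrable setT (EFin \o (fun w => dot (s w) (t w))).
  by move=> ms mt is_ it; apply: integrable_sumr => c; exact: integrable_mul_sqr.
have muO c : measurable_fun setT (fun w => (x k w - xstar) 0 c).
  exact: (past_measurable Sm (mu c)).
have iu c : Pr.-integrable setT (EFin \o (fun w => (x k w - xstar) 0 c ^+ 2)).
  apply: integrable_dominated (integrable_scale 2 iV) _.
    exact: measurable_funX.
  move=> w; rewrite ger0_norm ?sqr_ge0//.
  by apply: le_trans (coord_sqr_le _ _) _; exact: dist_le_V.
have Eaa : \int[Pr]_w dot (a (x k w)) (a (x k w)) <= 4 * L2 * \int[Pr]_w gap k w.
  by rewrite -Rint_scale//; apply: Rint_le => //; [exact: isum|exact: integrable_scale].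
have Eaa0 : 0 <= \int[Pr]_w dot (a (x k w)) (a (x k w)).
  by apply: Rintegral_ge0 => w _; exact: dot_ge0.
have Edu : \int[Pr]_w gap k w <= \int[Pr]_w dot (a (x k w)) (x k w - xstar).
  apply: Rint_le => //; first exact: isum.
  move=> w; have := f_ge (x k w) xstar.
  by rewrite -(opprB (x k w)) dotNr -[f xstar - _]opprB lerN2.
have m0R : 0 < m%:R :> R by rewrite ltr0n.
have N0R : 0 < N%:R :> R by rewrite ltr0n.
exact: (step_constants n0R N0R m0R r0 hL2 EW0 EWr Eaa0 Eaa Edu Dz0 (sqr_ge0 De)
  (sqr_ge0 sigma) (noise_budget Dz0 De0) erefl EV').
Qed.

Lemma V_int k : (k <= N)%N -> Pr.-integrable setT (EFin \o V k).
Proof.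
elim: k => [_|k IHk kN].
  have -> : V 0%N = fun=> bregman d x0 xstar by apply/funext => w; rewrite /V hx0.
  exact: integrable_cst.
exact: (@one_step (Ordinal kN) (IHk (ltnW kN))).1.
Qed.

Lemma gap_of_average w :
  f (N%:R^-1 *: \sum_(k < N) x k w) - f xstar <= N%:R^-1 * \sum_(k < N) gap k w.
Proof.
have N0R : 0 < N%:R :> R by rewrite ltr0n.
rewrite /gap sumrB sumr_const card_ord -[f xstar *+ N]mulr_natl mulrBr mulKf ?gt_eqF//.
by rewrite lerD2r; exact: (mean_value_le (x ^~ w) f_ge hN).
Qed.

(** The form of the bound in which only the two quadratic bounds on the objective
    and a dual norm majorant with mean at most [2 r] matter. *)
Lemma run_bound :
  ('E_Pr[fun w => f (N%:R^-1 *: \sum_(k < N) x k w)] - (f xstar)%:E <=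
   (384 * n%:R * r * L2 * bregman d x0 xstar / N%:R
    + 2 / L2 * (sigma ^+ 2 / m%:R)
    + n%:R / (12 * L2) * Dz
    + 4 * n%:R / (3 * L2) * De ^+ 2
    + 8 * Num.sqrt (2 * n%:R * bregman d x0 xstar) / N%:R * Q
    + N%:R / (3 * L2 * r) * Q ^+ 2)%:E)%E.
Proof.
have N0R : 0 < N%:R :> R by rewrite ltr0n.
have m0R : 0 < m%:R :> R by rewrite ltr0n.
have Q0 : 0 <= Q by rewrite addr_ge0 ?divr_ge0 ?sqrtr_ge0// mulr_ge0.
have igap (k : 'I_N) : Pr.-integrable setT (EFin \o gap k).
  by apply: gap_int; [exact: ltnW|apply: V_int; exact: ltnW].
pose avg w : 'rV[R]_n := N%:R^-1 *: \sum_(k < N) x k w.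
have mavg : measurable_fun setT (avg : Omega -> borel_rV R n).
  apply: measurable_to_borel_rV => c.
  have -> : (fun w => avg w 0 c) = (fun w => N%:R^-1 * \sum_(k < N) x k w 0 c).
    by apply/funext => w; rewrite /avg mxE summxE.
  apply: measurable_funM => //; apply: measurable_sum => k.
  by exact: (measurableT_comp (@measurable_coord R n c) (iterate_meas (ltnW (ltn_ord k)))).
have ibd : Pr.-integrable setT (EFin \o (fun w => N%:R^-1 * \sum_(k < N) gap k w)).
  by apply: integrable_scale; exact: integrable_sumr.
have iavg : Pr.-integrable setT (EFin \o (fun w => f (avg w) - f xstar)).
  apply: integrable_dominated ibd _.
    apply: measurable_funB => //.
    exact: (measurableT_comp (continuous_borel_measurable fcont) mavg).
  by move=> w; rewrite ger0_norm ?subr_ge0//; exact: gap_of_average.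
have iavg' : Pr.-integrable setT (EFin \o (fun w => f (avg w))).
  have := integrable_add iavg (integrable_cst Pr (f xstar)).
  by apply: eq_integrable => // w _ /=; rewrite subrK.
rewrite unlock (Rint_EFin iavg') -EFinB lee_fin.
rewrite -[f xstar](Rint_cst Pr) -Rint_sub//; last exact: integrable_cst.
apply: le_trans (Rint_le iavg ibd gap_of_average) _.
rewrite Rint_scale; last exact: integrable_sumr.
rewrite Rint_sum//.
pose S k := \int[Pr]_w gap k w; pose v k := \int[Pr]_w V k w.
have C0 : 0 <= al * C.
  have L0 := ltW hL2; have r1 := ltW r0; rewrite mulr_ge0 ?(ltW al0)//.
  by do !(exact: sqr_ge0 || exact: ler0n || by [] || apply: addr_ge0 ||
          apply: divr_ge0 || apply: mulr_ge0).
have := @recursion_bound R N v S (3 / 4 * al) (al * C) hN.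
rewrite mulr_ge0 ?(ltW al0)// => /(_ isT C0) H.
have Hrec : 3 / 4 * al * \sum_(k < N) S k <= 4 / 3 * (v 0%N + N%:R * (al * C)).
  apply: H => [k|k|k kN].
  - by apply: Rintegral_ge0 => w _; exact: bregman_ge0 hd _ _.
  - by apply: Rintegral_ge0 => w _; exact: gap_ge0.
  - by have [_ ] := @one_step (Ordinal kN) (V_int (ltnW kN)).
have v0E : v 0%N = bregman d x0 xstar.
  by rewrite /v /V; under eq_Rintegral do rewrite hx0; rewrite Rint_cst.
have al34 : 0 < 3 / 4 * al by rewrite mulr_gt0.
have T0 := bregman_ge0 hd x0 xstar.
apply: le_trans (final_constants n0R N0R m0R r0 hL2 T0 Dz0 (sqr_ge0 De)
  (sqr_ge0 sigma) Q0 erefl).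
rewrite mulrC ler_wpM2r ?invr_ge0 ?ler0n// -v0E.
by rewrite -[leLHS](mulKf (lt0r_neq0 al34)) ler_wpM2l ?invr_ge0 ?(ltW al34).
Qed.

End run.

(** * Oracle errors away from the sphere, and the bound *)

Section on_sphere.
Context {R : realType} {n : nat} {dX : measure_display} {X : measurableType dX}.
Context (P : probability X R) (u : 'rV[R]_n -> X -> 'rV[R]_n -> R).
Hypothesis mu : measurable_fun
  [set t : borel_rV R n * X * borel_rV R n | enorm (t.2 : 'rV[R]_n) = 1]
  (fun t => u t.1.1 t.1.2 t.2).

(** The oracle errors are controlled only for unit directions.  Extended by 0
    they are measurable and bounded in mean square for all directions, and on
    the run of the method nothing changes. *)
Definition on_sphere v t w : R := if enorm w == 1 then u v t w else 0.

Lemma sphere_measurable :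
  measurable [set t : borel_rV R n * X * borel_rV R n | enorm (t.2 : 'rV[R]_n) = 1].
Proof.
have ment : measurable_fun setT (fun w : borel_rV R n => enorm (w : 'rV[R]_n)).
  apply: continuous_borel_measurable => w.
  apply: (@continuous_comp _ _ _ (fun x : 'rV[R]_n => dot x x) Num.sqrt).
    exact: dot_sqr_continuous.
  exact: sqrt_continuous.
have := measurableT_comp ment (@measurable_snd _ _ (borel_rV R n * X)%type (borel_rV R n)).
move=> /(_ measurableT [set 1] (measurable_set1 _)); rewrite setTI.
by [].
Qed.

Lemma on_sphere_meas : measurable_fun setT
  (fun t : borel_rV R n * X * borel_rV R n => on_sphere t.1.1 t.1.2 t.2).
Proof.
have -> : (fun t : borel_rV R n * X * borel_rV R n => on_sphere t.1.1 t.1.2 t.2) =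
    (fun t => u t.1.1 t.1.2 t.2) \_
      [set t : borel_rV R n * X * borel_rV R n | enorm (t.2 : 'rV[R]_n) = 1].
  apply/funext => t; rewrite /on_sphere patchE.
  by case: eqP => h; [rewrite mem_set|rewrite memNset].
exact: (measurable_restrictT _ sphere_measurable).1.
Qed.

Lemma on_sphere_section_meas v w : enorm w = 1 -> measurable_fun setT (fun t => u v t w).
Proof.
move=> w1.
have -> : (fun t => u v t w) = (fun t => on_sphere v t w).
  by apply/funext => t; rewrite /on_sphere w1 eqxx.
have mp : measurable_fun setT (fun t : X => ((v : borel_rV R n, t), w : borel_rV R n)).
  by apply: measurable_fun_pair => //; exact: measurable_fun_pair.
exact: (measurableT_comp on_sphere_meas mp).
Qed.

Lemma on_sphere_sqr_le D : 0 <= D ->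
  (forall v w, enorm w = 1 -> (\int[P]_t ((u v t w) ^+ 2)%:E <= D%:E)%E) ->
  forall v w, (\int[P]_t ((on_sphere v t w) ^+ 2)%:E <= D%:E)%E.
Proof.
move=> D0 uD v w; rewrite /on_sphere; case: eqP => [/uD//|_].
by rewrite expr0n integral0 lee_fin.
Qed.

End on_sphere.

Theorem theorem2p3
  (R : realType) (n : nat) (hn : (8 <= n)%N)
  (dX : measure_display) (X : measurableType dX) (P : probability X R)
  (F : 'rV[R]_n -> X -> R) (g : 'rV[R]_n -> X -> 'rV[R]_n)
  (L : X -> R) (L2 : R) (hL2 : 0 < L2)
  (hF_int : forall x, P.-integrable setT (EFin \o F x))
  (hF : {ae P, forall xi, closed_function (F^~ xi) /\
     convex_function setT (F^~ xi) /\ has_gradient (F^~ xi) (g^~ xi)})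
  (hg_meas : measurable_fun setT
     (fun t : borel_rV R n * X => g t.1 t.2 : borel_rV R n))
  (hg_lip : {ae P, forall xi, forall x y : 'rV[R]_n,
     enorm (g x xi - g y xi) <= L xi * enorm (x - y)})
  (hL_meas : measurable_fun setT L)
  (hL : (sqrte 'E_P[fun xi => (L xi ^+ 2)%R] <= L2%:E)%E)
  (sigma : R)
  (hsigma : forall x, ('E_P[fun xi =>
     (enorm (g x xi - gradient (mean P F) x) ^+ 2)%R] <= (sigma ^+ 2)%:E)%E)
  (xstar : 'rV[R]_n) (hxstar : is_argmin (mean P F) xstar)
  (zeta eta : 'rV[R]_n -> X -> 'rV[R]_n -> R) (Dzeta Deta : R)
  (hzeta_meas : measurable_fun
     [set t : borel_rV R n * X * borel_rV R n | enorm (t.2 : 'rV[R]_n) = 1]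
     (fun t => zeta t.1.1 t.1.2 t.2))
  (heta_meas : measurable_fun
     [set t : borel_rV R n * X * borel_rV R n | enorm (t.2 : 'rV[R]_n) = 1]
     (fun t => eta t.1.1 t.1.2 t.2))
  (hzeta : forall x e, enorm e = 1 ->
     ('E_P[fun xi => (zeta x xi e ^+ 2)%R] <= Dzeta%:E)%E)
  (heta : forall x e, enorm e = 1 -> {ae P, forall xi, `|eta x xi e| <= Deta})
  (p : R) (q : \bar R) (hp : 1 <= p <= 2) (hpq : (p%:E^-1 + q^-1 = 1)%E)
  (d : 'rV[R]_n -> R) (hd : prox_function p d)
  (N m : nat) (hN : (1 <= N)%N) (hm : (1 <= m)%N)
  (dO : measure_display) (Omega : measurableType dO) (Pr : probability Omega R)
  (e : 'I_N -> {RV Pr >-> borel_rV R n}) (xi : 'I_N -> 'I_m -> {RV Pr >-> X})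
  (he : forall k, uniform_on_sphere (e k))
  (hxi : forall k i, has_law (xi k i) P)
  (hindep : mutually_independent Pr
     (fun j : 'I_N + 'I_N * 'I_m => match j with
        | inl k => preimage_set_system setT (e k) measurable
        | inr ki => preimage_set_system setT (xi ki.1 ki.2) measurable
        end))
  (x0 : 'rV[R]_n) (x : nat -> Omega -> 'rV[R]_n)
  (hx0 : forall w, x 0%N w = x0)
  (hx : forall (k : 'I_N) w, is_argmin
     (rdd_objective d (48 * n%:R * rho n q * L2)^-1
        (batch_gradient (oracle g zeta eta) (x k w) (fun i => xi k i w) (e k w))
        (x k w))
     (x k.+1 w)) :
  let Theta := bregman d x0 xstar in
  let xbar := fun w => N%:R^-1 *: \sum_(k < N) x k w in
  ('E_Pr[fun w => mean P F (xbar w)] - (mean P F xstar)%:E <=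
   (384 * n%:R * rho n q * L2 * Theta / N%:R
    + 2 / L2 * (sigma ^+ 2 / m%:R)
    + n%:R / (12 * L2) * Dzeta
    + 4 * n%:R / (3 * L2) * Deta ^+ 2
    + 8 * Num.sqrt (2 * n%:R * Theta) / N%:R * (Num.sqrt Dzeta / 2 + 2 * Deta)
    + N%:R / (3 * L2 * rho n q) * (Num.sqrt Dzeta / 2 + 2 * Deta) ^+ 2)%:E)%E.
Proof.
cbv zeta.
have n0 : (0 < n)%N by rewrite (leq_trans _ hn).
have [r0 [k0 [ca [cb [ca0 cb0 maj maj_le]]]]] := dual_norm_majorant hn hp hpq.
have gE := mean_gradientE hL2 hF_int hF hg_meas hg_lip hL_meas hL hsigma.
have inoise v := noise_sqr_int hg_meas hsigma v.
pose u0 : 'rV[R]_n := delta_mx 0 (Ordinal n0).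
have u01 : enorm u0 = 1 by rewrite /enorm dot_delta !mxE !eqxx sqrtr1.
have Dz0 : 0 <= Dzeta.
  rewrite -lee_fin; apply: le_trans (hzeta 0 u0 u01); rewrite unlock.
  by apply: integral_ge0 => t _; rewrite lee_fin sqr_ge0.
have De0 : 0 <= Deta := ae_bound_ge0 (heta 0 u0 u01).
have zD : forall v w, enorm w = 1 -> (\int[P]_t ((zeta v t w) ^+ 2)%:E <= Dzeta%:E)%E.
  by move=> v w w1; have := hzeta v w w1; rewrite unlock.
have yD v w : enorm w = 1 -> (\int[P]_t ((eta v t w) ^+ 2)%:E <= (Deta ^+ 2)%:E)%E.
  move=> w1; apply: integral_sqr_le_bound (heta v w w1).
  exact: (on_sphere_section_meas heta_meas).
apply: (run_bound n0 hL2
  (mean_ge hF_int hF hg_meas hsigma)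
  (mean_le hL2 hF_int hF hg_meas hg_lip hL_meas hL hsigma)
  hxstar hg_meas (gradient_coord_int hg_meas hsigma) _ _ _
  (on_sphere_meas hzeta_meas) (on_sphere_meas heta_meas)
  (on_sphere_sqr_le Dz0 zD) (on_sphere_sqr_le (sqr_ge0 _) yD) Dz0 De0
  hp hd r0 ca0 cb0 maj maj_le hN hm he hxi hindep hx0).
- by move=> v c; rewrite mxE.
- by move=> v; rewrite -gE; have [] := inoise v.
- by move=> v; rewrite -gE; have [] := inoise v.
move=> k w; have := hx k w; congr (is_argmin (rdd_objective _ _ _ _) _).
have ew1 := (he k).1 w.
rewrite /batch_gradient -scaler_suml scalerA; congr (_ *: _).
rewrite /stochastic_coef /mean_noise /oracle !big_split /= !mulrDr; congr (_ + _ + _).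
- by rewrite /batch_mean dotZl dot_suml.
- by congr (_ * _); apply: eq_bigr => i _; rewrite /on_sphere ew1 eqxx.
- by congr (_ * _); apply: eq_bigr => i _; rewrite /on_sphere ew1 eqxx.
Qed.
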